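(* Let $A$ be a self-adjoint operator with compact resolvent and simple eigenvalues $0<\mu_1<\mu_2<\cdots$ in $\mathcal H$, with normalized eigenvectors $\{\psi_n\}_{n\in\mathbb N}$, and let $v$ be a bounded sesquilinear form on $\mathcal D_a=\operatorname{Dom}(A^{1/2})$. Suppose that there is a sequence $\{\omega_j\}_{j\in\mathbb N}\subset[0,\infty)$ such that $$|v(\psi_j,\psi_k)|\le \omega_j\omega_k\quad (j,k\in\mathbb N),\qquad \sum_{j=1}^\infty\frac{\omega_j^2}{\mu_j}<\infty,$$ that $\sum_{n=1}^\infty \mu_n^{-p}<\infty$ for some $p>0$, and that $$\sum_{\substack{j=1\\ j\ne n}}^\infty\frac{\omega_j^2}{|\mu_n-\mu_j|}+\frac{\omega_n^2}{r_n}\longrightarrow 0,\qquad n\to\infty .$$ Let $T$ be the m-sectorial operator associated with the form $t=a+v$. Then there exist $N_0\in\mathbb N$ and $h_1,h_2>0$ such that $$\sigma(T)=\sigma_{\rm p}(T)\subset \Pi_0(N_0,h_1,h_2)\cup\bigcup_{k>N_0}\Pi_k .$$ With these $N_0,h_1,h_2$ and $\Pi_0=\Pi_0(N_0,h_1,h_2)$, the Riesz projections $$S_0=\frac1{2\pi i}\int_{\partial\Pi_0}(z-T)^{-1}dz,\qquad P_n=\frac1{2\pi i}\int_{\Gamma_n}(z-T)^{-1}dz,\quad n>N_0,$$ are well-defined and $$\operatorname{rank}S_0=\operatorname{rank}S_0^0=N_0,\qquad \operatorname{rank}P_n=\operatorname{rank}P_n^0=1,\quad n>N_0,$$ where $S_0^0,P_n^0$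 are the corresponding Riesz projections of $A$. Moreover, the system of projections $\{S_0\}\cup\{P_k\}_{k>N_0}$ is disjoint and complete.
   Context: $\mathbb N=\{1,2,3,\dots\}$. $\mathcal H$ is an infinite-dimensional separable Hilbert space; $\langle\cdot,\cdot\rangle$ and sesquilinear forms are linear in the first and antilinear in the second argument. $A$ is a self-adjoint operator in $\mathcal H$ with compact resolvent whose spectrum consists of simple eigenvalues $\{\mu_n\}_{n\in\mathbb N}\subset(0,\infty)$, ordered increasingly; $A\psi_n=\mu_n\psi_n$, $\|\psi_n\|=1$, so $\{\psi_n\}$ is an orthonormal basis of $\mathcal H$. $a(f,g)=\langle A^{1/2}f,A^{1/2}g\rangle$ is the form of $A$, and $\mathcal D_a$ is $\operatorname{Dom}(A^{1/2})$ with inner product $\langle A^{1/2}\cdot,A^{1/2}\cdot\rangle$. Under the first two conditions on $v$ and $\{\omega_j\}$ in the claim, the form $t=a+v$ with domain $\mathcal D_a$ is closed and sectorial; $T$ is the m-sectorial operator associated with it by the first representation theorem ($f\in\operatorname{Dom}(T)$, $Tf=h$ iff $f\in\mathcal D_a$ and $t(f,g)=\langle h,g\rangle$ for all $g\in\mathcal D_a$). It has compact resolvent. $\sigma_{\rm p}(T)$ is the set of eigenvalues of $T$. Gaps: $r_n^+=\mu_{n+1}-\mu_n$, $r_n^-=\mu_n-\mu_{n-1}$, and $r_n=\tfrac12\min\{r_n^-,r_n^+\}$ for $n>1$; $r_1=\tfrac12(\mu_2-\mu_1)$. Regions: $\Pi_0(N,h_1,h_2)=\{z\in\mathbb C: -h_1<\operatorname{Re}z\le\mu_N+r_N,\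 |\operatorname{Im}z|\le h_2\}$; for $k\in\mathbb N$, $\Pi_k$ is the open disc of radius $r_k$ centred at $\mu_k$, and $\Gamma_k=\partial\Pi_k$. Contours are positively oriented. ''Well-defined'' means that the contours lie in the resolvent set of $T$. Unperturbed projections: $S_0^0=\frac1{2\pi i}\int_{\partial\Pi_0}(z-A)^{-1}dz$, $P_n^0=\frac1{2\pi i}\int_{\Gamma_n}(z-A)^{-1}dz$. A system of projections $\{Q_j\}_{j\in J}$ is disjoint if $Q_jQ_k=\delta_{jk}Q_j$ for all $j,k\in J$; it is complete if $\langle Q_jx,y\rangle=0$ for all $x\in\mathcal H$, $j\in J$ implies $y=0$. *)

(* Defs.v *)
From HB Require Import structures.
From mathcomp Require Import all_boot all_order all_algebra.
From mathcomp Require Import sesquilinear complex.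
From mathcomp Require Import all_classical all_reals all_analysis.

Set Implicit Arguments.
Unset Strict Implicit.
Unset Printing Implicit Defensive.

Import Order.TTheory GRing.Theory Num.Theory.
Import numFieldNormedType.Exports.

Local Open Scope classical_set_scope.
Local Open Scope ring_scope.
Local Open Scope complex_scope.

(* Sequences indexed by {1, 2, ...} are functions on [nat] whose value at [0]
   is never used.

   A Hilbert space is a [completeNormedModType R[i]] with an inner product
   [ip : {dot H for Num.conj}] (linear in the first argument) inducing the
   norm.  The norm has values in [R[i]]; in the order of [R[i]], [x <= y] means
   that [y - x] is a nonnegative real, so norm inequalities are inequalities
   between reals. *)

Section Hilbert.
Variables (R : realType) (H : completeNormedModType R[i]).

Definition hilbert_norm (ip : {dot H for (@Num.conj R[i])}) : Prop :=
  forall x, ip x x = `|x| ^+ 2.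

Definition separable_hilbert : Prop := exists2 D : set H, countable D & dense D.

Definition has_dim (V : set H) (n : nat) : Prop :=
  exists e : 'I_n -> H,
    (forall c : 'I_n -> R[i], \sum_i c i *: e i = 0 -> forall i, c i = 0) /\
    V = [set x | exists c : 'I_n -> R[i], x = \sum_i c i *: e i].

Definition infinite_dimensional : Prop := forall n, ~ has_dim [set: H] n.

Definition has_rank (S : H -> H) (n : nat) : Prop := has_dim (range S) n.

Definition bounded_operator (S : H -> H) : Prop :=
  linear S /\ exists M : R, forall x, `|S x| <= M%:C * `|x|.

Definition compact_operator (S : H -> H) : Prop :=
  linear S /\ compact (closure (S @` [set x | `|x| <= 1])).

(* Unbounded operators: the values of [opfun] outside [dom] are irrelevant. *)
Record operator := Operator { dom : set H ; opfun :> H -> H }.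

Implicit Types (T A B : operator) (z : R[i]).

Definition linear_operator T : Prop :=
  dom T 0 /\
  forall (c : R[i]) f g, dom T f -> dom T g ->
    dom T (c *: f + g) /\ T (c *: f + g) = c *: T f + T g.

Definition is_resolvent T z (S : H -> H) : Prop :=
  [/\ bounded_operator S,
      forall h, dom T (S h) /\ z *: S h - T (S h) = h &
      forall f, dom T f -> S (z *: f - T f) = f].

Definition resolvent_set T : set R[i] := [set z | exists S, is_resolvent T z S].

Definition resolvent T z : H -> H := get (is_resolvent T z).

Definition op_spectrum T : set R[i] := ~` resolvent_set T.

Definition op_eigenspace T z : set H := [set f | dom T f /\ T f = z *: f].

Definition point_spectrum T : set R[i] :=
  [set z | exists2 f, op_eigenspace T z f & f != 0].

Definition simple_eigenvalue T z : Prop := has_dim (op_eigenspace T z) 1.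

Definition compact_resolvent T : Prop :=
  exists2 z, resolvent_set T z & compact_operator (resolvent T z).

Section InnerProduct.
Variable ip : {dot H for (@Num.conj R[i])}.

Definition self_adjoint A : Prop :=
  [/\ linear_operator A, dense (dom A) &
      forall f h, (dom A f /\ A f = h) <->
                  (forall g, dom A g -> ip (A g) f = ip g h)].

Definition nonnegative A : Prop := forall f, dom A f -> 0 <= ip (A f) f.

Definition is_sqrt A B : Prop :=
  [/\ self_adjoint B, nonnegative B,
      forall f, dom A f <-> dom B f /\ dom B (B f) &
      forall f, dom A f -> A f = B (B f)].

Definition sesquilinear_on (D : set H) (v : H -> H -> R[i]) : Prop :=
  (forall (c : R[i]) f f' g, D f -> D f' -> D g ->
     v (c *: f + f') g = c * v f g + v f' g) /\
  (forall (c : R[i]) f g g', D f -> D g -> D g' ->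
     v f (c *: g + g') = Num.conj c * v f g + v f g').

(* [v] is a bounded sesquilinear form on [dom B] equipped with the inner
   product [ip (B f) (B g)]. *)
Definition bounded_form B (v : H -> H -> R[i]) : Prop :=
  sesquilinear_on (dom B) v /\
  exists M : R, forall f g, dom B f -> dom B g ->
    `|v f g| <= M%:C * `|B f| * `|B g|.

Definition form_operator (D : set H) (t : H -> H -> R[i]) T : Prop :=
  forall f h, (dom T f /\ T f = h) <->
              (D f /\ forall g, D g -> t f g = ip h g).

Definition disjoint_system (J : set nat) (Q : nat -> H -> H) : Prop :=
  forall j k, J j -> J k ->
    forall x, Q j (Q k x) = if j == k then Q j x else 0.

Definition complete_system (J : set nat) (Q : nat -> H -> H) : Prop :=
  forall y, (forall j x, J j -> ip (Q j x) y = 0) -> y = 0.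

End InnerProduct.

(* [S] is the integral of the operator-valued function [F] along the path
   [gam], parametrized by [0, 1]: the Riemann-Stieltjes sums over tagged
   partitions converge to [S] in operator norm as the mesh goes to [0]. *)
Definition is_contour_integral (gam : R -> R[i]) (F : R[i] -> H -> H)
    (S : H -> H) : Prop :=
  forall eps : R, 0 < eps -> exists2 delta : R, 0 < delta &
    forall (n : nat) (t s : nat -> R),
      t 0%N = 0 -> t n = 1 ->
      (forall i, (i < n)%N ->
         t i <= s i <= t i.+1 /\ t i.+1 - t i < delta) ->
      forall x,
        `|\sum_(i < n) (gam (t i.+1) - gam (t i)) *: F (gam (s i)) x - S x|
          <= eps%:C * `|x|.

Definition is_riesz_projection T (gam : R -> R[i]) (S : H -> H) : Prop :=
  [/\ gam @` `[0, 1] `<=` resolvent_set T,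
      bounded_operator S &
      is_contour_integral gam (resolvent T)
        (fun x => (2 * pi%:C * 'i) *: S x)].

End Hilbert.

Section Regions.
Variables (R : realType) (mu : nat -> R).

Definition gap_radius (n : nat) : R :=
  if (n <= 1)%N then (mu 2%N - mu 1%N) / 2
  else Num.min (mu n - mu n.-1) (mu n.+1 - mu n) / 2.

Definition Pi0 (N : nat) (h1 h2 : R) : set R[i] :=
  [set z | - h1 < complex.Re z <= mu N + gap_radius N /\
           `|complex.Im z| <= h2].

Definition PiDisc (k : nat) : set R[i] :=
  [set z | `|z - (mu k)%:C| < (gap_radius k)%:C].

(* Boundaries of [PiDisc k] and [Pi0 N h1 h2], counterclockwise. *)
Definition Gamma (k : nat) (t : R) : R[i] :=
  (mu k + gap_radius k * cos (2 * pi * t)) +i*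
  (gap_radius k * sin (2 * pi * t)).

Definition rectangle (a b c d : R) (t : R) : R[i] :=
  if t <= 4^-1 then (a + 4 * t * (b - a)) +i* c
  else if t <= 2^-1 then b +i* (c + (4 * t - 1) * (d - c))
  else if t <= 3 / 4 then (b + (4 * t - 2) * (a - b)) +i* d
  else a +i* (d + (4 * t - 3) * (c - d)).

Definition Gamma0 (N : nat) (h1 h2 : R) : R -> R[i] :=
  rectangle (- h1) (mu N + gap_radius N) (- h2) h2.

End Regions.

(* Main.v *)
Require Import Defs.
From mathcomp Require Import all_boot all_order all_algebra.
From mathcomp Require Import sesquilinear complex.
From mathcomp Require Import all_classical all_reals all_analysis.
From mathcomp Require Import ring lra.

Set Implicit Arguments.
Unset Strict Implicit.
Unset Printing Implicit Defensive.

Import Order.TTheory GRing.Theory Num.Theory.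
Import numFieldNormedType.Exports.

Local Open Scope classical_set_scope.
Local Open Scope ring_scope.
Local Open Scope complex_scope.

(** Write [f_j] for the coordinates of [f] in the basis of eigenvectors. The
    bound on the entries of [v] means [|v (f, psi_k)| <= omega_k * s], where [s]
    is the sum of the [omega_j * |f_j|], and the equation [z f - T f = x] reads
    [(z - mu_k) f_k - v (f, psi_k) = x_k] for all [k]. It can be solved by
    iteration at each [z] where the sum of the [omega_j^2 / |z - mu_j|] is
    small ([solve_exists], [good_resolvent]). The gap condition provides such
    points: for large [n], the set of the [z] that keep from every other [mu_j]
    half its distance to [mu_n], and from [mu_n] half the gap radius, contains
    the circle of index [n] and all large rectangles whose right side passes
    through [mu_n + r_n]; and these sets cover the complement of one rectangle
    and of the following discs ([good_cover]). This locates the spectrum, which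
    consists of eigenvalues since the resolvent is a limit of operators of
    finite rank ([res_tail], [fredholm], [spectrum_point]).

    Contour integrals are handled without holomorphic functions. The resolvent
    identity gives
      [(b - c) R_a + (c - a) R_b + (a - b) R_c
         = (b - c) (c - a) (b - a) R_a R_b R_c],
    so the trapezoid rule around a small triangle has a defect of third order,
    and integrals over linearly homotopic closed paths agree ([homotopy]). The
    same argument applied to [(z - w)^-1] yields the winding numbers of circles
    and rectangles, and then the product rule for Riesz projections
    ([riesz_product]): they are idempotent, a larger rectangle absorbs the
    contours inside it, and exterior contours annihilate each other.

    The projections of [T] are compared with those of [A], which are coordinate
    projections. The pairing of the difference of the resolvents with two
    vectors [x], [y] is at most [2 b(x) b(y)], where [b(x)] is the sum of the
    [omega_j |x_j| / |z - mu_j|]. If [d_j] are the distances kept from the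
    eigenvalues and [eps] is the sum of the [omega_j^2 / d_j], then [b(x)^2] is
    at most [eps] times the sum of the [|x_j|^2 d_j / |z - mu_j|^2], and the
    integral of [d_j / |z - mu_j|^2] along the contour is bounded by an absolute
    constant, as for a Poisson kernel ([circ_majorant], [rect_majorant]). Hence
    the projections differ by at most [8 eps] in norm ([rp_diff]), and
    idempotents at distance less than [1] have the same rank ([rank_close]).

    Let [V_n] be the projection of [T] for a rectangle ending at [mu_n + r_n].
    The difference [V_(n+1) - V_n - P_(n+1)] is idempotent and of small norm,
    so it vanishes ([rect_succ]), and [V_n] is the sum of [S_0] and of the
    [P_k] with [N_0 < k <= n]. As [V_n] differs from the projection on the
    first [n] basis vectors by a norm that tends to [0], it converges strongly
    to the identity, and the system is complete ([spectral_decomposition]). *)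

(** * Real-valued norms, finite sums and sequential limits *)

Section RealNorm.
Context {R : realType}.
Implicit Types (a b : R[i]) (V : normedZmodType R[i]).

(** The norm of a complex normed space has values in [R[i]]; its real part
    makes norm estimates accessible to real arithmetic. *)
Definition nr {V : normedZmodType R[i]} (x : V) : R := complex.Re `|x|.

Lemma nrE V (x : V) : `|x| = (nr x)%:C.
Proof.
have := normr_ge0 x; rewrite /nr; case: (`|x|) => a b.
by rewrite lecE /= => /andP[/eqP ->].
Qed.

Lemma nr_le V (x : V) (c : R) : (`|x| <= c%:C) = (nr x <= c).
Proof. by rewrite nrE lecR. Qed.

Lemma nr_ge0 V (x : V) : 0 <= nr x.
Proof. by have := normr_ge0 x; rewrite nrE ler0c. Qed.

Lemma nr0 V : nr (0 : V) = 0.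
Proof. by rewrite /nr normr0. Qed.

Lemma nr_eq0 V (x : V) : nr x = 0 -> x = 0.
Proof. by move=> h; apply/eqP; rewrite -normr_eq0 nrE h. Qed.

Lemma nrD V (x y : V) : nr (x + y) <= nr x + nr y.
Proof. by rewrite -nr_le rmorphD /= -!nrE ler_normD. Qed.

Lemma nrN V (x : V) : nr (- x) = nr x.
Proof. by rewrite /nr normrN. Qed.

Lemma nrB V (x y : V) : nr (x - y) <= nr x + nr y.
Proof. by rewrite -(nrN y); exact: nrD. Qed.

Lemma nrC V (x y : V) : nr (x - y) = nr (y - x).
Proof. by rewrite /nr distrC. Qed.

Lemma nr_tri V (x y z : V) : nr (x - z) <= nr (x - y) + nr (y - z).
Proof. by apply: le_trans (nrD _ _); rewrite addrA subrK. Qed.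

Lemma nr_sum V (I : Type) (r : seq I) (P : pred I) (F : I -> V) :
  nr (\sum_(i <- r | P i) F i) <= \sum_(i <- r | P i) nr (F i).
Proof.
elim/big_ind2 : _ => [|x1 x2 y1 y2 h1 h2|//]; first by rewrite nr0.
by apply: le_trans (nrD _ _) _; rewrite lerD.
Qed.

Lemma nrM a b : nr (a * b) = nr a * nr b.
Proof. by apply: (@complexI R); rewrite rmorphM /= -!nrE normrM. Qed.

Lemma nrV a : nr a^-1 = (nr a)^-1.
Proof. by apply: (@complexI R); rewrite fmorphV /= -!nrE normfV. Qed.

Lemma nr_conj a : nr (Num.conj a) = nr a.
Proof. by rewrite /nr norm_conjC. Qed.

Lemma nrR (x : R) : nr x%:C = `|x|.
Proof. by rewrite /nr normc_def /= expr0n /= addr0 sqrtr_sqr. Qed.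

Lemma nr_sqr a : nr a ^+ 2 = complex.Re a ^+ 2 + complex.Im a ^+ 2.
Proof. by rewrite /nr normc_def /= sqr_sqrtr // addr_ge0 ?sqr_ge0. Qed.

Lemma nr_Re a : `|complex.Re a| <= nr a.
Proof. by rewrite -lecR -nrE normc_ge_Re. Qed.

Lemma nr_Im a : `|complex.Im a| <= nr a.
Proof.
rewrite -(@ler_pXn2r _ 2) ?nnegrE ?normr_ge0 ?nr_ge0 //.
by rewrite nr_sqr real_normK ?num_real // lerDr sqr_ge0.
Qed.

Lemma nr_ReIm a : nr a <= `|complex.Re a| + `|complex.Im a|.
Proof.
rewrite -(@ler_pXn2r _ 2) ?nnegrE ?addr_ge0 ?nr_ge0 //.
rewrite nr_sqr sqrrD !real_normK ?num_real // addrAC lerDl.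
by rewrite mulrn_wge0 // mulr_ge0.
Qed.

Lemma nrZ (U : normedModType R[i]) a (x : U) : nr (a *: x) = nr a * nr x.
Proof. by apply: (@complexI R); rewrite rmorphM /= -!nrE normrZ. Qed.

End RealNorm.

Section RealSums.
Context {R : realType}.

Lemma le_of_eq (a b : R) : a = b -> a <= b.
Proof. by move=> ->. Qed.

Lemma le_of_sqr (a b : R) : 0 <= b -> a ^+ 2 <= b ^+ 2 -> a <= b.
Proof.
move=> b0 h; apply: le_trans (ler_norm _) _.
by rewrite -(ger0_norm b0) -ler_sqr ?nnegrE ?normr_ge0 // !real_normK ?num_real.
Qed.

Lemma sum_mono m n (F : nat -> R) : (forall i, 0 <= F i) -> (m <= n)%N ->
  \sum_(i < m) F i <= \sum_(i < n) F i.
Proof.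
move=> h mn; rewrite -(subnKC mn) big_split_ord /= lerDl.
exact: sumr_ge0.
Qed.

Lemma sum_trunc (F : nat -> R) M n : (forall j, 0 <= F j) -> (forall j, (M <= j)%N -> F j = 0) ->
  \sum_(j < n) F j <= \sum_(j < M) F j.
Proof.
move=> F0 FM; apply: le_trans (sum_mono F0 (leq_maxr M n)) _.
rewrite -(subnKC (leq_maxl M n)) big_split_ord /= [X in _ + X]big1 ?addr0 // => j _.
by rewrite FM // leq_addr.
Qed.

Lemma cauchy_sum n (a b : nat -> R) :
  (\sum_(i < n) a i * b i) ^+ 2 <=
  (\sum_(i < n) a i ^+ 2) * (\sum_(i < n) b i ^+ 2).
Proof.
elim: n => [|n IH]; first by rewrite !big_ord0 expr0n mul0r.
rewrite !big_ord_recr /=.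
set S := \sum_(i < n) a i * b i in IH *.
have P0 : 0 <= \sum_(i < n) a i ^+ 2 by apply: sumr_ge0 => i _; exact: sqr_ge0.
have Q0 : 0 <= \sum_(i < n) b i ^+ 2 by apply: sumr_ge0 => i _; exact: sqr_ge0.
move: (\sum_(i < n) a i ^+ 2) (\sum_(i < n) b i ^+ 2) P0 Q0 IH => P Q P0 Q0 IH.
move: (a n) (b n) => x y.
suff: 2 * S * (x * y) <= P * y ^+ 2 + Q * x ^+ 2 by nra.
have h1 : (2 * S * (x * y)) ^+ 2 <= (P * y ^+ 2 + Q * x ^+ 2) ^+ 2.
  have : S ^+ 2 * (x * y) ^+ 2 <= P * Q * (x * y) ^+ 2 by rewrite ler_wpM2r ?sqr_ge0.
  have := sqr_ge0 (P * y ^+ 2 - Q * x ^+ 2); nra.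
have h2 : 0 <= P * y ^+ 2 + Q * x ^+ 2 by rewrite addr_ge0 // mulr_ge0 // sqr_ge0.
exact: le_of_sqr.
Qed.

Lemma cauchy_sum_le n (a b : nat -> R) (A B : R) : 0 <= A -> 0 <= B ->
  \sum_(i < n) a i ^+ 2 <= A ^+ 2 -> \sum_(i < n) b i ^+ 2 <= B ^+ 2 ->
  \sum_(i < n) a i * b i <= A * B.
Proof.
move=> A0 B0 ha hb; have := cauchy_sum n a b => h.
have h2 : (\sum_(i < n) a i * b i) ^+ 2 <= (A * B) ^+ 2.
  apply: le_trans h _; rewrite exprMn; apply: ler_pM => //; apply: sumr_ge0 => i _; exact: sqr_ge0.
have AB : 0 <= A * B by rewrite mulr_ge0.
exact: le_of_sqr.
Qed.

Lemma le_eps (x y : R) : (forall e, 0 < e -> x <= y + e) -> x <= y.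
Proof. by move=> h; apply/ler_addgt0Pr. Qed.

Lemma archi (x : R) : exists n : nat, x < n%:R.
Proof.
by exists (Num.truncn `|x|).+1; apply: le_lt_trans (ler_norm _) (truncnS_gt _).
Qed.

Lemma le_arch (x y C : R) : (forall n : nat, x <= y + C / n.+1%:R) -> x <= y.
Proof.
move=> h; apply: le_eps => e e0; have [n hn] := archi (`|C| / e).
apply: le_trans (h n) _; rewrite lerD2l.
rewrite ler_pdivrMr ?ltr0Sn //; apply: le_trans (ler_norm _) _.
rewrite mulrC -ler_pdivrMr //; apply: ltW; apply: lt_trans hn _.
by rewrite ltr_nat.
Qed.

End RealSums.

Section LinearMaps.
Context {R : realType} {V : lmodType R[i]}.

Definition lin (S : V -> V) : Prop := forall (a : R[i]) x y, S (a *: x + y) = a *: S x + S y.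

Variables (S : V -> V).
Hypothesis hS : lin S.

Lemma lin0 : S 0 = 0.
Proof. by have := hS (-1) 0 0; rewrite scaler0 addr0 scaleN1r addNr. Qed.
Lemma linZ a x : S (a *: x) = a *: S x.
Proof. by rewrite -[a *: x]addr0 hS lin0 addr0. Qed.
Lemma linD x y : S (x + y) = S x + S y.
Proof. by rewrite -[x in x + y]scale1r hS scale1r. Qed.
Lemma linB x y : S (x - y) = S x - S y.
Proof. by rewrite linD -scaleN1r linZ scaleN1r. Qed.
Lemma lin_sum n (F : 'I_n -> V) : S (\sum_i F i) = \sum_i S (F i).
Proof. by elim/big_ind2 : _ => [|? ? ? ? <- <-|//]; [exact: lin0|exact: linD]. Qed.

End LinearMaps.

Section Limits.
Context {R : realType} {V : normedModType R[i]}.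
Implicit Types (u w : nat -> V).

Definition tends u (l : V) : Prop :=
  forall e : R, 0 < e -> exists n0, forall n, (n0 <= n)%N -> nr (u n - l) <= e.

Lemma tends_uniq u l l' : tends u l -> tends u l' -> l = l'.
Proof.
move=> h h'; apply/eqP; rewrite -subr_eq0; apply/eqP; apply: nr_eq0.
apply/eqP; rewrite eq_le nr_ge0 andbT; apply: le_eps => e e0; rewrite add0r.
have e2 : 0 < e / 2 by rewrite divr_gt0.
have [n hn] := h _ e2; have [m hm] := h' _ e2.
apply: le_trans (nr_tri l (u (maxn n m)) l') _.
rewrite nrC [e]splitr; apply: lerD; [apply: hn|apply: hm];
  by rewrite ?leq_maxl ?leq_maxr.
Qed.

Lemma tends_cst l : tends (fun=> l) l.
Proof. by move=> e e0; exists 0%N => n _; rewrite subrr nr0 ltW. Qed.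

Lemma tends_eventually u l n0 : (forall n, (n0 <= n)%N -> u n = l) -> tends u l.
Proof. by move=> h e e0; exists n0 => n /h ->; rewrite subrr nr0 ltW. Qed.

Lemma tends_ext u w l : (forall n, u n = w n) -> tends u l -> tends w l.
Proof. by move=> h hu e /hu[n0 hn]; exists n0 => n /hn; rewrite h. Qed.

Lemma tends_nr_le u l (M : R) n1 : tends u l -> (forall n, (n1 <= n)%N -> nr (u n) <= M) -> nr l <= M.
Proof.
move=> h hM; apply: le_eps => e /h[n0 hn].
have := hn (maxn n0 n1) (leq_maxl _ _) => h1; have := hM (maxn n0 n1) (leq_maxr _ _).
have := nr_tri l (u (maxn n0 n1)) 0; rewrite !subr0 nrC; lra.
Qed.

Lemma tendsD u w l l' : tends u l -> tends w l' -> tends (fun n => u n + w n) (l + l').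
Proof.
move=> h h' e e0; have e2 : 0 < e / 2 by rewrite divr_gt0.
have [n hn] := h _ e2; have [m hm] := h' _ e2; exists (maxn n m) => k.
rewrite geq_max => /andP[/hn h1 /hm h2]; rewrite opprD addrACA.
by apply: le_trans (nrD _ _) _; rewrite [e]splitr lerD.
Qed.

Lemma tends_lin (W : normedModType R[i]) (f : V -> W) u l (M : R) :
  (forall x y, nr (f x - f y) <= M * nr (x - y)) -> tends u l ->
  forall e : R, 0 < e -> exists n0, forall n, (n0 <= n)%N -> nr (f (u n) - f l) <= e.
Proof.
move=> hf h e e0; have M0 : 0 < `|M| + 1 by rewrite ltr_wpDl.
have [n0 hn] := h (e / (`|M| + 1)) (divr_gt0 e0 M0); exists n0 => n /hn h1.
apply: le_trans (hf _ _) _; apply: (@le_trans _ _ ((`|M| + 1) * nr (u n - l))).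
  by rewrite ler_wpM2r ?nr_ge0 //; have := ler_norm M; lra.
by rewrite -ler_pdivlMl // mulrC.
Qed.

Lemma tendsZ (a : R[i]) u l : tends u l -> tends (fun n => a *: u n) (a *: l).
Proof.
apply: (@tends_lin V (fun x => a *: x) u l (nr a)) => x y.
by rewrite -scalerBr nrZ.
Qed.

Lemma tends_sub (k : nat -> nat) u l : (forall n, (n <= k n)%N) -> tends u l ->
  tends (fun n => u (k n)) l.
Proof.
by move=> hk h e /h[n0 hn]; exists n0 => n hle; apply: hn; exact: leq_trans hle (hk n).
Qed.

Lemma tends_near u w l : tends u l ->
  (forall e : R, 0 < e -> exists n0, forall n, (n0 <= n)%N -> nr (u n - w n) <= e) ->
  tends w l.
Proof.
move=> h h' e e0; have e2 : 0 < e / 2 by rewrite divr_gt0.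
have [n hn] := h _ e2; have [m hm] := h' _ e2; exists (maxn n m) => k.
rewrite geq_max => /andP[/hn h1 /hm h2].
apply: le_trans (nr_tri _ (u k) _) _; rewrite [e]splitr lerD // nrC //.
Qed.

End Limits.

(** The form in which [tends_near] is applied: a discretization error of order
    [1 / n]. *)
Lemma near_inv {R : realType} {V : normedModType R[i]} (u w : nat -> V) (C : R) :
  (forall n, nr (u n - w n) <= C / n.+1%:R) ->
  forall e : R, 0 < e -> exists n0, forall n, (n0 <= n)%N -> nr (u n - w n) <= e.
Proof.
move=> h e e0; have [n0 hn] := archi (`|C| / e); exists n0 => n nn.
apply: le_trans (h n) _; rewrite ler_pdivrMr ?ltr0Sn //.
apply: le_trans (ler_norm _) _; rewrite mulrC -ler_pdivrMr //; apply: ltW.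
apply: lt_le_trans hn _; rewrite ler_nat; exact: leq_trans nn (leqnSn _).
Qed.

Lemma cauchy_tends {R : realType} {V : completeNormedModType R[i]} (u : nat -> V) :
  (forall e : R, 0 < e -> exists n0, forall m n, (n0 <= m)%N -> (n0 <= n)%N ->
     nr (u m - u n) <= e) -> exists l, tends u l.
Proof.
move=> h.
have : cauchy (u @ \oo).
  apply/cauchyP => /= eps eps0.
  have epsE : eps = (complex.Re eps)%:C by apply/esym/RRe_real/gtr0_real.
  have e0 : 0 < complex.Re eps / 2 by rewrite divr_gt0 // -ltcR -epsE.
  have [n0 hn] := h _ e0; exists (u n0); exists n0 => // m /= hm.
  rewrite -ball_normE /ball_ /= epsE nrE ltcR.
  apply: le_lt_trans (hn _ _ (leqnn _) hm) _.
  by move: e0; lra.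
move/cauchy_cvg => /cvg_ex[l hc]; exists l => e e0.
have e0' : 0 < e%:C by rewrite ltcR.
have /cvgr_dist_lt /(_ _ e0') [n0 _ hn] := hc; exists n0 => n nn.
by have := hn n nn; rewrite /= nrE ltcR nrC => /ltW.
Qed.

Lemma fixpoint {R : realType} {V : completeNormedModType R[i]} (f : V -> V) (q : R) :
  0 <= q < 1 -> (forall x y, nr (f x - f y) <= q * nr (x - y)) -> exists x, f x = x.
Proof.
move=> /andP[q0 q1] hf; pose u n := iter n f 0; pose d := nr (u 1%N - u 0%N).
have step n : nr (u n.+1 - u n) <= q ^+ n * d.
  elim: n => [|n IH]; first by rewrite expr0 mul1r.
  by apply: le_trans (hf _ _) _; rewrite exprS -mulrA ler_wpM2l.
have q1' : 0 < 1 - q by rewrite subr_gt0.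
have far n k : nr (u (n + k)%N - u n) <= q ^+ n * d / (1 - q).
  have : nr (u (n + k)%N - u n) <= q ^+ n * d * (1 - q ^+ k) / (1 - q).
    elim: k => [|k IH]; first by rewrite addn0 subrr nr0 expr0 subrr mulr0 mul0r.
    apply: le_trans (nr_tri _ (u (n + k)%N) _) _.
    rewrite addnS; apply: le_trans (lerD (step _) IH) _.
    rewrite ler_pdivlMr // mulrDl divfK ?gt_eqF // exprD exprS; lra.
  move=> h; apply: le_trans h _; rewrite ler_pM2r ?invr_gt0 //.
  rewrite ler_piMr // ?mulr_ge0 ?exprn_ge0 ?nr_ge0 //.
  by rewrite lerBlDr lerDl exprn_ge0.
have small (e : R) : 0 < e -> exists n0, forall n, (n0 <= n)%N -> q ^+ n * d / (1 - q) <= e.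
  move=> e0; have d0 : 0 <= d by exact: nr_ge0.
  have e1 : 0 < e * (1 - q) / (d + 1) by rewrite divr_gt0 ?mulr_gt0 // ltr_wpDl.
  have hq : `|q| < 1 by rewrite ger0_norm.
  have /cvgr_dist_lt /(_ _ e1) [n0 _ hn] := cvg_expr hq.
  exists n0 => n nn; have := hn n nn; rewrite /= sub0r normrN ger0_norm ?exprn_ge0 // => h.
  rewrite ler_pdivrMr //; apply: le_trans (_ : q ^+ n * (d + 1) <= _).
    by rewrite ler_wpM2l ?exprn_ge0 // lerDl.
  by rewrite -ler_pdivlMr ?ltr_wpDl // ltW.
have [|l hl] := @cauchy_tends _ _ u.
  move=> e e0; have [n0 hn] := small (e / 2) (divr_gt0 e0 (ltr0Sn _ 1)).
  exists n0 => m n hm hn'.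
  apply: le_trans (nr_tri _ (u n0) _) _; rewrite [e]splitr lerD //.
    by rewrite -(subnKC hm); apply: le_trans (far _ _) _; exact: hn.
  by rewrite nrC -(subnKC hn'); apply: le_trans (far _ _) _; exact: hn.
exists l; apply: (@tends_uniq _ _ (fun n => u n.+1)); last exact: (tends_sub (fun n => leqnSn n) hl).
exact: (@tends_lin _ _ _ f u l q).
Qed.

(** * Riemann sums along Lipschitz paths *)

Section ContourIntegral.
Context {R : realType}.

Definition lip {V : normedZmodType R[i]} (g : R -> V) (C : R) : Prop :=
  forall s t, 0 <= s <= 1 -> 0 <= t <= 1 -> nr (g s - g t) <= C * `|s - t|.

Definition node (n i : nat) : R := i%:R / n.+1%:R.

Lemma node0 n : node n 0 = 0. Proof. by rewrite /node mul0r. Qed.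

Lemma node1 n : node n n.+1 = 1. Proof. by rewrite /node divff. Qed.

Lemma node_in n i : (i <= n.+1)%N -> 0 <= node n i <= 1.
Proof.
by move=> h; rewrite /node divr_ge0 //= ler_pdivrMr ?ltr0Sn // mul1r ler_nat.
Qed.

Lemma node_step n i : node n i.+1 - node n i = n.+1%:R^-1.
Proof. by rewrite /node -mulrBl -natrB // subSnn mul1r. Qed.

Lemma lip_step {V : normedZmodType R[i]} (g : R -> V) C n i : lip g C -> (i <= n)%N ->
  nr (g (node n i.+1) - g (node n i)) <= C / n.+1%:R.
Proof.
move=> hg hi; apply: le_trans (hg _ _ (node_in _) (node_in _)) _ => //; first exact: leqW.
by rewrite node_step ger0_norm.
Qed.

Lemma lip_ge0 {V : normedZmodType R[i]} (g : R -> V) C : lip g C -> 0 <= C.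
Proof.
move=> /(_ 0 1); rewrite sub0r normrN normr1 mulr1 !lexx ler01 => /(_ isT isT).
exact/le_trans/nr_ge0.
Qed.

Section Existence.
Context {V : completeNormedModType R[i]}.
Implicit Types (gam : R -> R[i]) (F : R -> V).

Definition left_sum gam F n : V :=
  \sum_(i < n.+1) (gam (node n i.+1) - gam (node n i)) *: F (node n i).

(** For Lipschitz data the limit of uniform left sums determines the limit of
    all tagged sums, see [int_partition]. *)
Definition is_int gam F I := tends (left_sum gam F) I.

(** Each node of the uniform partition is attributed to the cell of [t] that
    contains it. On a cell of length [l] the two sums differ by
    [A * L * (l + 1 / m) ^ 2] from the variation of [F], plus an error of
    order [1 / m] at the ends of the cell; for a fixed partition, the errors
    other than [A * L * d] vanish as [m] grows. *)
Lemma rs_approx gam F (A L B d : R) (n : nat) (t s : nat -> R) :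
  lip gam A -> lip F L -> (forall x, 0 <= x <= 1 -> nr (F x) <= B) ->
  t 0%N = 0 -> t n = 1 ->
  (forall i, (i < n)%N -> t i <= s i <= t i.+1 /\ t i.+1 - t i <= d) -> 0 <= d ->
  forall m, nr (\sum_(i < n) (gam (t i.+1) - gam (t i)) *: F (s i) - left_sum gam F m) <=
    A * L * d + (A * L * (1 + d * n%:R + n%:R) + 2 * n%:R * A * B) / m.+1%:R.
Proof.
move=> hg hF hB t0 tn hs d0 m.
have A0 := lip_ge0 hg; have L0 := lip_ge0 hF.
have B0 : 0 <= B by apply: le_trans (hB 0 _); rewrite ?nr_ge0 // lexx ler01.
have M0 : 0 < m.+1%:R :> R by rewrite ltr0Sn.
have M1 : 1 <= m.+1%:R :> R by rewrite ler1n.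
move ME: (m.+1%:R : R) M0 M1 => M M0 M1.
(* index of the last uniform node not exceeding [x] *)
pose k x := Num.truncn (x * M).
have tle i j : (i <= j)%N -> (j <= n)%N -> t i <= t j.
  move=> ij; rewrite -(subnKC ij); elim: (j - i)%N => [|r IH]; first by rewrite addn0.
  rewrite addnS => hr; apply: le_trans (IH (ltnW hr)) _.
  by have [/andP[h1 h2] _] := hs _ hr; exact: le_trans h1 h2.
have tin i : (i <= n)%N -> 0 <= t i <= 1.
  by move=> hi; rewrite -{1}t0 -tn !tle.
have klo x : 0 <= x -> node m (k x) <= x.
  by move=> x0; rewrite /node ME ler_pdivrMr // truncn_le // mulr_ge0 // ltW.
have khi x : x <= node m (k x) + M^-1.
  rewrite /node ME.
  have -> : (k x)%:R / M + M^-1 = (k x).+1%:R / M by rewrite -natr1 mulrDl mul1r.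
  rewrite ler_pdivlMr //.
  by apply: ltW; exact: truncnS_gt.
have kmono x y : 0 <= x -> x <= y -> (k x <= k y)%N.
  by move=> x0 xy; apply: le_truncn; rewrite ler_pM2r.
have k1 : k 1 = m.+1 by rewrite /k mul1r -ME natrK.
have k0 : k 0 = 0%N by rewrite /k mul0r truncn0.
have kin x : 0 <= x <= 1 -> (k x <= m.+1)%N.
  by move=> /andP[x0 x1]; rewrite -k1 kmono.
pose E j : V := (gam (node m j.+1) - gam (node m j)) *: F (node m j).
(* contribution of one cell *)
have loc a b x : 0 <= a -> a <= x -> x <= b -> b <= 1 ->
    nr ((gam b - gam a) *: F x - \sum_(k a <= j < k b) E j) <=
    A * L * (b - a + M^-1) ^+ 2 + 2 * A * B / M.
  move=> a0 ax xb b1.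
  have ain : 0 <= a <= 1 by rewrite a0; apply: le_trans b1; lra.
  have bin : 0 <= b <= 1 by rewrite b1 andbT; apply: le_trans a0 _; lra.
  have xin : 0 <= x <= 1 by apply/andP; split; lra.
  have kab : (k a <= k b)%N by apply: kmono => //; lra.
  have -> : (gam b - gam a) *: F x - \sum_(k a <= j < k b) E j =
     ((gam b - gam (node m (k b))) - (gam a - gam (node m (k a)))) *: F x -
     \sum_(k a <= j < k b) (gam (node m j.+1) - gam (node m j)) *: (F (node m j) - F x).
    have -> : \sum_(k a <= j < k b) (gam (node m j.+1) - gam (node m j)) *: (F (node m j) - F x)
     = \sum_(k a <= j < k b) E j - (gam (node m (k b)) - gam (node m (k a))) *: F x.
      rewrite -(telescope_sumr (fun j => gam (node m j)) kab) scaler_suml -sumrB.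
      by apply: eq_bigr => j _; rewrite -scalerBr.
    rewrite [- (_ - _ *: _)]opprB addrA; congr (_ - _).
    by rewrite -scalerDl; congr (_ *: _); ring.
  apply: le_trans (nrB _ _) _; rewrite [leRHS]addrC; apply: lerD.
    rewrite nrZ; apply: le_trans (_ : (A / M + A / M) * B <= _); last by apply: le_of_eq; ring.
    apply: ler_pM; rewrite ?nr_ge0 //; last exact: hB.
    have ptk y : 0 <= y <= 1 -> nr (gam y - gam (node m (k y))) <= A / M.
      move=> yin; apply: le_trans (hg _ _ yin _) _; first exact/node_in/kin.
      rewrite ler_wpM2l //; have := klo y; have := khi y; case/andP: yin => y0 _.
      by move=> h1 /(_ y0) h2; rewrite ger0_norm ?subr_ge0 // lerBlDl.
    by apply: le_trans (nrB _ _) _; rewrite lerD ?ptk.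
  apply: le_trans (nr_sum _ _ _) _.
  have hM : 0 <= b - a + M^-1 by apply: addr_ge0; [lra|rewrite invr_ge0 ltW].
  apply: (@le_trans _ _ (\sum_(k a <= j < k b) A / M * (L * (b - a + M^-1)))).
    rewrite big_nat_cond [leRHS]big_nat_cond; apply: ler_sum => j /andP[/andP[j1 j2] _].
    have jm : (j < m.+1)%N by apply: leq_trans j2 (kin _ bin).
    rewrite nrZ; apply: ler_pM; rewrite ?nr_ge0 //; first by rewrite -ME; exact: lip_step.
    apply: le_trans (hF _ _ (node_in (ltnW jm)) xin) _; rewrite ler_wpM2l //.
    have h1 : node m (k a) <= node m j by rewrite /node ME ler_pM2r ?invr_gt0 // ler_nat.
    have h2 : node m j <= node m (k b) by rewrite /node ME ler_pM2r ?invr_gt0 // ler_nat ltnW.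
    have h3 := khi a; have h4 : node m (k b) <= b by apply: klo; case/andP: bin.
    have h6 : 0 < M^-1 by rewrite invr_gt0.
    by rewrite ler_norml; apply/andP; split; lra.
  rewrite big_const_nat iter_addr_0 -mulr_natr.
  have h5 : (k b - k a)%:R / M <= b - a + M^-1.
    rewrite natrB // mulrBl.
    have h3 := khi a; have h4 : node m (k b) <= b by apply: klo; case/andP: bin.
    by move: h3 h4; rewrite /node ME; lra.
  rewrite (_ : A / M * _ * _ = A * L * ((b - a + M^-1) * ((k b - k a)%:R / M))); last by ring.
  by rewrite expr2 !ler_wpM2l // mulr_ge0.
have split_ r : (r <= n)%N -> \sum_(0 <= j < k (t r)) E j =
    \sum_(i < r) \sum_(k (t i) <= j < k (t i.+1)) E j.
  elim: r => [|r IH] hr; first by rewrite t0 k0 big_ord0 big_geq.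
  rewrite big_ord_recr /= -IH ?(ltnW hr) // -big_cat_nat //.
  by apply: kmono; [case/andP: (tin r (ltnW hr))|exact: tle].
have -> : left_sum gam F m = \sum_(i < n) \sum_(k (t i) <= j < k (t i.+1)) E j.
  by rewrite -split_ // tn k1 big_mkord.
rewrite -sumrB; apply: le_trans (nr_sum _ _ _) _.
apply: (@le_trans _ _ (\sum_(i < n) (A * L * (d + M^-1) * (t i.+1 - t i) + (A * L * (d + M^-1) / M + 2 * A * B / M)))).
  apply: ler_sum => -[i hi] _ /=.
  have [/andP[h1 h2] h3] := hs i hi.
  have /andP[h4 _] := tin i (ltnW hi); have /andP[_ h5] := tin _ hi.
  apply: le_trans (loc _ _ _ h4 h1 h2 h5) _; rewrite addrA lerD2r.
  move dE: (t i.+1 - t i) h3 => dd h3.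
  have dd0 : 0 <= dd by rewrite -dE subr_ge0; exact: le_trans h1 h2.
  have -> : A * L * (d + M^-1) * dd + A * L * (d + M^-1) / M = A * L * ((d + M^-1) * (dd + M^-1)) by ring.
  rewrite ler_wpM2l ?mulr_ge0 // expr2.
  have Mi : 0 < M^-1 by rewrite invr_gt0.
  nra.
rewrite big_split /= sumr_const card_ord -mulr_sumr.
have -> : \sum_(i < n) (t i.+1 - t i) = 1.
  by rewrite -(big_mkord xpredT (fun i => t i.+1 - t i)) telescope_sumr // tn t0 subr0.
rewrite mulr1 -[X in _ + X <= _]mulr_natl.
have Mi : 0 < M^-1 by rewrite invr_gt0.
have Mi1 : M^-1 <= 1 by rewrite invf_le1.
rewrite -subr_ge0.
have -> : A * L * d + (A * L * (1 + d * n%:R + n%:R) + 2 * n%:R * A * B) / M -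
  (A * L * (d + M^-1) + n%:R * (A * L * (d + M^-1) / M + 2 * A * B / M)) =
  A * L * n%:R * M^-1 * (1 - M^-1) by ring.
by rewrite !mulr_ge0 ?subr_ge0 // ltW.
Qed.

Lemma lip_bound F L : lip F L -> forall x, 0 <= x <= 1 -> nr (F x) <= nr (F 0) + L.
Proof.
move=> hF x xin; have := hF x 0 xin; rewrite lexx ler01 => /(_ isT) h.
have := nr_tri (F x) (F 0) 0; rewrite !subr0 => h2; apply: le_trans h2 _.
rewrite addrC lerD2l; apply: le_trans h _; rewrite subr0 ler_piMr ?(lip_ge0 hF) //.
by case/andP: xin => x0 x1; rewrite ger0_norm.
Qed.

Lemma left_sum_dist gam F A L n n' : lip gam A -> lip F L ->
  nr (left_sum gam F n - left_sum gam F n') <= A * L / n.+1%:R + A * L / n'.+1%:R.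
Proof.
move=> hg hF; pose B := nr (F 0) + L.
have key r : exists K, forall m, nr (left_sum gam F r - left_sum gam F m) <= A * L / r.+1%:R + K / m.+1%:R.
  eexists => m; apply: (rs_approx (B := B) (t := node r) (s := node r) hg hF);
    rewrite ?node0 ?node1 ?invr_ge0 //; first exact: lip_bound.
  move=> i hi; rewrite node_step lexx; split => //=; rewrite -subr_ge0 node_step invr_ge0 //.
have [K hK] := key n; have [K' hK'] := key n'.
apply: (@le_arch _ _ _ (K + K')) => m.
have := nr_tri (left_sum gam F n) (left_sum gam F m) (left_sum gam F n').
rewrite (nrC (left_sum gam F m)) [(K + K') / _]mulrDl => h1.
apply: le_trans h1 _; apply: le_trans (lerD (hK m) (hK' m)) _.
by rewrite addrACA.
Qed.

Lemma int_exists gam F A L : lip gam A -> lip F L -> exists I, is_int gam F I.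
Proof.
move=> hg hF; have A0 := lip_ge0 hg; have L0 := lip_ge0 hF.
apply: cauchy_tends => e e0; have [N hN] := archi (2 * (A * L) / e).
exists N => m n hm hn; apply: le_trans (left_sum_dist _ _ hg hF) _.
have small r : (N <= r)%N -> A * L / r.+1%:R <= e / 2.
  move=> hr; rewrite ler_pdivrMr ?ltr0Sn //.
  have : N%:R <= r.+1%:R :> R by rewrite ler_nat; exact: leq_trans hr (leqnSn _).
  move: hN; rewrite ltr_pdivrMr //; nra.
by rewrite [e]splitr lerD ?small.
Qed.

Lemma int_partition gam F A L I (n : nat) (t s : nat -> R) (d : R) :
  lip gam A -> lip F L -> is_int gam F I ->
  t 0%N = 0 -> t n = 1 ->
  (forall i, (i < n)%N -> t i <= s i <= t i.+1 /\ t i.+1 - t i <= d) -> 0 <= d ->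
  nr (\sum_(i < n) (gam (t i.+1) - gam (t i)) *: F (s i) - I) <= A * L * d.
Proof.
move=> hg hF hI t0 tn hs d0.
have [K h] : exists K, forall m, nr (\sum_(i < n) (gam (t i.+1) - gam (t i)) *: F (s i) - left_sum gam F m) <= A * L * d + K / m.+1%:R.
  by eexists => m; exact: (rs_approx hg hF (lip_bound hF) t0 tn hs d0).
apply: le_eps => e e0; have e2 : 0 < e / 2 by rewrite divr_gt0.
have [n0 hn] := hI _ e2; have [N hN] := archi (`|K| / (e / 2)).
pose m := maxn n0 N; apply: le_trans (nr_tri _ (left_sum gam F m) _) _.
have h1 := hn m (leq_maxl _ _); have h2 := h m.
have : K / m.+1%:R <= e / 2.
  rewrite ler_pdivrMr ?ltr0Sn //; apply: le_trans (ler_norm _) _.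
  rewrite mulrC -ler_pdivrMr //; apply: ltW; apply: lt_le_trans hN _.
  by rewrite ler_nat; apply: leq_trans (leqnSn _); exact: leq_maxr.
move=> h3; apply: le_trans (lerD h2 h1) _.
by rewrite -addrA lerD2l [leRHS]splitr lerD.
Qed.

End Existence.

(** * Homotopy invariance *)

Section Homotopy.
Context {V : completeNormedModType R[i]}.
Implicit Types (f : R[i] -> V) (g : R -> R[i]).

(** Twice the trapezoid rule around the triangle [a], [b], [c], see [trapE].
    For resolvents it is of third order in the size of the triangle, which
    replaces holomorphy below. *)
Definition trapezoid_defect f (a b c : R[i]) : V := (b - c) *: f a + (c - a) *: f b + (a - b) *: f c.

Let E f (a b : R[i]) : V := (b - a) *: (f a + f b).

Lemma trapE f a b c : E f a b + E f b c + E f c a = trapezoid_defect f a b c.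
Proof.
rewrite /E /trapezoid_defect.
have aux (u w t : R[i]) (X Y Z : V) : u *: (X + Y) + w *: (Y + Z) + t *: (Z + X) =
    (u + t) *: X + (u + w) *: Y + (w + t) *: Z.
  by rewrite !scalerDr !scalerDl [LHS](AC (2*2*2) ((1*6)*(2*3)*(4*5))).
by rewrite aux; congr (_ *: _ + _ *: _ + _ *: _); ring.
Qed.

(** A linear homotopy between closed paths is cut into a grid of [n ^ 2]
    cells, each made of two triangles. The trapezoid sums of two neighbouring
    rows differ by the defects of the triangles between them, of order
    [n ^ -3] each, so the sums for [g0] and [g1] differ by [O (1 / n)]. *)
Lemma homotopy f g0 g1 (D : set R[i]) (A L K : R) I :
  lip g0 A -> lip g1 A -> g0 0 = g0 1 -> g1 0 = g1 1 ->
  (forall s t, 0 <= s <= 1 -> 0 <= t <= 1 -> D (g0 t + s%:C * (g1 t - g0 t))) ->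
  (forall a b, D a -> D b -> nr (f a - f b) <= L * nr (a - b)) ->
  (forall a b c, D a -> D b -> D c ->
     nr (trapezoid_defect f a b c) <= K * (nr (a - b) * nr (b - c) * nr (c - a))) ->
  is_int g0 (f \o g0) I -> is_int g1 (f \o g1) I.
Proof.
move=> hg0 hg1 c0 c1 hD hL hK; have A0 := lip_ge0 hg0.
pose W := A + A + nr (g1 0 - g0 0).
have hW t : 0 <= t <= 1 -> nr (g1 t - g0 t) <= W.
  move=> tin; have h0 : (0 <= 0 :> R) && (0 <= 1 :> R) by rewrite lexx ler01.
  have h1 := hg0 0 t h0 tin; have h2 := hg1 t 0 tin h0.
  have tn : `|t| <= 1 by case/andP: tin => t0 t1; rewrite ger0_norm.
  have -> : g1 t - g0 t = (g1 t - g1 0) + (g0 0 - g0 t) + (g1 0 - g0 0) by ring.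
  apply: le_trans (nrD _ _) _; rewrite /W lerD2r; apply: le_trans (nrD _ _) _.
  apply: lerD; [apply: le_trans h2 _|apply: le_trans h1 _];
   by rewrite ?subr0 ?sub0r ?normrN ler_piMr.
have [l [Al Wl l0]] : exists l, [/\ A <= l, W <= l & 0 <= l].
  have W0 : 0 <= W by rewrite !addr_ge0 ?nr_ge0.
  by exists (A + W); split; [rewrite lerDl|rewrite lerDr|exact: addr_ge0].
pose h (s t : R) := g0 t + s%:C * (g1 t - g0 t).
have ht s : 0 <= s <= 1 -> lip (h s) A.
  move=> /andP[s0 s1] t t' tin tin'; rewrite /h.
  have -> : g0 t + s%:C * (g1 t - g0 t) - (g0 t' + s%:C * (g1 t' - g0 t')) =
     (1 - s)%:C * (g0 t - g0 t') + s%:C * (g1 t - g1 t') by rewrite rmorphB rmorph1; ring.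
  apply: le_trans (nrD _ _) _; rewrite !nrM !nrR (ger0_norm s0) (@ger0_norm _ (1 - s)) ?subr_ge0 //.
  have := hg0 _ _ tin tin'; have := hg1 _ _ tin tin'.
  move: (nr (g0 t - g0 t')) (nr (g1 t - g1 t')) (A * _) => Y X Z h1 h2.
  have : (1 - s) * Y <= (1 - s) * Z by rewrite ler_wpM2l ?subr_ge0.
  have : s * X <= s * Z by rewrite ler_wpM2l.
  lra.
have hs s s' t : 0 <= t <= 1 -> nr (h s t - h s' t) <= W * `|s - s'|.
  move=> tin; rewrite /h.
  have -> : g0 t + s%:C * (g1 t - g0 t) - (g0 t + s'%:C * (g1 t - g0 t)) = (s - s')%:C * (g1 t - g0 t).
    by rewrite rmorphB; ring.
  by rewrite nrM nrR mulrC ler_wpM2r // hW.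
pose TS n s := \sum_(i < n.+1) E f (h s (node n i)) (h s (node n i.+1)).
have [K' [K'0 KK']] : exists K', 0 <= K' /\ K <= K' by exists `|K|; rewrite normr_ge0 ler_norm.
have hK' a b c (x : R) : D a -> D b -> D c -> 0 <= x -> nr (a - b) <= x -> nr (b - c) <= x ->
    nr (c - a) <= x -> nr (trapezoid_defect f a b c) <= K' * x ^+ 3.
  move=> Da Db Dc x0 h1 h2 h3; apply: le_trans (hK _ _ _ Da Db Dc) _.
  apply: le_trans (_ : K' * (nr (a - b) * nr (b - c) * nr (c - a)) <= _).
    by rewrite ler_wpM2r // !mulr_ge0 ?nr_ge0.
  rewrite (_ : x ^+ 3 = x * x * x); last by ring.
  by apply: ler_wpM2l; [by []|do 2?[apply: ler_pM; rewrite ?mulr_ge0 ?nr_ge0 //]].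
(* one row of the grid: the contributions of the transversal edges telescope
   to [0] because the paths are closed *)
have level n j : (j <= n)%N -> nr (TS n (node n j) - TS n (node n j.+1)) <= 16 * K' * l ^+ 3 / n.+1%:R ^+ 2.
  move=> hj; have jin := node_in (leqW hj); have jin1 : 0 <= node n j.+1 <= 1 by exact: node_in.
  set s := node n j; set s' := node n j.+1.
  pose e t := E f (h s t) (h s' t).
  pose T i := trapezoid_defect f (h s (node n i)) (h s (node n i.+1)) (h s' (node n i.+1)) +
              trapezoid_defect f (h s (node n i)) (h s' (node n i.+1)) (h s' (node n i)).
  have Eanti a b : E f a b = - E f b a by rewrite /E -scaleNr opprB [f b + _]addrC.
  have quad i : E f (h s (node n i)) (h s (node n i.+1)) - E f (h s' (node n i)) (h s' (node n i.+1)) =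
     T i + (e (node n i) - e (node n i.+1)).
    rewrite /T /e -!trapE.
    rewrite (Eanti (h s' (node n i.+1)) (h s (node n i))) (Eanti (h s' (node n i.+1)) (h s' (node n i))).
    rewrite (Eanti (h s' (node n i)) (h s (node n i))).
    rewrite [RHS](AC (3*3*2) ((1*5)*(4*3)*(7*6)*(2*8))).
    by rewrite /= !subrr !addr0.
  have -> : TS n s - TS n s' = \sum_(i < n.+1) T i.
    rewrite -sumrB.
    transitivity (\sum_(i < n.+1) (T i + (e (node n i) - e (node n i.+1)))).
      by apply: eq_bigr => i _; rewrite quad.
    rewrite big_split /=.
    have -> : \sum_(i < n.+1) (e (node n i) - e (node n i.+1)) = 0.
      have -> : \sum_(i < n.+1) (e (node n i) - e (node n i.+1)) = - \sum_(i < n.+1) (e (node n i.+1) - e (node n i)).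
        by rewrite -sumrN; apply: eq_bigr => i _; rewrite opprB.
      rewrite -(big_mkord xpredT (fun i => e (node n i.+1) - e (node n i))) telescope_sumr //.
      by rewrite node0 node1 /e /h c0 c1 subrr oppr0.
    by rewrite addr0.
  apply: le_trans (nr_sum _ _ _) _.
  have N0 : 0 < n.+1%:R :> R by rewrite ltr0Sn.
  apply: (@le_trans _ _ (\sum_(i < n.+1) (16 * K' * l ^+ 3 / n.+1%:R ^+ 3))); last first.
    rewrite sumr_const card_ord -[leLHS]mulr_natr; apply: le_of_eq.
    by field; rewrite gt_eqF.
  apply: ler_sum => -[i hi] _ /=.
  have iin := node_in (leqW hi); have iin' : 0 <= node n i <= 1 by apply: node_in; exact: ltnW.
  have iin1 : 0 <= node n i.+1 <= 1 by exact: node_in.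
  have x0 : 0 <= 2 * l / n.+1%:R by rewrite divr_ge0 // mulr_ge0.
  move xE: (2 * l / n.+1%:R) x0 => x x0.
  have lx : l / n.+1%:R + l / n.+1%:R <= x by rewrite -xE -mulrDl (_ : l + l = 2 * l) //; ring.
  have lx' : l / n.+1%:R <= x by apply: le_trans lx; rewrite lerDl divr_ge0.
  have s1 r : 0 <= r <= 1 -> nr (h r (node n i) - h r (node n i.+1)) <= l / n.+1%:R.
    move=> rin; rewrite nrC; apply: le_trans (@lip_step _ _ A n i (ht r rin) hi) _.
    by rewrite ler_pM2r ?invr_gt0.
  have s2 t : 0 <= t <= 1 -> nr (h s t - h s' t) <= l / n.+1%:R.
    move=> tin; apply: le_trans (hs _ _ _ tin) _.
    by rewrite distrC /s /s' node_step ger0_norm // ler_pM2r ?invr_gt0.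
  have dg : nr (h s (node n i) - h s' (node n i.+1)) <= x.
    by apply: le_trans lx; apply: le_trans (nr_tri _ (h s (node n i.+1)) _) _; rewrite lerD ?s1 ?s2.
  apply: le_trans (nrD _ _) _.
  apply: (@le_trans _ _ (K' * x ^+ 3 + K' * x ^+ 3)); last first.
    by apply: le_of_eq; rewrite -xE; field; rewrite gt_eqF.
  apply: lerD; apply: hK'; rewrite ?x0 //; try (by apply: hD).
  - by apply: le_trans lx'; exact: s1.
  - by apply: le_trans lx'; exact: s2.
  - by rewrite nrC.
  - by rewrite nrC; apply: le_trans lx'; exact: s1.
  - by rewrite nrC; apply: le_trans lx'; exact: s2.
have total n : nr (TS n 0 - TS n 1) <= 16 * K' * l ^+ 3 / n.+1%:R.
  have -> : TS n 0 - TS n 1 = \sum_(j < n.+1) (TS n (node n j) - TS n (node n j.+1)).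
    have -> : \sum_(j < n.+1) (TS n (node n j) - TS n (node n j.+1)) = - \sum_(j < n.+1) (TS n (node n j.+1) - TS n (node n j)).
      by rewrite -sumrN; apply: eq_bigr => i _; rewrite opprB.
    rewrite -(big_mkord xpredT (fun j => TS n (node n j.+1) - TS n (node n j))) telescope_sumr //.
    by rewrite node0 node1 opprB.
  apply: le_trans (nr_sum _ _ _) _.
  apply: le_trans (_ : \sum_(j < n.+1) (16 * K' * l ^+ 3 / n.+1%:R ^+ 2) <= _).
    by apply: ler_sum => -[j hj] _ /=; exact: level.
  rewrite sumr_const card_ord -[leLHS]mulr_natr; apply: le_of_eq.
  by field; rewrite nat1r pnatr_eq0.
(* trapezoid sums differ from twice the left sums by [O (1 / n)] *)
have trap n g s : 0 <= s <= 1 -> (forall t, h s t = g t) -> nr (TS n s - 2 *: left_sum g (f \o g) n) <= `|L| * A ^+ 2 / n.+1%:R.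
  move=> sin hg; rewrite /TS /left_sum scaler_sumr -sumrB.
  have -> : \sum_(i < n.+1) (E f (h s (node n i)) (h s (node n i.+1)) - 2 *: ((g (node n i.+1) - g (node n i)) *: (f \o g) (node n i)))
    = \sum_(i < n.+1) (g (node n i.+1) - g (node n i)) *: (f (g (node n i.+1)) - f (g (node n i))).
    apply: eq_bigr => i _; rewrite !hg /E /= scalerA mulrC -scalerA -scalerBr; congr (_ *: _).
    by rewrite scaler_nat mulr2n opprD addrACA subrr add0r.
  apply: le_trans (nr_sum _ _ _) _.
  apply: le_trans (_ : \sum_(i < n.+1) (A / n.+1%:R * (`|L| * (A / n.+1%:R))) <= _).
    apply: ler_sum => -[i hi] _ /=.
     rewrite nrZ; rewrite -!hg; apply: ler_pM; rewrite ?nr_ge0 //.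
      exact: (@lip_step _ _ A n i (ht s sin) hi).
    apply: le_trans (hL _ _ _ _) _; [apply: hD => //; exact: node_in|apply: hD => //; exact/node_in/ltnW|].
    apply: le_trans (ler_wpM2r (nr_ge0 _) (ler_norm L)) _; apply: ler_wpM2l; rewrite ?normr_ge0 //.
    exact: (@lip_step _ _ A n i (ht s sin) hi).
  rewrite sumr_const card_ord -[leLHS]mulr_natr; apply: le_of_eq.
  by field; rewrite nat1r pnatr_eq0.
move=> hI; apply: (tends_near hI); apply: (@near_inv _ _ _ _ (16 * K' * l ^+ 3 + 2 * (`|L| * A ^+ 2))) => n.
have h00 t : h 0 t = g0 t by rewrite /h mul0r addr0.
have h11 t : h 1 t = g1 t by rewrite /h mul1r addrC subrK.
have t0 : nr (TS n 0 - 2 *: left_sum g0 (f \o g0) n) <= `|L| * A ^+ 2 / n.+1%:R by apply: trap; rewrite ?lexx ?ler01.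
have t1 : nr (TS n 1 - 2 *: left_sum g1 (f \o g1) n) <= `|L| * A ^+ 2 / n.+1%:R by apply: trap; rewrite ?lexx ?ler01.
have t2 := total n.
have : nr (2 *: (left_sum g0 (f \o g0) n - left_sum g1 (f \o g1) n)) <= (16 * K' * l ^+ 3 + 2 * (`|L| * A ^+ 2)) / n.+1%:R.
  rewrite scalerBr; apply: le_trans (nr_tri _ (TS n 0) _) _.
  rewrite nrC; apply: le_trans (lerD t0 (nr_tri _ (TS n 1) _)) _.
  apply: le_trans (lerD (lexx _) (lerD t2 t1)) _.
  by apply: le_of_eq; ring.
have n2 : nr (2 : R[i]) = 2 by rewrite /nr normr_nat; have -> : (2 : R[i]) = (2 : R)%:C by rewrite rmorph_nat.
rewrite nrZ n2 => t3; apply: le_trans t3.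
by rewrite ler_peMl ?nr_ge0 // ler1n.
Qed.

End Homotopy.

End ContourIntegral.

(** * Resolvent families *)

Section ResolventFamily.
Context {R : realType} {V : completeNormedModType R[i]}.
Implicit Types (Z : set R[i]) (Rf : R[i] -> V -> V).

(** The resolvent identity with uniform bounds, without reference to an
    operator, so that it also covers the scalar Cauchy kernel. *)
Definition resfam Z Rf (C : R) : Prop :=
  [/\ 0 <= C,
      forall z, Z z -> lin (Rf z),
      forall z x, Z z -> nr (Rf z x) <= C * nr x &
      forall z w x, Z z -> Z w -> Rf z x - Rf w x = (w - z) *: Rf z (Rf w x)].

Variables (Z : set R[i]) (Rf : R[i] -> V -> V) (C : R).
Hypothesis hR : resfam Z Rf C.

Let C0 : 0 <= C. Proof. by case: hR. Qed.

Lemma resfam_lin z : Z z -> lin (Rf z).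
Proof. by case: hR => _ h _ _ /h. Qed.

Lemma resfam_le z x : Z z -> nr (Rf z x) <= C * nr x.
Proof. by case: hR => _ _ h _ /h. Qed.

Lemma resfam_id z w x : Z z -> Z w -> Rf z x - Rf w x = (w - z) *: Rf z (Rf w x).
Proof. by case: hR => _ _ _ h /h; apply. Qed.

Lemma resfam_comm z w x : Z z -> Z w -> Rf z (Rf w x) = Rf w (Rf z x).
Proof.
move=> hz hw; have [->//|zw] := eqVneq z w.
have h1 := resfam_id x hz hw; have h2 := resfam_id x hw hz.
have h : (w - z) *: Rf z (Rf w x) = (w - z) *: Rf w (Rf z x).
  by rewrite -h1 -[w - z]opprB scaleNr -h2 opprB.
by apply: (scalerI _ h); rewrite subr_eq0 eq_sym.
Qed.

Lemma resfam_lip a b x : Z a -> Z b -> nr (Rf a x - Rf b x) <= C ^+ 2 * nr x * nr (a - b).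
Proof.
move=> ha hb; rewrite resfam_id // nrZ nrC mulrC ler_wpM2r ?nr_ge0 //.
apply: le_trans (resfam_le _ ha) _; rewrite expr2 -mulrA ler_wpM2l //.
exact: resfam_le.
Qed.

(** Two applications of the resolvent identity turn the defect into
    [(b - c) (c - a) (b - a)] times the product of the three resolvents. *)
Lemma resfam_tri a b c x : Z a -> Z b -> Z c ->
  nr (trapezoid_defect (fun z => Rf z x) a b c) <= C ^+ 3 * nr x * (nr (a - b) * nr (b - c) * nr (c - a)).
Proof.
move=> ha hb hc.
have -> : trapezoid_defect (fun z => Rf z x) a b c =
    ((b - c) * (c - a) * (b - a)) *: Rf a (Rf b (Rf c x)).
  have -> : trapezoid_defect (fun z => Rf z x) a b c = (b - c) *: (Rf a x - Rf c x) + (c - a) *: (Rf b x - Rf c x).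
    rewrite /trapezoid_defect !scalerBr addrACA -opprD -scalerDl addrC addrC; congr (_ + _).
    by rewrite -scaleNr; congr (_ *: _); ring.
  rewrite !resfam_id // !scalerA -[c - b]opprB mulrN scaleNr.
  by rewrite [(c - a) * (b - c)]mulrC -scalerBr resfam_id // scalerA.
rewrite nrZ !nrM [leRHS]mulrC.
have -> : nr (b - c) * nr (c - a) * nr (b - a) = nr (a - b) * nr (b - c) * nr (c - a).
  by rewrite (nrC b a); ring.
rewrite ler_wpM2l ?mulr_ge0 ?nr_ge0 //.
have -> : C ^+ 3 * nr x = C * (C * (C * nr x)) by ring.
apply: le_trans (resfam_le _ ha) _; rewrite ler_wpM2l //.
apply: le_trans (resfam_le _ hb) _; rewrite ler_wpM2l //.
exact: resfam_le.
Qed.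

Lemma resfam_path_lip g A x : lip g A -> (forall t, 0 <= t <= 1 -> Z (g t)) ->
  lip (fun t => Rf (g t) x) (C ^+ 2 * nr x * A).
Proof.
move=> hg hZ s t hs ht; apply: le_trans (resfam_lip _ (hZ _ hs) (hZ _ ht)) _.
by rewrite -[leRHS]mulrA ler_wpM2l ?mulr_ge0 ?exprn_ge0 ?nr_ge0 ?hg.
Qed.

Lemma resfam_int g A x : lip g A -> (forall t, 0 <= t <= 1 -> Z (g t)) ->
  exists I, is_int g (fun t => Rf (g t) x) I.
Proof. by move=> hg hZ; exact: (int_exists hg (resfam_path_lip x hg hZ)). Qed.

Lemma resfam_homotopy g0 g1 A x I : lip g0 A -> lip g1 A -> g0 0 = g0 1 -> g1 0 = g1 1 ->
  (forall s t, 0 <= s <= 1 -> 0 <= t <= 1 -> Z (g0 t + s%:C * (g1 t - g0 t))) ->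
  is_int g0 (fun t => Rf (g0 t) x) I -> is_int g1 (fun t => Rf (g1 t) x) I.
Proof.
move=> h0 h1 c0 c1 hZ.
apply: (@homotopy _ _ (fun z => Rf z x) g0 g1 Z A _ _ I h0 h1 c0 c1 hZ).
  by move=> a b ha hb; exact: resfam_lip.
by move=> a b c ha hb hc; exact: resfam_tri.
Qed.

End ResolventFamily.

Section Kernel.
Context {R : realType} {V : completeNormedModType R[i]}.

Definition away (w : R[i]) (d : R) : set R[i] := [set z | d <= nr (z - w)].

(** The resolvent of the multiplication by [w]. *)
Definition cauchy_kern (w z : R[i]) (x : V) : V := (z - w)^-1 *: x.

Lemma away_neq w d z : 0 < d -> away w d z -> z - w != 0.
Proof. by move=> d0 h; apply/eqP => h0; move: h; rewrite /away /= h0 nr0 leNgt d0. Qed.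

Lemma cauchy_kern_fam w d : 0 < d -> resfam (away w d) (cauchy_kern w) d^-1.
Proof.
move=> d0; split; first by rewrite invr_ge0 ltW.
- by move=> z _ a x y; rewrite /cauchy_kern scalerDr !scalerA mulrC.
- move=> z x hz; rewrite nrZ ler_wpM2r ?nr_ge0 // nrV lef_pV2 ?posrE //.
  exact: lt_le_trans hz.
- move=> z z' x hz hz'; rewrite /cauchy_kern !scalerA -scalerBl; congr (_ *: _).
  by field; rewrite (away_neq d0 hz) (away_neq d0 hz').
Qed.

End Kernel.

(** * Winding numbers of circles *)

Section Circle.
Context {R : realType}.

Lemma sin_lip (a b : R) : `|sin a - sin b| <= `|a - b|.
Proof.
wlog ab : a b / a < b.
  move=> h; have [/h//|/h|->] := ltgtP a b; last by rewrite !subrr.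
  by rewrite distrC [leRHS]distrC.
rewrite distrC [leRHS]distrC.
have [c _ ->] : exists2 c, c \in `]a, b[%R & sin b - sin a = cos c * (b - a).
  apply: MVT => //; apply: continuous_subspaceT => x; exact: continuous_sin.
by rewrite normrM ler_piMl // cos_max.
Qed.

Lemma cos_lip (a b : R) : `|cos a - cos b| <= `|a - b|.
Proof.
rewrite -!sinDpihalf; apply: le_trans (sin_lip _ _) _.
by rewrite opprD addrACA subrr addr0.
Qed.

Lemma cos_near1 (h : R) : 0 <= h -> `|cos h - 1| <= h ^+ 2.
Proof.
move=> h0; have [->|hn] := eqVneq h 0; first by rewrite cos0 subrr normr0 expr0n.
have hp : 0 < h by rewrite lt_def hn.
have [c /[!in_itv]/= /andP[c0 ch]] : exists2 c, c \in `]0, h[%R & cos h - cos 0 = - sin c * (h - 0).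
  apply: MVT => //; apply: continuous_subspaceT => x; exact: continuous_cos.
rewrite cos0 subr0 => ->; rewrite normrM normrN expr2 (ger0_norm h0) ler_wpM2r //.
have := sin_lip c 0; rewrite sin0 !subr0 => hs; apply: le_trans hs _.
by rewrite ger0_norm ltW.
Qed.

Lemma sin_near (h : R) : 0 <= h -> `|sin h - h| <= h ^+ 3.
Proof.
move=> h0; have [->|hn] := eqVneq h 0; first by rewrite sin0 subrr normr0 expr0n.
have hp : 0 < h by rewrite lt_def hn.
have [c /[!in_itv]/= /andP[c0 ch]] : exists2 c, c \in `]0, h[%R & sin h - sin 0 = cos c * (h - 0).
  apply: MVT => //; apply: continuous_subspaceT => x; exact: continuous_sin.
rewrite sin0 !subr0 => ->; have -> : cos c * h - h = (cos c - 1) * h by ring.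
rewrite normrM (ger0_norm h0) exprSr ler_wpM2r //.
apply: le_trans (cos_near1 (ltW c0)) _.
by rewrite ler_pXn2r ?nnegrE // ltW.
Qed.

Definition cis (a : R) : R[i] := cos a +i* sin a.

Lemma cisD a b : cis (a + b) = cis a * cis b.
Proof. by apply/eqP; rewrite /cis cosD sinD eq_complex /= eqxx /= addrC [cos a * _]mulrC [sin a * _]mulrC eqxx. Qed.

Lemma nr_cis a : nr (cis a) = 1.
Proof. by rewrite /nr normc_def /= cos2Dsin2 sqrtr1. Qed.

Lemma cis_lip a b : nr (cis a - cis b) <= 2 * `|a - b|.
Proof.
apply: le_trans (nr_ReIm _) _; rewrite /cis /=.
by have := sin_lip a b; have := cos_lip a b; lra.
Qed.

Definition circ (c rho : R[i]) (t : R) : R[i] := c + rho * cis (2 * pi * t).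

Lemma circ_lip c rho : lip (circ c rho) (nr rho * (4 * pi)).
Proof.
move=> s t _ _; have -> : circ c rho s - circ c rho t = rho * (cis (2 * pi * s) - cis (2 * pi * t)).
  by rewrite /circ; ring.
rewrite nrM -[leRHS]mulrA ler_wpM2l ?nr_ge0 //; apply: le_trans (cis_lip _ _) _.
rewrite -mulrBr normrM ger0_norm ?mulr_ge0 ?pi_ge0 //; lra.
Qed.

Lemma cis0 : cis 0 = 1. Proof. by rewrite /cis cos0 sin0. Qed.

Lemma cis2pi : cis (2 * pi) = 1.
Proof. by rewrite /cis mulr_natl cos2pi sin2pi. Qed.

Lemma circ_closed c rho : circ c rho 0 = circ c rho 1.
Proof. by rewrite /circ mulr0 mulr1 cis0 cis2pi. Qed.

Definition two_pi_i : R[i] := 2 * pi%:C * 'i.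

(** All terms of the left sum are equal to [cis (2 * pi / n) - 1], by the
    multiplicativity of [cis]. *)
Lemma circ_wind_center {V : completeNormedModType R[i]} c rho (x : V) : rho != 0 ->
  is_int (circ c rho) (fun t => cauchy_kern c (circ c rho t) x) (two_pi_i *: x).
Proof.
move=> rho0.
pose h n : R := 2 * pi / n.+1%:R.
have us n : left_sum (circ c rho) (fun t => cauchy_kern c (circ c rho t) x) n = (n.+1%:R * (cis (h n) - 1)) *: x.
  rewrite /left_sum.
  transitivity (\sum_(i < n.+1) (cis (h n) - 1) *: x); last first.
    by rewrite sumr_const card_ord -scaler_nat scalerA.
  apply: eq_bigr => i _; rewrite /cauchy_kern scalerA; congr (_ *: _).
  rewrite /circ; have -> : 2 * pi * node n i.+1 = 2 * pi * node n i + h n :> R.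
    by rewrite -[node n i.+1](subrK (node n i)) node_step /h; ring.
  have e0 : cis (2 * pi * node n i) != 0 :> R[i].
    by apply/eqP => h0; have := nr_cis (2 * pi * node n i); rewrite h0 nr0 => /esym/eqP; rewrite oner_eq0.
  by rewrite cisD; field; rewrite addrAC subrr add0r mulf_neq0.
apply: (tends_ext (fun n => esym (us n))).
apply: (tends_near (tends_cst (two_pi_i *: x))).
apply: (@near_inv _ _ _ _ (((2 * pi) ^+ 2 + (2 * pi) ^+ 3) * nr x)) => n.
rewrite -scalerBl nrZ mulrAC ler_wpM2r ?nr_ge0 //.
have p0 : 0 <= 2 * pi :> R by rewrite mulr_ge0 ?pi_ge0.
have h0 : 0 <= h n by rewrite /h divr_ge0.
apply: le_trans (nr_ReIm _) _.
have -> : two_pi_i - n.+1%:R * (cis (h n) - 1) = (- (n.+1%:R * (cos (h n) - 1))) +i* (- (n.+1%:R * (sin (h n) - h n))).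
  apply/eqP; rewrite eq_complex /two_pi_i /cis; apply/andP; split; apply/eqP.
  all: rewrite -?(rmorph_nat (real_complex R)) /=.
  by ring.
  by rewrite /h; field; rewrite nat1r pnatr_eq0.
rewrite /= !normrN !normrM normr_nat [leRHS]mulrDl; apply: lerD.
  apply: le_trans (ler_wpM2l (ler0n _ _) (cos_near1 h0)) _.
  by apply: le_of_eq; rewrite /h; field; rewrite nat1r pnatr_eq0.
apply: le_trans (ler_wpM2l (ler0n _ _) (sin_near h0)) _.
apply: (@le_trans _ _ ((2 * pi) ^+ 3 / n.+1%:R ^+ 2)).
  by apply: le_of_eq; rewrite /h; field; rewrite nat1r pnatr_eq0.
rewrite ler_wpM2l ?exprn_ge0 // lef_pV2 ?posrE ?exprn_gt0 ?ltr0Sn //.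
by rewrite expr2 ler_peMl // ler1n.
Qed.

End Circle.

Section Winding.
Context {R : realType}.

Lemma int_cst_path {V : completeNormedModType R[i]} (c : R[i]) (F : R -> V) : is_int (fun=> c) F 0.
Proof.
apply: (tends_ext _ (tends_cst 0)) => n; rewrite /left_sum big1 // => i _.
by rewrite subrr scale0r.
Qed.

Lemma lip_cst (c : R[i]) A : 0 <= A -> lip (fun=> c) A.
Proof. by move=> A0 s t _ _; rewrite subrr nr0 mulr_ge0. Qed.

Definition convexC (K : set R[i]) : Prop :=
  forall a b (s : R), K a -> K b -> 0 <= s <= 1 -> K (a + s%:C * (b - a)).

(** In a convex set, a closed path contracts linearly to its starting
    point. *)
Lemma null_int {V : completeNormedModType R[i]} (f : R[i] -> V) g (D : set R[i]) (A L K : R) :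
  lip g A -> g 0 = g 1 -> convexC D -> (forall t, 0 <= t <= 1 -> D (g t)) ->
  (forall a b, D a -> D b -> nr (f a - f b) <= L * nr (a - b)) ->
  (forall a b c, D a -> D b -> D c ->
     nr (trapezoid_defect f a b c) <= K * (nr (a - b) * nr (b - c) * nr (c - a))) ->
  is_int g (f \o g) 0.
Proof.
move=> hg cg cD hD hL hK.
apply: (@homotopy _ _ f (fun=> g 0) g D A L K 0) => //.
- exact/lip_cst/(lip_ge0 hg).
- by move=> s t hs ht; apply: cD => //; apply: hD; rewrite ?lexx ?ler01.
- exact: int_cst_path.
Qed.

Lemma nr_rtri (a b : R[i]) : nr a - nr b <= nr (a + b).
Proof. by rewrite lerBlDr; have := nrB (a + b) b; rewrite addrK. Qed.

Lemma nr_pos (x : R) : 0 <= x -> nr x%:C = x.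
Proof. by move=> x0; rewrite nrR ger0_norm. Qed.

Lemma complexC_eq0 (x : R) : (x%:C == 0) = (x == 0).
Proof. by rewrite eq_complex /= eqxx andbT. Qed.

(** The circle is shrunk linearly to one centred at [w], staying away from [w]
    by the distance of [w] to the circle. *)
Lemma wind_circ_in {V : completeNormedModType R[i]} (c w : R[i]) (r : R) (x : V) :
  nr (w - c) < r -> is_int (circ c r%:C) (fun t => cauchy_kern w (circ c r%:C t) x) (two_pi_i *: x).
Proof.
move=> hw; pose d := r - nr (w - c); have d0 : 0 < d by rewrite subr_gt0.
have r0 : 0 <= r by apply: ltW; apply: le_lt_trans hw; exact: nr_ge0.
apply: (@resfam_homotopy _ _ (away w d) (cauchy_kern w) d^-1 (cauchy_kern_fam w d0)
  (circ w d%:C) (circ c r%:C) (r * (4 * pi)) x (two_pi_i *: x)).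
- move=> s t hs ht; apply: le_trans (circ_lip _ _ hs ht) _; rewrite (nr_pos (ltW d0)).
  by rewrite !ler_wpM2r ?mulr_ge0 ?pi_ge0 // /d lerBlDr lerDl nr_ge0.
- by rewrite -{2}(nr_pos r0); exact: circ_lip.
- exact: circ_closed.
- exact: circ_closed.
- move=> s t /andP[s0 s1] tin; rewrite /away /circ /=.
  set e := cis _.
  have -> : w + d%:C * e + s%:C * (c + r%:C * e - (w + d%:C * e)) - w =
     (r - (1 - s) * nr (w - c))%:C * e + - (s%:C * (w - c)).
    rewrite /d !rmorphB !rmorphM /= rmorphB rmorph1; ring.
  apply: le_trans (nr_rtri _ _); rewrite nrN !nrM nr_cis mulr1 (nr_pos s0) nr_pos.
    rewrite /d; have -> : r - (1 - s) * nr (w - c) - s * nr (w - c) = r - nr (w - c) by ring.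
    exact: lexx.
  have : (1 - s) * nr (w - c) <= 1 * nr (w - c) by rewrite ler_wpM2r ?nr_ge0 // lerBlDr lerDl.
  lra.
- by apply: circ_wind_center; rewrite complexC_eq0 gt_eqF.
Qed.

Lemma cauchy_kern_null {V : completeNormedModType R[i]} (w : R[i]) (d A : R) g (K : set R[i]) (x : V) :
  0 < d -> lip g A -> g 0 = g 1 -> convexC K -> (forall t, 0 <= t <= 1 -> K (g t)) ->
  K `<=` away w d -> is_int g (fun t => cauchy_kern w (g t) x) 0.
Proof.
move=> d0 hg cg cK hK Kw; have hR := @cauchy_kern_fam R V w d d0.
apply: (@null_int _ (fun z => cauchy_kern w z x) g K A _ _ hg cg cK hK).
  by move=> a b ha hb; exact: (resfam_lip hR x (Kw _ ha) (Kw _ hb)).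
by move=> a b c ha hb hc; exact: (resfam_tri hR x (Kw _ ha) (Kw _ hb) (Kw _ hc)).
Qed.

Definition disc (c : R[i]) (r : R) : set R[i] := [set z | nr (z - c) <= r].

Lemma disc_convex c r : convexC (disc c r).
Proof.
move=> a b s; rewrite /disc /= => ha hb /andP[s0 s1].
have -> : a + s%:C * (b - a) - c = (1 - s)%:C * (a - c) + s%:C * (b - c).
  by rewrite rmorphB rmorph1; ring.
apply: le_trans (nrD _ _) _; rewrite !nrM (nr_pos s0) nr_pos ?subr_ge0 //.
have : (1 - s) * nr (a - c) <= (1 - s) * r by rewrite ler_wpM2l ?subr_ge0.
have : s * nr (b - c) <= s * r by rewrite ler_wpM2l.
lra.
Qed.

Lemma circ_disc c (r : R) t : 0 <= r -> disc c r (circ c r%:C t).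
Proof. by move=> r0; rewrite /disc /circ /= addrC addKr nrM nr_cis mulr1 nr_pos. Qed.

Lemma wind_circ_out {V : completeNormedModType R[i]} (c w : R[i]) (r : R) (x : V) :
  0 <= r -> r < nr (w - c) -> is_int (circ c r%:C) (fun t => cauchy_kern w (circ c r%:C t) x) 0.
Proof.
move=> r0 hw; have d0 : 0 < nr (w - c) - r by rewrite subr_gt0.
apply: (cauchy_kern_null x d0 (circ_lip c r%:C) (circ_closed _ _) (@disc_convex c r)).
  by move=> t _; exact: circ_disc.
move=> z; rewrite /disc /away /= => hz.
have -> : z - w = (c - w) + (z - c) by ring.
by apply: le_trans (nr_rtri _ _); rewrite [nr (c - w)]nrC; lra.
Qed.

End Winding.

(** * Winding numbers of rectangles *)

Section Rectangle.
Context {R : realType}.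
Implicit Types a b c d t s : R.

(** [(square_x t, square_y t)] runs through the boundary of the unit square at
    constant speed; [rectangleE] obtains all rectangles from it by affine
    maps. *)
Definition square_x t : R := if t <= 4^-1 then 4 * t else if t <= 2^-1 then 1 else if t <= 3 / 4 then 3 - 4 * t else 0.
Definition square_y t : R := if t <= 4^-1 then 0 else if t <= 2^-1 then 4 * t - 1 else if t <= 3 / 4 then 1 else 4 - 4 * t.

Lemma rectangleE a b c d t :
  rectangle a b c d t = (a + (b - a) * square_x t) +i* (c + (d - c) * square_y t).
Proof.
rewrite /rectangle /square_x /square_y; do ![case: ifP => _]; congr (_ +i* _); ring.
Qed.

Lemma square_x_lip s t : `|square_x s - square_x t| <= 4 * `|s - t|.
Proof.
rewrite /square_x; do ![case: ifPn; rewrite -?ltNge => ?]; rewrite ler_norml; have h1 := ler_norm (s - t); have h2 := ler_norm (t - s); rewrite distrC in h2; apply/andP; split; lra.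
Qed.

Lemma square_y_lip s t : `|square_y s - square_y t| <= 4 * `|s - t|.
Proof.
rewrite /square_y; do ![case: ifPn; rewrite -?ltNge => ?]; rewrite ler_norml; have h1 := ler_norm (s - t); have h2 := ler_norm (t - s); rewrite distrC in h2; apply/andP; split; lra.
Qed.

Lemma square_in t : 0 <= t <= 1 -> (0 <= square_x t <= 1) && (0 <= square_y t <= 1).
Proof.
move=> /andP[t0 t1]; rewrite /square_x /square_y; do ![case: ifPn; rewrite -?ltNge => ?]; apply/andP; split; apply/andP; split; lra.
Qed.

Lemma rect_lip a b c d : lip (rectangle a b c d) (4 * (`|b - a| + `|d - c|)).
Proof.
move=> s t _ _; rewrite !rectangleE; apply: le_trans (nr_ReIm _) _ => /=.
have -> : a + (b - a) * square_x s - (a + (b - a) * square_x t) = (b - a) * (square_x s - square_x t) by ring.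
have -> : c + (d - c) * square_y s - (c + (d - c) * square_y t) = (d - c) * (square_y s - square_y t) by ring.
rewrite !normrM.
have := ler_wpM2l (normr_ge0 (b - a)) (square_x_lip s t).
have := ler_wpM2l (normr_ge0 (d - c)) (square_y_lip s t).
lra.
Qed.

Lemma rect_closed a b c d : rectangle a b c d 0 = rectangle a b c d 1.
Proof.
rewrite !rectangleE /square_x /square_y.
have -> : (0 <= 4^-1 :> R) by lra.
have -> : (1 <= 4^-1 :> R) = false by apply/negbTE; rewrite -ltNge; lra.
have -> : (1 <= 2^-1 :> R) = false by apply/negbTE; rewrite -ltNge; lra.
have -> : (1 <= 3 / 4 :> R) = false by apply/negbTE; rewrite -ltNge; lra.
by congr (_ +i* _); ring.
Qed.

Lemma cs_ge1 (x y : R) : x ^+ 2 + y ^+ 2 = 1 -> 0 <= x -> 0 <= y -> 1 <= x + y.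
Proof. by move=> h x0 y0; nra. Qed.

Lemma sin_neg t : 2^-1 <= t <= 1 -> sin (2 * pi * t) <= 0.
Proof.
move=> /andP[t0 t1]; have p0 := pi_gt0 R.
have -> : 2 * pi * t = (2 * pi * t - pi) + pi by ring.
rewrite sinDpi oppr_le0; apply: sin_ge0_pi; apply/andP; split; nra.
Qed.

Lemma sin_pos t : 0 <= t <= 2^-1 -> 0 <= sin (2 * pi * t).
Proof.
move=> /andP[t0 t1]; have p0 := pi_gt0 R.
apply: sin_ge0_pi; apply/andP; split; nra.
Qed.

Lemma cos_pos1 t : 0 <= t <= 4^-1 -> 0 <= cos (2 * pi * t).
Proof.
move=> /andP[t0 t1]; have p0 := pi_gt0 R.
apply: cos_ge0_pihalf; apply/andP; split; nra.
Qed.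

Lemma cos_pos2 t : 3 / 4 <= t <= 1 -> 0 <= cos (2 * pi * t).
Proof.
move=> /andP[t0 t1]; have p0 := pi_gt0 R.
have -> : 2 * pi * t = (2 * pi * t - 2 * pi) + pi *+ 2 by ring.
rewrite cosD2pi; apply: cos_ge0_pihalf; apply/andP; split; nra.
Qed.

Lemma cos_neg t : 4^-1 <= t <= 3 / 4 -> cos (2 * pi * t) <= 0.
Proof.
move=> /andP[t0 t1]; have p0 := pi_gt0 R.
have -> : 2 * pi * t = (2 * pi * t - pi) + pi by ring.
rewrite cosDpi oppr_le0; apply: cos_ge0_pihalf; apply/andP; split; nra.
Qed.

(** The circle around [w] starts in the direction [-1 - i] of the first corner
    of the rectangle. At each time both paths lie beyond the same side of the
    square of half-side [e] around [w], and so does the segment between them;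
    the homotopy avoids [w]. *)
Lemma wind_rect_in {V : completeNormedModType R[i]} a b c d (w : R[i]) (e : R) (x : V) : 0 < e ->
  a + e <= complex.Re w <= b - e -> c + e <= complex.Im w <= d - e ->
  is_int (rectangle a b c d) (fun t => cauchy_kern w (rectangle a b c d t) x) (two_pi_i *: x).
Proof.
move=> e0 /andP[wa wb] /andP[wc wd].
pose rho : R[i] := (- e) +i* (- e).
have rho0 : rho != 0 by rewrite eq_complex /= oppr_eq0 gt_eqF.
pose A := Num.max (nr rho * (4 * pi)) (4 * (`|b - a| + `|d - c|)).
apply: (@resfam_homotopy _ _ (away w e) (cauchy_kern w) e^-1 (cauchy_kern_fam w e0)
  (circ w rho) (rectangle a b c d) A x (two_pi_i *: x)).
- move=> s t hs ht; apply: le_trans (circ_lip _ _ hs ht) _.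
  by rewrite ler_wpM2r // le_max lexx.
- move=> s t hs ht; apply: le_trans (rect_lip _ _ _ _ hs ht) _.
  by rewrite ler_wpM2r // le_max lexx orbT.
- exact: circ_closed.
- exact: rect_closed.
- move=> s t /andP[s0 s1] /andP[t0 t1]; rewrite /away /= rectangleE.
  pose X := (1 - s) * (e * (sin (2 * pi * t) - cos (2 * pi * t))) + s * (a + (b - a) * square_x t - complex.Re w).
  pose Y := (1 - s) * (e * (- sin (2 * pi * t) - cos (2 * pi * t))) + s * (c + (d - c) * square_y t - complex.Im w).
  have -> : circ w rho t + s%:C * ((a + (b - a) * square_x t) +i* (c + (d - c) * square_y t) - circ w rho t) - w = X +i* Y.
    rewrite /X /Y /circ /cis /rho; case: (w) => w1 w2.
    by apply/eqP; rewrite eq_complex /=; apply/andP; split; apply/eqP; ring.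
  have cs := cos2Dsin2 (2 * pi * t).
  suff : e <= X \/ e <= - X \/ e <= Y \/ e <= - Y.
    have hx : `|X| <= nr (X +i* Y) by exact: (nr_Re (X +i* Y)).
    have hy : `|Y| <= nr (X +i* Y) by exact: (nr_Im (X +i* Y)).
    have := ler_norm X; have := ler_norm (- X); have := ler_norm Y; have := ler_norm (- Y).
    rewrite !normrN; move: (`|X|) (`|Y|) (nr _) hx hy => x1 y1 n1 *.
    by repeat match goal with H : _ \/ _ |- _ => case: H => H end; lra.
  rewrite /X /Y /square_x /square_y.
  have aux (u v : R) : e <= u -> e <= v -> e <= (1 - s) * u + s * v.
    move=> hu hv; have : (1 - s) * e <= (1 - s) * u by rewrite ler_wpM2l ?subr_ge0.
    have : s * e <= s * v by rewrite ler_wpM2l.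
    lra.
  have e1 (u : R) : 1 <= u -> e <= e * u by move=> hu; rewrite ler_peMr // ltW.
  have [ht1|ht1] := leP t 4^-1; [|have [ht2|ht2] := leP t 2^-1; [|have [ht3|ht3] := leP t (3 / 4)]].
  + right; right; right; rewrite opprD -!mulrN; apply: aux; last by lra.
    apply: e1; have h1 : 0 <= cos (2 * pi * t) by apply: cos_pos1; lra.
    have h2 : 0 <= sin (2 * pi * t) by apply: sin_pos; lra.
    by have := cs_ge1 cs h1 h2; lra.
  + left; apply: aux; last by lra.
    apply: e1; have : 0 <= - cos (2 * pi * t) by rewrite oppr_ge0 cos_neg //; lra.
    have : 0 <= sin (2 * pi * t) by apply: sin_pos; lra.
    move: cs; rewrite -(sqrrN (cos _)) => cs h1 h2; have := cs_ge1 cs h2 h1; lra.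
  + right; right; left; apply: aux; last by lra.
    apply: e1; have : 0 <= - cos (2 * pi * t) by rewrite oppr_ge0 cos_neg //; lra.
    have : 0 <= - sin (2 * pi * t) by rewrite oppr_ge0 sin_neg //; lra.
    move: cs; rewrite -(sqrrN (cos _)) -(sqrrN (sin _)) => cs h1 h2; have := cs_ge1 cs h2 h1; lra.
  + right; left; rewrite opprD -!mulrN; apply: aux; last by lra.
    apply: e1; have : 0 <= cos (2 * pi * t) by rewrite cos_pos2 //; lra.
    have : 0 <= - sin (2 * pi * t) by rewrite oppr_ge0 sin_neg //; lra.
    move: cs; rewrite -(sqrrN (sin _)) => cs h1 h2; have := cs_ge1 cs h2 h1; lra.
- exact: circ_wind_center.
Qed.

Definition halfL (b : R) : set R[i] := [set z | complex.Re z <= b].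
Lemma halfL_convex b : convexC (halfL b).
Proof.
move=> u v s; rewrite /halfL /=; case: u => u1 u2; case: v => v1 v2 /= h1 h2 /andP[s0 s1].
rewrite !mul0r subr0; nra.
Qed.

Definition box a b h : set R[i] := [set z | (a <= complex.Re z <= b) && (`|complex.Im z| <= h)].

Lemma box_convex a b h : convexC (box a b h).
Proof.
move=> u v s; rewrite /box /=; case: u => u1 u2; case: v => v1 v2 /=.
rewrite !ler_norml => /andP[/andP[h1 h2] /andP[h3 h4]] /andP[/andP[k1 k2] /andP[k3 k4]] /andP[s0 s1].
rewrite !mul0r subr0 addr0; apply/andP; split; apply/andP; split; nra.
Qed.

Lemma rect_box a b h t : a <= b -> 0 <= h -> 0 <= t <= 1 -> box a b h (rectangle a b (- h) h t).
Proof.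
move=> ab h0 /square_in /andP[/andP[p0 p1] /andP[q0 q1]]; rewrite rectangleE /box /= ler_norml.
by apply/andP; split; apply/andP; split; nra.
Qed.

Lemma wind_rect_out {V : completeNormedModType R[i]} a b h (w : R) (x : V) :
  a <= b -> 0 <= h -> b < w ->
  is_int (rectangle a b (- h) h) (fun t => cauchy_kern w%:C (rectangle a b (- h) h t) x) 0.
Proof.
move=> ab h0 bw; have d0 : 0 < w - b by rewrite subr_gt0.
apply: (cauchy_kern_null x d0 (rect_lip _ _ _ _) (rect_closed _ _ _ _) (@halfL_convex b)).
  by move=> t ht; have := rect_box ab h0 ht; rewrite /box /= => /andP[/andP[_ ?] _].
move=> z; rewrite /halfL /away /= => hz; apply: le_trans (nr_Re _).
by case: z hz => z1 z2 /= hz; rewrite ler0_norm; lra.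
Qed.

End Rectangle.

(** * Riesz projections of resolvent families *)

Section LeftSums.
Context {R : realType} {V : completeNormedModType R[i]}.
Implicit Types (g : R -> R[i]) (F G : R -> V).

Lemma left_sumD g F G n : left_sum g (fun t => F t + G t) n = left_sum g F n + left_sum g G n.
Proof. by rewrite /left_sum -big_split; apply: eq_bigr => i _; rewrite scalerDr. Qed.

Lemma left_sumZ g F (a : R[i]) n : left_sum g (fun t => a *: F t) n = a *: left_sum g F n.
Proof. by rewrite /left_sum scaler_sumr; apply: eq_bigr => i _; rewrite !scalerA mulrC. Qed.

Lemma left_sum_ext g F G n : (forall t, 0 <= t <= 1 -> F t = G t) -> left_sum g F n = left_sum g G n.
Proof.
move=> h; apply: eq_bigr => i _; rewrite h //; apply: node_in.
by rewrite ltnW.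
Qed.

Lemma int_ext g F G I : (forall t, 0 <= t <= 1 -> F t = G t) -> is_int g F I -> is_int g G I.
Proof. by move=> h; apply: tends_ext => n; exact: left_sum_ext. Qed.

Lemma intD g F G I J : is_int g F I -> is_int g G J -> is_int g (fun t => F t + G t) (I + J).
Proof.
by move=> h1 h2; apply: (tends_ext _ (tendsD h1 h2)) => n; rewrite left_sumD.
Qed.

Lemma intZ g F (a : R[i]) I : is_int g F I -> is_int g (fun t => a *: F t) (a *: I).
Proof. by move=> h1; apply: (tends_ext _ (tendsZ a h1)) => n; rewrite left_sumZ. Qed.

Lemma left_sum_le g F A B n : lip g A -> (forall t, 0 <= t <= 1 -> nr (F t) <= B) ->
  nr (left_sum g F n) <= A * B.
Proof.
move=> hg hB; apply: le_trans (nr_sum _ _ _) _.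
apply: le_trans (_ : \sum_(i < n.+1) (A / n.+1%:R * B) <= _).
  apply: ler_sum => -[i hi] _ /=.
  rewrite nrZ; apply: ler_pM; rewrite ?nr_ge0 //; first exact: (@lip_step _ _ _ A n i hg hi).
  by apply: hB; apply: node_in; exact: ltnW.
rewrite sumr_const card_ord -[leLHS]mulr_natr; apply: le_of_eq.
by field; rewrite nat1r pnatr_eq0.
Qed.

Lemma int_le g F A B I : lip g A -> (forall t, 0 <= t <= 1 -> nr (F t) <= B) ->
  is_int g F I -> nr I <= A * B.
Proof. by move=> hg hB hI; apply: (tends_nr_le (n1 := 0) hI) => n _; exact: left_sum_le. Qed.

Lemma nr_two_pi_i : nr (two_pi_i : R[i]) = 2 * pi.
Proof.
rewrite /two_pi_i !nrM nrR ger0_norm ?pi_ge0 //.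
have -> : nr (2 : R[i]) = 2 by rewrite -[2 : R[i]](rmorph_nat (real_complex R)) nrR normr_nat.
by rewrite /nr normc_def /= expr0n expr1n add0r sqrtr1 mulr1.
Qed.

Lemma two_pi_i_ge4 : 4 <= nr (two_pi_i : R[i]).
Proof. by rewrite nr_two_pi_i; have := pi_ge2 R; lra. Qed.

Lemma two_pi_i_neq0 : (two_pi_i : R[i]) != 0.
Proof. by apply/eqP => h; have := two_pi_i_ge4; rewrite h nr0; lra. Qed.

End LeftSums.

Section RieszCalculus.
Context {R : realType} {V : completeNormedModType R[i]}.
Variables (Z : set R[i]) (Rf : R[i] -> V -> V) (C : R).
Hypothesis hR : resfam Z Rf C.

Let C0 : 0 <= C. Proof. by case: hR. Qed.

(** The integral is taken vector by vector; [riesz_of_rp] recovers the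
    convergence in operator norm. *)
Definition is_rp (g : R -> R[i]) (S : V -> V) : Prop :=
  forall x, is_int g (fun t => Rf (g t) x) (two_pi_i *: S x).

Definition contour (g : R -> R[i]) (A : R) : Prop :=
  [/\ lip g A, g 0 = g 1 & forall t, 0 <= t <= 1 -> Z (g t)].

Lemma rp_exists g A : contour g A -> exists S, is_rp g S.
Proof.
move=> [hg cg hZ].
have h x : exists y, is_int g (fun t => Rf (g t) x) (two_pi_i *: y).
  have [I hI] := resfam_int hR x hg hZ.
  by exists (two_pi_i^-1 *: I); rewrite scalerA mulfV ?two_pi_i_neq0 // scale1r.
by have [S hS] := choice h; exists S.
Qed.

Lemma rp_lin g A S : contour g A -> is_rp g S -> lin S.
Proof.
move=> [hg cg hZ] hS a x y; apply: (scalerI two_pi_i_neq0).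
apply: (tends_uniq (hS (a *: x + y))).
rewrite scalerDr scalerA mulrC -scalerA.
apply: (int_ext _ (intD (intZ a (hS x)) (hS y))) => t ht.
by rewrite (resfam_lin hR (hZ t ht)).
Qed.

Lemma rp_le g A S x : contour g A -> is_rp g S -> nr (S x) <= A * C * nr x.
Proof.
move=> [hg cg hZ] hS; have := int_le hg _ (hS x).
move=> /(_ (C * nr x)) => h; rewrite -mulrA; apply: le_trans (h _); last first.
  by move=> t ht; apply: (resfam_le hR); exact: hZ.
rewrite nrZ ler_peMl ?nr_ge0 //; have := @two_pi_i_ge4 R; lra.
Qed.

Lemma rp_left_sum g A S g' F n : contour g A -> is_rp g S -> S (left_sum g' F n) = left_sum g' (fun t => S (F t)) n.
Proof.
move=> cg hS; have hl := rp_lin cg hS.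
by rewrite /left_sum (lin_sum hl); apply: eq_bigr => i _; rewrite (linZ hl).
Qed.

Lemma rp_int g A S g' F I : contour g A -> is_rp g S -> is_int g' F I ->
  is_int g' (fun t => S (F t)) (S I).
Proof.
move=> cg hS hI; apply: (tends_ext (fun n => rp_left_sum g' F n cg hS)).
apply: (@tends_lin _ _ _ S _ _ (A * C)) hI => x y.
by rewrite -(linB (rp_lin cg hS)); exact: rp_le cg hS.
Qed.

Lemma rp_comm g A S w x : contour g A -> is_rp g S -> Z w -> S (Rf w x) = Rf w (S x).
Proof.
move=> cg hS hw; apply: (scalerI two_pi_i_neq0); apply: (tends_uniq (hS (Rf w x))).
have lw := resfam_lin hR hw; rewrite -(linZ lw).
have [hg _ hZ] := cg.
apply: (tends_ext (u := fun n => Rf w (left_sum g (fun t => Rf (g t) x) n))); last first.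
  apply: (@tends_lin _ _ _ (Rf w) _ _ C) (hS x) => y z.
  by rewrite -(linB lw); exact: (resfam_le hR).
move=> n; rewrite /left_sum (lin_sum lw); apply: eq_bigr => i _.
by rewrite (linZ lw) (resfam_comm hR) //; apply: hZ; apply: node_in; rewrite ltnW.
Qed.

Lemma rp_comm2 g A S g' A' S' x : contour g A -> is_rp g S -> contour g' A' -> is_rp g' S' ->
  S (S' x) = S' (S x).
Proof.
move=> cg hS cg' hS'; apply: (scalerI two_pi_i_neq0); apply: (tends_uniq (hS (S' x))).
have [hg _ hZ] := cg.
have h := rp_int cg' hS' (hS x).
rewrite -(linZ (rp_lin cg' hS')).
by apply: int_ext h => t ht; rewrite (rp_comm _ cg' hS') //; exact: hZ.
Qed.

(** By the resolvent identity, [S' (Rf w x)] is [chi *: Rf w x] minus the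
    integral [G w] of [(z - w)^-1 Rf z x] over [g'], divided by [2 * pi * i].
    The function [G] is defined on all of [K], where [g] is contractible, so
    that its integral over [g] vanishes. *)
Lemma riesz_product g A S g' A' S' (K : set R[i]) (d : R) (chi : R[i]) :
  contour g A -> is_rp g S -> contour g' A' -> is_rp g' S' ->
  convexC K -> (forall t, 0 <= t <= 1 -> K (g t)) -> 0 < d ->
  (forall w t, K w -> 0 <= t <= 1 -> d <= nr (g' t - w)) ->
  (forall w (x : V), K w -> is_int g' (fun t => cauchy_kern w (g' t) x) ((chi * two_pi_i) *: x)) ->
  forall x, S' (S x) = chi *: S x.
Proof.
move=> cg hS cg' hS' cK gK d0 hd hw x.
have [hg clg hZ] := cg; have [hg' clg' hZ'] := cg'; have A'0 := lip_ge0 hg'.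
pose F w t := cauchy_kern w (g' t) (Rf (g' t) x).
have swap (w z : R[i]) (y : V) : cauchy_kern w z y = - cauchy_kern z w y.
  by rewrite /cauchy_kern -scaleNr -invrN opprB.
have Fle w t : K w -> 0 <= t <= 1 -> nr (F w t) <= d^-1 * (C * nr x).
  move=> Kw ht; have hk := @cauchy_kern_fam R V w d d0.
  have := resfam_le hk (Rf (g' t) x) (hd w t Kw ht) => h; apply: le_trans h _.
  by rewrite ler_wpM2l ?invr_ge0 ?(ltW d0) //; apply: (resfam_le hR); exact: hZ'.
have Flip w : K w -> exists L, lip (F w) L.
  move=> Kw; have hk := @cauchy_kern_fam R V w d d0.
  exists (d^-1 * (C ^+ 2 * nr x * A') + d^-1 ^+ 2 * (C * nr x) * A') => s t hs ht.
  have -> : F w s - F w t = cauchy_kern w (g' s) (Rf (g' s) x - Rf (g' t) x) +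
     (cauchy_kern w (g' s) (Rf (g' t) x) - cauchy_kern w (g' t) (Rf (g' t) x)).
    by rewrite (linB (resfam_lin hk (hd w s Kw hs))) addrA subrK.
  apply: le_trans (nrD _ _) _; rewrite mulrDl; apply: lerD.
    apply: le_trans (resfam_le hk _ (hd w s Kw hs)) _; rewrite -[leRHS]mulrA ler_wpM2l ?invr_ge0 ?(ltW d0) //.
    exact: (resfam_path_lip hR x hg' hZ' hs ht).
  apply: le_trans (resfam_lip hk _ (hd w s Kw hs) (hd w t Kw ht)) _.
  rewrite -[leLHS]mulrA -[leRHS]mulrA -[leRHS]mulrA ler_wpM2l ?exprn_ge0 ?invr_ge0 ?(ltW d0) //.
  apply: ler_pM; rewrite ?nr_ge0 //; last exact: hg'.
  by apply: (resfam_le hR); exact: hZ'.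
have [G hG] : exists G : R[i] -> V, forall w, K w -> is_int g' (F w) (G w).
  have h w : exists y, K w -> is_int g' (F w) y.
    have [Kw|nK] := pselect (K w); last by exists 0 => /nK.
    have [L hL] := Flip w Kw; have [I hI] := int_exists hg' hL; by exists I.
  by have [G hG] := choice h; exists G.
(* the resolvent identity under the integral over [g'] *)
have SR w : K w -> Z w -> two_pi_i *: S' (Rf w x) = (chi * two_pi_i) *: Rf w x - G w.
  move=> Kw Zw; apply: (tends_uniq (hS' (Rf w x))).
  rewrite -[- G w]scaleN1r.
  apply: (int_ext _ (intD (hw w (Rf w x) Kw) (intZ (-1) (hG w Kw)))) => t ht.
  have zw : g' t - w != 0 by apply: (away_neq d0); exact: hd.
  rewrite /F scaleN1r /cauchy_kern -scalerBr (resfam_id hR x Zw (hZ' t ht)).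
  by rewrite scalerA mulVf // scale1r (resfam_comm hR) //; exact: hZ'.
(* [G] is a superposition of Cauchy kernels in [w] and inherits their
   Lipschitz and defect bounds *)
have G0 : is_int g (G \o g) 0.
  apply: (@null_int _ _ G g K A (A' * (d^-1 ^+ 2 * (C * nr x))) (A' * (d^-1 ^+ 3 * (C * nr x))) hg clg cK gK).
    move=> a b Ka Kb; rewrite -mulrA.
    have hI := intD (hG a Ka) (intZ (-1) (hG b Kb)).
    rewrite scaleN1r in hI; apply: (int_le hg' _ hI) => t ht; rewrite scaleN1r /F.
    have hk := @cauchy_kern_fam R V (g' t) d d0.
    rewrite !(swap _ (g' t)) -opprD nrN.
    have ha : away (g' t) d a by rewrite /away /= nrC; exact: hd.
    have hb : away (g' t) d b by rewrite /away /= nrC; exact: hd.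
    apply: le_trans (resfam_lip hk _ ha hb) _; rewrite ler_wpM2r ?nr_ge0 //.
    rewrite ler_wpM2l ?exprn_ge0 ?invr_ge0 ?(ltW d0) //.
    by apply: (resfam_le hR); exact: hZ'.
  move=> a b c Ka Kb Kc; rewrite -mulrA.
  have hI := intD (intD (intZ (b - c) (hG a Ka)) (intZ (c - a) (hG b Kb))) (intZ (a - b) (hG c Kc)).
  apply: (int_le hg' _ hI) => t ht; rewrite /F.
  have hk := @cauchy_kern_fam R V (g' t) d d0.
  rewrite !(swap _ (g' t)) !scalerN -!opprD nrN.
  have ha : away (g' t) d a by rewrite /away /= nrC; exact: hd.
  have hb : away (g' t) d b by rewrite /away /= nrC; exact: hd.
  have hc : away (g' t) d c by rewrite /away /= nrC; exact: hd.
  apply: le_trans (resfam_tri hk _ ha hb hc) _; rewrite ler_wpM2r ?mulr_ge0 ?nr_ge0 //.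
  rewrite ler_wpM2l ?exprn_ge0 ?invr_ge0 ?(ltW d0) //.
  by apply: (resfam_le hR); exact: hZ'.
have h1 := intZ two_pi_i (rp_int cg' hS' (hS x)).
have h2 := intD (intZ (chi * two_pi_i) (hS x)) (intZ (-1) G0).
have : two_pi_i *: S' (two_pi_i *: S x) = (chi * two_pi_i) *: (two_pi_i *: S x) + -1 *: 0.
  apply: (tends_uniq h1); apply: int_ext h2 => t ht.
  by rewrite /= SR ?scaleN1r //; [exact: gK|exact: hZ].
rewrite (linZ (rp_lin cg' hS')) scaler0 addr0 !scalerA => h3.
apply: (scalerI (mulf_neq0 two_pi_i_neq0 two_pi_i_neq0)); rewrite h3 scalerA; congr (_ *: _); ring.
Qed.

End RieszCalculus.

Lemma resolvent_fam {R : realType} {H : completeNormedModType R[i]} (T : operator H) (Z : set R[i]) (C : R) :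
  0 <= C -> (forall z, Z z -> is_resolvent T z (resolvent T z)) ->
  (forall z x, Z z -> nr (resolvent T z x) <= C * nr x) -> resfam Z (resolvent T) C.
Proof.
move=> C0 hR hC; split => // [z hz a x y|z w x hz hw].
  by have [[h _] _ _] := hR z hz; exact: h.
have [_ h1 _] := hR w hw; have [d1 e1] := h1 x.
have [[lz _] _ h2] := hR z hz; have := h2 _ d1.
set f := resolvent T w x in d1 e1 *; move=> e2.
have -> : resolvent T z x = f - (z - w) *: resolvent T z f.
  have E : z *: f - T f = (z - w) *: f + x by rewrite -e1 scalerBl addrA subrK.
  by move: e2; rewrite E lz => e3; apply/eqP; rewrite eq_sym subr_eq addrC e3.
by rewrite addrC addKr -scaleNr opprB.
Qed.

Section RieszProjection.
Context {R : realType} {H : completeNormedModType R[i]}.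

Lemma lip_mono (g : R -> R[i]) A B : lip g A -> A <= B -> lip g B.
Proof. by move=> h AB s t hs ht; apply: le_trans (h s t hs ht) _; rewrite ler_wpM2r. Qed.

(** The error bound of [int_partition] is proportional to the norm of the
    vector, hence uniform on the unit ball. *)
Lemma riesz_of_rp (T : operator H) (Z : set R[i]) C g A S :
  resfam Z (resolvent T) C -> (forall z, Z z -> is_resolvent T z (resolvent T z)) ->
  contour Z g A -> is_rp (resolvent T) g S -> is_riesz_projection T g S.
Proof.
move=> hR hi cg hS; have [hg _ hZ] := cg; split.
- move=> _ [t + <-]; rewrite /= in_itv /= => ht; exists (resolvent T (g t)); exact: hi (hZ t ht).
- split; first by move=> a x y; exact: (rp_lin hR cg hS).
  by exists (A * C) => x; rewrite (nrE (S x)) (nrE x) -rmorphM lecR; exact: (rp_le hR x cg hS).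
- move=> eps eps0; have C0 : 0 <= C by case: hR.
  have A0 := lip_ge0 hg.
  have K0 : 0 < C ^+ 2 * A ^+ 2 + 1 by rewrite ltr_wpDl // mulr_ge0 ?sqr_ge0.
  exists (eps / (C ^+ 2 * A ^+ 2 + 1)); first by rewrite divr_gt0.
  move=> n t s t0 tn hs x.
  have := int_partition hg (resfam_path_lip hR x hg hZ) (hS x) t0 tn
    (d := eps / (C ^+ 2 * A ^+ 2 + 1)) (s := s).
  have hs' i : (i < n)%N -> t i <= s i <= t i.+1 /\ t i.+1 - t i <= eps / (C ^+ 2 * A ^+ 2 + 1).
    by move=> hi'; have [h1 h2] := hs i hi'; split => //; exact: ltW.
  move=> /(_ hs' (ltW (divr_gt0 eps0 K0))) h.
  rewrite nrE (nrE x) -rmorphM lecR; apply: le_trans h _.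
  have -> : A * (C ^+ 2 * nr x * A) * (eps / (C ^+ 2 * A ^+ 2 + 1)) =
    eps * (C ^+ 2 * A ^+ 2 / (C ^+ 2 * A ^+ 2 + 1)) * nr x by ring.
  rewrite ler_wpM2r ?nr_ge0 // ler_piMr ?(ltW eps0) // ler_pdivrMr // mul1r lerDl //.
Qed.

End RieszProjection.

(** * Coordinates in an orthonormal basis *)

Section BoundedSums.
Context {R : realType}.

Lemma mono_cauchy (s : nat -> R) (M : R) : (forall m n, (m <= n)%N -> s m <= s n) ->
  (forall n, s n <= M) -> forall e, 0 < e -> exists n0, forall n, (n0 <= n)%N -> s n - s n0 <= e.
Proof.
move=> hm hM e e0; have hs : has_sup (range s).
  by split; [exists (s 0%N); exists 0%N|exists M => _ [n _ <-]].
have [_ [n0 _ <-] h] := sup_adherent e0 hs; exists n0 => n _.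
have : s n <= sup (range s) by apply: sup_upper_bound => //; exists n.
by move: h; lra.
Qed.

Lemma sum_tail (b : nat -> R) (M : R) : (forall j, 0 <= b j) ->
  (forall n, \sum_(j < n) b j <= M) -> forall e, 0 < e -> exists n0, forall n, (n0 <= n)%N ->
    \sum_(j < n) b j - \sum_(j < n0) b j <= e.
Proof. by move=> b0 hM; apply: (mono_cauchy _ hM) => m n mn; exact: sum_mono. Qed.

End BoundedSums.

Section InnerProd.
Context {R : realType} {H : completeNormedModType R[i]}.
Variable ip : {dot H for (@Num.conj R[i])}.
Hypothesis hip : hilbert_norm ip.

Lemma ipPl x y z a : ip (a *: x + y) z = a * ip x z + ip y z.
Proof. by rewrite linearPl. Qed.

Lemma ipPr x y z a : ip x (a *: y + z) = Num.conj a * ip x y + ip x z.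
Proof. by rewrite linearPr. Qed.

Lemma ipDl x y z : ip (x + y) z = ip x z + ip y z. Proof. exact: linearDl. Qed.
Lemma ipDr x y z : ip x (y + z) = ip x y + ip x z. Proof. exact: linearDr. Qed.
Lemma ipBl x y z : ip (x - y) z = ip x z - ip y z. Proof. exact: linearBl. Qed.
Lemma ipBr x y z : ip x (y - z) = ip x y - ip x z. Proof. exact: linearBr. Qed.
Lemma ip0l x : ip 0 x = 0. Proof. exact: linear0l. Qed.
Lemma ip0r x : ip x 0 = 0. Proof. exact: linear0r. Qed.

Lemma ipZl a x y : ip (a *: x) y = a * ip x y.
Proof. by rewrite -[a *: x]addr0 ipPl ip0l addr0. Qed.

Lemma ipZr a x y : ip x (a *: y) = Num.conj a * ip x y.
Proof. by rewrite -[a *: y]addr0 ipPr ip0r addr0. Qed.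

Lemma ipC x y : ip x y = Num.conj (ip y x).
Proof. by rewrite hermC /= expr0 mul1r. Qed.

Lemma ip_sqr x : ip x x = (nr x ^+ 2)%:C.
Proof. by rewrite hip nrE rmorphXn. Qed.

Lemma nr_add_sqr x y : nr (x + y) ^+ 2 = nr x ^+ 2 + nr y ^+ 2 + 2 * complex.Re (ip x y).
Proof.
apply: (@complexI R); rewrite -ip_sqr ipDl !ipDr !ip_sqr (ipC y x).
have -> : ((nr x ^+ 2 + nr y ^+ 2 + 2 * complex.Re (ip x y))%:C : R[i]) =
   (nr x ^+ 2)%:C + (nr y ^+ 2)%:C + (ip x y + Num.conj (ip x y)).
  have -> : ip x y + Num.conj (ip x y) = 2 * (complex.Re (ip x y))%:C by rewrite -addcJ.
  by apply/eqP; rewrite eq_complex /=; apply/andP; split; apply/eqP; ring.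
by ring.
Qed.

Lemma pythag x y : ip x y = 0 -> nr (x + y) ^+ 2 = nr x ^+ 2 + nr y ^+ 2.
Proof. by move=> h; rewrite nr_add_sqr h /= mulr0 addr0. Qed.

Lemma cauchy_schwarz x y : nr (ip x y) <= nr x * nr y.
Proof.
have [->|y0] := eqVneq y 0; first by rewrite ip0r !nr0 mulr0.
have ny : 0 < nr y by rewrite lt_def nr_ge0 andbT; apply: contra_neq y0 => /nr_eq0.
pose a := ip x y; pose b : R[i] := (nr y ^+ 2)%:C.
have h : ip (b *: x - a *: y) (a *: y) = 0.
  by rewrite ipBl !ipZl !ipZr ip_sqr /a /b; ring.
have h2 := pythag h; rewrite subrK !nrZ in h2.
have h3 : nr b = nr y ^+ 2 by rewrite /b nrR ger0_norm ?exprn_ge0 ?nr_ge0.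
rewrite h3 in h2; have h4 := sqr_ge0 (nr (b *: x - a *: y)).
have h5 : (nr a * nr y) ^+ 2 <= (nr y * nr x * nr y) ^+ 2 by move: h2 h4; lra.
have := le_of_sqr _ h5; rewrite !mulr_ge0 ?nr_ge0 // => /(_ isT).
by rewrite ler_pM2r // [nr y * _]mulrC.
Qed.

Lemma ip_sum_l n (F : 'I_n -> H) y : ip (\sum_i F i) y = \sum_i ip (F i) y.
Proof. exact: (big_morph (ip^~ y) (fun x x' => ipDl x x' y) (ip0l y)). Qed.

Lemma ip_sum_r n (F : 'I_n -> H) x : ip x (\sum_i F i) = \sum_i ip x (F i).
Proof. exact: (big_morph (ip x) (fun y y' => ipDr x y y') (ip0r x)). Qed.

Lemma tends_ip (u v : nat -> H) x y : tends u x -> tends v y ->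
  tends (fun n => ip (u n) (v n) : R[i]^o) (ip x y : R[i]^o).
Proof.
move=> hu hv q q0; pose K := nr x + nr y + 1.
have K0 : 0 < K by rewrite ltr_wpDl ?addr_ge0 ?nr_ge0.
have d0 : 0 < Num.min 1 (q / K) by rewrite lt_min ltr01 divr_gt0.
have [n1 h1] := hu _ d0; have [n2 h2] := hv _ d0.
exists (maxn n1 n2) => n; rewrite geq_max => /andP[/h1 {}h1 /h2 {}h2].
have -> : ip (u n) (v n) - ip x y = ip (u n - x) (v n) + ip x (v n - y).
  by rewrite ipBl ipBr addrA subrK.
apply: le_trans (nrD _ _) _.
have k1 := cauchy_schwarz (u n - x) (v n).
have k2 := cauchy_schwarz x (v n - y).
have k3 := nr_tri (v n) y 0; rewrite !subr0 in k3.
move: h1 h2; rewrite !le_min => /andP[_ h1] /andP[h2 h3].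
have dK : q / K * (nr x + nr y + 1) = q by rewrite divfK ?gt_eqF.
have x0 := nr_ge0 x; have u0 := nr_ge0 (u n - x); have v0 := nr_ge0 (v n).
rewrite -dK; move: (q / K) (nr _) (nr (u n - x)) (nr _) h1 h2 h3 k1 k2 k3 x0 u0 => *; nra.
Qed.

Section Coordinates.
Variable e : nat -> H.
Hypothesis orth : forall i j, ip (e i) (e j) = (i == j)%:R.

Definition basis_coord (x : H) (j : nat) : R[i] := ip x (e j).
Definition lsum (a : nat -> R[i]) n : H := \sum_(j < n) a j *: e j.

Lemma coD x y j : basis_coord (x + y) j = basis_coord x j + basis_coord y j. Proof. exact: ipDl. Qed.
Lemma coB x y j : basis_coord (x - y) j = basis_coord x j - basis_coord y j. Proof. exact: ipBl. Qed.
Lemma coZ a x j : basis_coord (a *: x) j = a * basis_coord x j. Proof. exact: ipZl. Qed.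
Lemma co0 j : basis_coord 0 j = 0. Proof. exact: ip0l. Qed.
Lemma coe i j : basis_coord (e i) j = (i == j)%:R. Proof. exact: orth. Qed.

Lemma nre i : nr (e i) = 1.
Proof.
have := ip_sqr (e i); rewrite orth eqxx => h.
have : nr (e i) ^+ 2 = 1 by apply: (@complexI R); rewrite -h rmorph1.
move/eqP; rewrite sqrf_eq1 => /orP[/eqP//|/eqP h2].
by have := nr_ge0 (e i); rewrite h2; lra.
Qed.

Lemma co_lsum a n k : basis_coord (lsum a n) k = if (k < n)%N then a k else 0.
Proof.
rewrite /basis_coord /lsum ip_sum_l.
elim: n => [|n IH]; first by rewrite big_ord0.
rewrite big_ord_recr /= IH ipZl orth ltnS [n == k]eq_sym.
by have [kn|kn|->] := ltngtP k n; rewrite /= ?mulr0 ?addr0 ?mulr1 ?add0r.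
Qed.

Lemma lsum_sqr a n : nr (lsum a n) ^+ 2 = \sum_(j < n) nr (a j) ^+ 2.
Proof.
elim: n => [|n IH]; first by rewrite /lsum !big_ord0 nr0 expr0n.
rewrite /lsum !big_ord_recr /= -/(lsum a n) pythag; last first.
  by rewrite ipZr -/(basis_coord _ _) co_lsum ltnn mulr0.
by rewrite IH nrZ nre mulr1.
Qed.

Lemma lsum_diff a m n : (m <= n)%N ->
  nr (lsum a n - lsum a m) ^+ 2 = \sum_(j < n) nr (a j) ^+ 2 - \sum_(j < m) nr (a j) ^+ 2.
Proof.
move=> mn; have h : ip (lsum a n - lsum a m) (lsum a m) = 0.
  rewrite /lsum ip_sum_r big1 // => j _.
  rewrite ipZr -/(basis_coord _ _) coB !co_lsum ltn_ord (leq_trans (ltn_ord j) mn) subrr mulr0 //.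
by have := pythag h; rewrite subrK !lsum_sqr => ->; rewrite addrK.
Qed.

Definition partial_sum n (x : H) : H := lsum (basis_coord x) n.

Lemma part_split n x : nr x ^+ 2 = nr (x - partial_sum n x) ^+ 2 + \sum_(j < n) nr (basis_coord x j) ^+ 2.
Proof.
have h : ip (x - partial_sum n x) (partial_sum n x) = 0.
  rewrite /partial_sum /lsum ip_sum_r big1 // => j _.
  by rewrite ipZr -/(basis_coord _ _) coB co_lsum ltn_ord subrr mulr0.
by have := pythag h; rewrite subrK lsum_sqr.
Qed.

Lemma bessel n x : \sum_(j < n) nr (basis_coord x j) ^+ 2 <= nr x ^+ 2.
Proof. by rewrite (part_split n x) lerDr sqr_ge0. Qed.

Lemma co_le x j : nr (basis_coord x j) <= nr x.
Proof. by have := cauchy_schwarz x (e j); rewrite nre mulr1. Qed.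

Lemma riesz_fischer (a : nat -> R[i]) (M : R) : (forall n, \sum_(j < n) nr (a j) ^+ 2 <= M) ->
  exists x, (forall j, basis_coord x j = a j) /\ tends (lsum a) x.
Proof.
move=> hM; have [|x hx] := @cauchy_tends _ _ (lsum a).
  move=> eps e0; have e2 : 0 < (eps / 2) ^+ 2 by rewrite exprn_gt0 ?divr_gt0.
  have [n0 h] := sum_tail (fun j => sqr_ge0 (nr (a j))) hM e2.
  have h2 n : (n0 <= n)%N -> nr (lsum a n - lsum a n0) <= eps / 2.
    move=> hn; apply: le_of_sqr; first by rewrite divr_ge0 ?ltW.
    by rewrite lsum_diff // h.
  exists n0 => m n hm hn; apply: le_trans (nr_tri _ (lsum a n0) _) _.
  by rewrite [eps]splitr lerD ?h2 // nrC h2.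
exists x; split => // j; apply: tends_uniq (tends_ip hx (tends_cst (e j))) _.
by apply: (tends_eventually (n0 := j.+1)) => n hn; rewrite -/(basis_coord _ _) co_lsum hn.
Qed.

Hypothesis total : forall y, (forall j, basis_coord y j = 0) -> y = 0.

Lemma co_ext x y : (forall j, basis_coord x j = basis_coord y j) -> x = y.
Proof.
move=> h; apply/eqP; rewrite -subr_eq0; apply/eqP/total => j.
by rewrite coB h subrr.
Qed.

Lemma tends_part x : tends (partial_sum ^~ x) x.
Proof.
have [y [hy hl]] := riesz_fischer (fun n => bessel n x).
by rewrite (co_ext hy) in hl.
Qed.

Lemma nr_le_co x (M : R) : 0 <= M -> (forall n, \sum_(j < n) nr (basis_coord x j) ^+ 2 <= M ^+ 2) ->
  nr x <= M.
Proof.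
move=> M0 h; apply: (tends_nr_le (n1 := 0) (tends_part x)) => n _.
by apply: le_of_sqr => //; rewrite lsum_sqr.
Qed.

Lemma co_part n x k : basis_coord (partial_sum n x) k = if (k < n)%N then basis_coord x k else 0.
Proof. exact: co_lsum. Qed.

End Coordinates.
End InnerProd.

(** * Spectral theory of the unperturbed operator *)

Section CompactEigen.
Context {R : realType} {H : completeNormedModType R[i]}.
Variable ip : {dot H for (@Num.conj R[i])}.
Hypothesis hip : hilbert_norm ip.

Lemma bounded_nr (S : H -> H) : bounded_operator S ->
  exists2 C : R, 0 <= C & forall x, nr (S x) <= C * nr x.
Proof.
move=> [_ [M hM]]; exists `|M| => // x; apply: (@le_trans _ _ (M * nr x)).
  by rewrite -nr_le rmorphM /= -nrE.
by rewrite ler_wpM2r ?nr_ge0 ?ler_norm.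
Qed.

Lemma compact_cluster (S : H -> H) (u : nat -> H) : compact_operator S ->
  (forall n, nr (u n) <= 1) ->
  exists l, forall e : R, 0 < e -> forall n0, exists2 n, (n0 <= n)%N & nr (S (u n) - l) <= e.
Proof.
move=> [_ hc] hu.
have [|l [_ hl]] := hc (S \o u @ \oo) _.
  exists 0%N => // n _ /=; apply: subset_closure; exists (u n) => //=.
  by rewrite -[1](rmorph1 (real_complex R)) nr_le.
exists l => e e0 n0.
have hA : (S \o u @ \oo) [set x | exists2 n, (n0 <= n)%N & x = S (u n)].
  by exists n0 => // n hn /=; exists n.
have hB : nbhs l [set x | nr (x - l) <= e].
  have e0' : 0 < e%:C by rewrite ltcR.
  apply: (filterS _ (nbhsx_ballx l _ e0')) => x.
  by rewrite -ball_normE /ball_ /= nrE ltcR nrC => /ltW.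
by have [x [[n hn ->] /= hx]] := hl _ _ hA hB; exists n.
Qed.

(** Let [M] be the supremum of [nr (G x) ^+ 2], that is of the quadratic form
    of [K], on the unit ball of [W]. Since
    [nr (K x - M x) ^+ 2 <= M * (M - nr (G x) ^+ 2)], a maximizing sequence
    consists of approximate eigenvectors, and a cluster point of its images
    under [K] is an eigenvector. The map [G], a square root of [K], supplies
    positivity. *)
Lemma compact_eigen (K G : H -> H) (W : set H) (C : R) :
  lin K -> lin G -> 0 <= C -> (forall x, nr (K x) <= C * nr x) ->
  (forall x y, ip (G x) (G y) = ip x (K y)) ->
  (forall x y, ip (K x) y = ip x (K y)) ->
  (forall x, G x = 0 -> x = 0) ->
  (forall u, (forall n, nr (u n : H) <= 1) -> exists l,
     forall e : R, 0 < e -> forall n0, exists2 n : nat, (n0 <= n)%N & nr (K (u n) - l) <= e) ->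
  (forall x y a, W x -> W y -> W (a *: x + y)) -> (forall x, W x -> W (K x)) ->
  (forall l, (forall e : R, 0 < e -> exists2 x, W x & nr (x - l) <= e) -> W l) ->
  (exists2 y, W y & y != 0) ->
  exists l, exists M : R, [/\ W l, l != 0, 0 < M & K l = M%:C *: l].
Proof.
move=> Kl Gl C0 KC GK Ksym Ginj Kcpt Wl WK Wc [y Wy y0].
have W0 : W 0 by have := Wl y y (-1) Wy Wy; rewrite scaleN1r addNr.
have WZ x a : W x -> W (a *: x) by move=> Wx; rewrite -[_ *: _]addr0; exact: Wl.
have GKr x : nr (G x) ^+ 2 = complex.Re (ip x (K x)).
  by rewrite -GK (ip_sqr hip).
have Gle x : nr (G x) ^+ 2 <= nr x * nr (K x).
  by rewrite GKr; apply: le_trans (cauchy_schwarz hip _ _); apply: le_trans (nr_Re _); exact: ler_norm.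
pose E := [set r | exists x, [/\ W x, nr x <= 1 & r = nr (G x) ^+ 2]].
have hE : has_sup E.
  split; first by exists (nr (G 0) ^+ 2), 0; rewrite nr0 ler01.
  exists C => _ [x [_ x1 ->]]; apply: le_trans (Gle x) _.
  apply: le_trans (_ : 1 * (C * 1) <= _); last by rewrite mul1r mulr1.
  apply: ler_pM; rewrite ?nr_ge0 //; apply: le_trans (KC x) _.
  by rewrite ler_wpM2l.
move ME : (sup E) => M.
have hsup x : W x -> nr x <= 1 -> nr (G x) ^+ 2 <= M.
  by move=> Wx x1; rewrite -ME; apply: sup_upper_bound => //; exists x.
have hM x : W x -> nr (G x) ^+ 2 <= M * nr x ^+ 2.
  move=> Wx; have [->|x0] := eqVneq x 0; first by rewrite (lin0 Gl) !nr0 expr0n mulr0.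
  have nx : 0 < nr x by rewrite lt_def nr_ge0 andbT; apply: contra_neq x0 => /nr_eq0.
  have := hsup ((nr x)^-1%:C *: x) (WZ _ _ Wx).
  rewrite (linZ Gl) !nrZ nrR ger0_norm ?invr_ge0 ?nr_ge0 // mulVf ?gt_eqF // lexx => /(_ isT).
  by rewrite exprMn exprVn mulrC ler_pdivrMr ?exprn_gt0.
have M0 : 0 < M.
  have Gy : 0 < nr (G y) by rewrite lt_def nr_ge0 andbT; apply: contra_neq y0 => /nr_eq0/Ginj.
  have h1 : 0 < nr (G y) ^+ 2 by rewrite exprn_gt0.
  have ny : 0 < nr y by rewrite lt_def nr_ge0 andbT; apply: contra_neq y0 => /nr_eq0.
  have := lt_le_trans h1 (hM y Wy); rewrite pmulr_lgt0 // exprn_gt0 //.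
have hK x : W x -> nr (K x) ^+ 2 <= M * nr (G x) ^+ 2.
  move=> Wx.
  have h1 : nr (G ((- M)%:C *: x + K x)) ^+ 2 = M ^+ 2 * nr (G x) ^+ 2 + nr (G (K x)) ^+ 2 - 2 * M * nr (K x) ^+ 2.
    rewrite Gl (nr_add_sqr hip) nrZ nrR normrN (ger0_norm (ltW M0)) exprMn ipZl GK -Ksym (ip_sqr hip) /=; ring.
  have h2 := hM _ (WK _ Wx); have h3 := sqr_ge0 (nr (G ((- M)%:C *: x + K x))).
  rewrite h1 in h3; move: (nr (K x) ^+ 2) (nr (G x) ^+ 2) (nr (G (K x)) ^+ 2) h2 h3 => a b c h2 h3.
  have : M * a <= M * (M * b) by lra.
  by rewrite ler_pM2l.
have hS x : W x -> nr x <= 1 -> nr (K x - M%:C *: x) ^+ 2 <= M * (M - nr (G x) ^+ 2).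
  move=> Wx x1.
  have -> : nr (K x - M%:C *: x) ^+ 2 = nr (K x) ^+ 2 + M ^+ 2 * nr x ^+ 2 - 2 * M * nr (G x) ^+ 2.
    rewrite (nr_add_sqr hip) nrN nrZ nrR (ger0_norm (ltW M0)) exprMn -scaleNr -rmorphN Ksym (linZ Kl) ipZr.
    have -> : Num.conj (- M)%:C = (- M)%:C :> R[i] by apply/CrealP; rewrite complex_real.
    by rewrite -GK (ip_sqr hip) /=; ring.
  have h1 := hK x Wx; have h2 : nr x ^+ 2 <= 1 by rewrite expr_le1 ?nr_ge0.
  have h3 : M ^+ 2 * nr x ^+ 2 <= M ^+ 2 * 1 by rewrite ler_wpM2l ?sqr_ge0.
  by move: h1 h3; move: (nr (K x) ^+ 2) (nr (G x) ^+ 2) (nr x ^+ 2) => a b c; lra.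
have hx n : exists x, [/\ W x, nr x <= 1 & M - n.+1%:R^-1 <= nr (G x) ^+ 2].
  have n0 : 0 < n.+1%:R^-1 :> R by rewrite invr_gt0.
  have [_ [x [Wx x1 ->]] h] := sup_adherent n0 hE.
  by exists x; split => //; rewrite -ME ltW.
have [u hu] := choice hx.
have [l hl] := Kcpt u (fun n => let: And3 _ h _ := hu n in h).
have small (e : R) : 0 < e -> exists n0, forall n, (n0 <= n)%N -> n.+1%:R^-1 <= e.
  move=> e0; have [n0 hn] := archi e^-1; exists n0 => n hn'.
  rewrite -[e]invrK lef_pV2 ?posrE ?invr_gt0 //; apply: ltW; apply: lt_le_trans hn _.
  by rewrite ler_nat; exact: leq_trans hn' (leqnSn _).
exists l, M; split => //.
- apply: Wc => e e0; have [n _ h] := hl _ e0 0%N; exists (K (u n)) => //.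
  by apply: WK; case: (hu n).
- apply/eqP => l0.
  have [n1 h1] := small (M / 2) (divr_gt0 M0 (ltr0Sn _ 1)).
  have [n hn h] := hl (M / 4) (divr_gt0 M0 (ltr0Sn _ 3)) n1.
  have [_ x1 h2] := hu n; have h3 := h1 n hn; have h4 := Gle (u n).
  rewrite l0 subr0 in h.
  have h5 : nr (u n) * nr (K (u n)) <= 1 * (M / 4) by apply: ler_pM; rewrite ?nr_ge0.
  move: h2 h3 h4 h5; move: (n.+1%:R^-1) (nr (G (u n)) ^+ 2) => a b; lra.
- apply/eqP; rewrite -subr_eq0; apply/eqP/nr_eq0/eqP; rewrite eq_le nr_ge0 andbT.
  apply: le_eps => e e0; rewrite add0r.
  pose d := e / (C + C + M + 1); have den : 0 < C + C + M + 1 by lra.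
  have d0 : 0 < d by rewrite divr_gt0.
  have [n1 h1] := small (d ^+ 2 / M) (divr_gt0 (exprn_gt0 2 d0) M0).
  have [n hn h] := hl d d0 n1; have [Wx x1 h2] := hu n.
  have h3 : nr (K (u n) - M%:C *: u n) <= d.
    apply: le_of_sqr; first exact: ltW.
    apply: le_trans (hS _ Wx x1) _; have := h1 n hn; rewrite ler_pdivlMr // => h4.
    have : M * (M - nr (G (u n)) ^+ 2) <= M * n.+1%:R^-1 by rewrite ler_wpM2l ?(ltW M0) // lerBlDr addrC -lerBlDr.
    by rewrite mulrC in h4; move=> h5; exact: le_trans h5 h4.
  have -> : K l - M%:C *: l = - K (K (u n) - l) + K (K (u n) - M%:C *: u n) + M%:C *: (K (u n) - l).
    by rewrite !(linB Kl) (linZ Kl) scalerBr opprB !addrA !subrK.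
  have hd : C * d + C * d + M * d <= e.
    rewrite -!mulrDl; apply: (@le_trans _ _ ((C + C + M + 1) * d)); first by rewrite ler_wpM2r ?(ltW d0) // lerDl.
    by rewrite /d mulrCA mulfV ?mulr1 // gt_eqF.
  apply: le_trans hd; apply: le_trans (nrD _ _) _; apply: lerD; last first.
    by rewrite nrZ nrR (ger0_norm (ltW M0)) ler_wpM2l ?(ltW M0).
  apply: le_trans (nrD _ _) _; rewrite nrN; apply: lerD;
    by apply: le_trans (KC _) _; rewrite ler_wpM2l.
Qed.

End CompactEigen.

Section Structure.
Context {R : realType} {H : completeNormedModType R[i]}.
Variable ip : {dot H for (@Num.conj R[i])}.
Hypothesis hip : hilbert_norm ip.

Lemma conjR (x : R) : Num.conj x%:C = x%:C :> R[i].
Proof. by apply/CrealP; rewrite complex_real. Qed.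

Lemma sa_sym (A : operator H) f g : self_adjoint ip A -> dom A f -> dom A g ->
  ip (A g) f = ip g (A f).
Proof. by move=> [_ _ h] hf hg; have [h1 _] := h f (A f); exact: (h1 (conj hf erefl)). Qed.

Lemma op_lin (A : operator H) (a : R[i]) f g : linear_operator A -> dom A f -> dom A g ->
  dom A (a *: f + g) /\ A (a *: f + g) = a *: A f + A g.
Proof. by move=> [_ h] hf hg; exact: h. Qed.

Lemma op0 (A : operator H) : linear_operator A -> A 0 = 0.
Proof.
by move=> hA; have [h0 _] := hA; have [_] := op_lin (-1) hA h0 h0; rewrite scaler0 addr0 scaleN1r addNr.
Qed.

Lemma op_domZ (A : operator H) (a : R[i]) f : linear_operator A -> dom A f ->
  dom A (a *: f) /\ A (a *: f) = a *: A f.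
Proof.
by move=> hA hf; have := op_lin a hA hf (proj1 hA); rewrite (op0 hA) !addr0.
Qed.

Variables (A B : operator H) (m : nat -> R) (e : nat -> H).
Hypothesis saA : self_adjoint ip A.
Hypothesis cptA : compact_resolvent A.
Hypothesis m0 : forall j, 0 < m j.
Hypothesis minj : forall i j, m i = m j -> i = j.
Hypothesis spA : op_spectrum A = [set z | exists j, z = (m j)%:C].
Hypothesis simA : forall j, simple_eigenvalue A (m j)%:C.
Hypothesis eA : forall j, op_eigenspace A (m j)%:C (e j) /\ `|e j| = 1.
Hypothesis sqB : is_sqrt ip A B.

Let linA : linear_operator A. Proof. by case: saA. Qed.
Let saB : self_adjoint ip B. Proof. by case: sqB. Qed.
Let linB : linear_operator B. Proof. by case: saB. Qed.

Lemma eig_orth i j : ip (e i) (e j) = (i == j)%:R.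
Proof.
have [<-|ij] := eqVneq i j.
  by rewrite (ip_sqr hip) /nr; case: (eA i) => _ ->; rewrite /= expr1n.
have [[hi Ai] _] := eA i; have [[hj Aj] _] := eA j.
have := sa_sym saA hj hi; rewrite Ai Aj ipZl ipZr conjR => h.
have h2 : ((m i)%:C - (m j)%:C) * ip (e i) (e j) = 0 by rewrite mulrBl h subrr.
move/eqP: h2; rewrite mulf_eq0 subr_eq0 => /orP[/eqP h3|/eqP//].
by move: ij; rewrite (minj (complexI h3)) eqxx.
Qed.

(** Otherwise the orthogonal complement of the [e j] is a nonzero closed
    invariant subspace of the inverse [K] of [A], which is compact with square
    root [G x = B (K x)]. It contains an eigenvector of [K] by
    [compact_eigen], hence an eigenvector of [A] orthogonal to all the [e j],
    against the simplicity of the eigenvalues. *)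
Lemma eig_total y : (forall j, basis_coord ip e y j = 0) -> y = 0.
Proof.
move=> hy; apply: contrapT => /eqP y0.
have : ~ op_spectrum A 0.
  rewrite spA => -[j] /esym/eqP; rewrite -[0](rmorph0 (real_complex R)) => /eqP/complexI.
  by move/eqP; rewrite gt_eqF.
move/contrapT => -[S hS]; have [bS S1 S2] := hS.
pose K x := - S x; pose G x := B (K x).
have Sl : lin S by have [h _] := bS; exact: h.
have Kl : lin K by move=> a x z; rewrite /K Sl opprD scalerN.
have dK x : dom A (K x).
  by have [h _] := S1 x; have [] := op_domZ (-1) linA h; rewrite scaleN1r.
have AK x : A (K x) = x.
  have [h h2] := S1 x; have [_ h3] := op_domZ (-1) linA h.
  by rewrite scaleN1r in h3; rewrite /K h3 scaleN1r -[RHS]h2 scale0r sub0r.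
have KA x : dom A x -> K (A x) = x.
  by move=> hx; have := S2 x hx; rewrite scale0r sub0r -scaleN1r (linZ Sl) scaleN1r.
have Bd x : dom B (K x) /\ dom B (B (K x)).
  by have [_ _ h _] := sqB; apply/h.
have BB x : B (B (K x)) = x by have [_ _ _ h] := sqB; rewrite -h.
have Gl : lin G.
  by move=> a x z; rewrite /G Kl; have [_ ->] := op_lin a linB (Bd x).1 (Bd z).1.
have [C C0 hC] : exists2 C : R, 0 <= C & forall x, nr (K x) <= C * nr x.
  by have [C C0 h] := bounded_nr bS; exists C => // x; rewrite /K nrN.
have GK x z : ip (G x) (G z) = ip x (K z).
  rewrite /G -(sa_sym saB (Bd z).1 (Bd x).2) BB //.
have Ksym x z : ip (K x) z = ip x (K z).
  by rewrite -{1}(AK z) -(sa_sym saA (dK z) (dK x)) AK.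
have Ginj x : G x = 0 -> x = 0 by rewrite /G => h; rewrite -(BB x) h op0.
have Kcpt u : (forall n, nr (u n : H) <= 1) -> exists l,
     forall eps : R, 0 < eps -> forall n0, exists2 n : nat, (n0 <= n)%N & nr (K (u n) - l) <= eps.
  move=> hu; have [z [Rz0 hRz0] cRz] := cptA.
  have hR : is_resolvent A z (resolvent A z) by exact: (getPex (ex_intro _ _ hRz0)).
  set Rz := resolvent A z in cRz hR.
  have [_ _ R2] := hR.
  have KR x : K x = Rz (z *: K x - x) by have := R2 _ (dK x); rewrite AK.
  pose M := nr z * C + 1; have M1 : 0 < M by rewrite ltr_wpDl ?mulr_ge0 ?nr_ge0.
  pose w n := M^-1%:C *: (z *: K (u n) - u n).
  have hw n : nr (w n) <= 1.
    rewrite /w nrZ nrR ger0_norm ?invr_ge0 ?(ltW M1) // ler_pdivrMl // mulr1.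
    apply: le_trans (nrB _ _) _; rewrite nrZ /M; apply: lerD => //.
    rewrite ler_wpM2l ?nr_ge0 //; apply: le_trans (hC _) _.
    by rewrite -[leRHS]mulr1 ler_wpM2l.
  have [l hl] := compact_cluster cRz hw.
  exists (M%:C *: l) => eps eps0 n0.
  have [n hn h] := hl _ (divr_gt0 eps0 M1) n0; exists n => //.
  have Rl : lin Rz by have [[h' _] _ _] := hR; exact: h'.
  have -> : K (u n) = M%:C *: Rz (w n).
    rewrite KR; have -> : z *: K (u n) - u n = M%:C *: w n.
      by rewrite /w scalerA -rmorphM /= mulfV ?gt_eqF // rmorph1 scale1r.
    exact: linZ.
  by rewrite -scalerBr nrZ nrR (ger0_norm (ltW M1)) mulrC -ler_pdivlMr.
pose W := [set x | forall j, basis_coord ip e x j = 0].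
have [||||l [M [Wl l0 M0 Kll]]] := @compact_eigen _ _ ip hip K G W C Kl Gl C0 hC GK Ksym Ginj Kcpt.
- by move=> x z a hx hz j; rewrite coD coZ hx hz mulr0 addr0.
- move=> x hx j; rewrite /basis_coord Ksym; have [[hj Aj] _] := eA j.
  have -> : K (e j) = (m j)^-1%:C *: e j.
    rewrite -{2}(KA _ hj) Aj (linZ Kl) scalerA -rmorphM /= mulVf ?gt_eqF //.
    by rewrite rmorph1 scale1r.
  by rewrite ipZr -/(basis_coord ip e x j) hx mulr0.
- move=> l hl j; apply/nr_eq0/eqP; rewrite eq_le nr_ge0 andbT; apply: le_eps => eps eps0.
  rewrite add0r; have [x hx h] := hl eps eps0.
  have -> : basis_coord ip e l j = - basis_coord ip e (x - l) j by rewrite coB hx sub0r opprK.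
  by rewrite nrN; apply: le_trans (co_le hip eig_orth _ _) h.
- by exists y => //.
have Al : op_eigenspace A (M^-1)%:C l.
  have Ml : l = M^-1%:C *: K l by rewrite Kll scalerA -rmorphM /= mulVf ?gt_eqF // rmorph1 scale1r.
  have [h1 h2] := op_domZ M^-1%:C linA (dK l).
  by split; rewrite {1}Ml ?h2 ?AK //.
have : op_spectrum A (M^-1)%:C.
  move=> [S' [bS' _ S2']]; have [h1 h2] := Al; have := S2' l h1.
  rewrite h2 subrr => h3; move/eqP: l0; apply; rewrite -h3.
  by have [h _] := bS'; exact: (lin0 h).
rewrite spA => -[n hn]; rewrite hn in Al.
have [b [_ hb]] := simA n.
have [he n1] := eA n.
move: (he) (Al); rewrite hb => -[c1 h1] [c2 h2].
rewrite !big_ord1 in h1 h2.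
have c0 : c1 ord0 != 0.
  by apply/eqP => c0; move: n1; rewrite h1 c0 scale0r normr0 => /esym/eqP; rewrite oner_eq0.
have h3 : l = (c2 ord0 / c1 ord0) *: e n by rewrite h1 scalerA divfK.
have := Wl n; rewrite h3 coZ (coe eig_orth) eqxx mulr1 => h4.
by move/eqP: l0; apply; rewrite h3 h4 scale0r.
Qed.

(** With [s] the square root of [m j], the vector [B (e j) - s *: e j]
    satisfies [B u = - s *: u], which the nonnegativity of [B] excludes unless
    it vanishes. *)
Lemma eig_B j : dom B (e j) /\ B (e j) = (Num.sqrt (m j))%:C *: e j.
Proof.
have [[hj Aj] _] := eA j; have [_ nnB hd hBB] := sqB.
have [d1 d2] := (hd _).1 hj; split => //.
set s := Num.sqrt (m j).
have [d3 h3] := op_lin (- s)%:C linB d1 d2; set u := (- s)%:C *: e j + B (e j) in d3 h3.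
have ss : s ^+ 2 = m j by rewrite sqr_sqrtr // ltW.
have Bu : B u = (- s)%:C *: u.
  rewrite h3 -hBB // Aj /u scalerDr scalerA -rmorphM /= mulrNN -expr2 ss addrC //.
have := nnB u d3; rewrite Bu ipZl (ip_sqr hip) -rmorphM /= ler0c => h4.
have s0 : 0 < s by rewrite sqrtr_gt0.
have h5 : nr u ^+ 2 <= 0 by have := sqr_ge0 (nr u); nra.
have h6 : nr u = 0 by have := nr_ge0 u; nra.
move/nr_eq0: h6 => h6; rewrite -[RHS]addr0 -h6 /u rmorphN scaleNr addrA subrr add0r //.
Qed.

Local Notation co := (basis_coord ip e).
Local Notation part := (partial_sum ip e).

Lemma co_B f j : dom B f -> co (B f) j = (Num.sqrt (m j))%:C * co f j.
Proof.
move=> hf; have [d1 h1] := eig_B j.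
by rewrite /basis_coord (sa_sym saB d1 hf) h1 ipZr conjR.
Qed.

Lemma ip_limit x y x' y' : (forall n, ip x (part n y) = ip x' (part n y')) -> ip x y = ip x' y'.
Proof.
move=> h; have t a b := tends_ip hip (tends_cst a) (tends_part hip eig_orth eig_total b).
exact: tends_uniq (t x y) (tends_ext (fun n => esym (h n)) (t x' y')).
Qed.

(** For the converse, let [h] have the coordinates [sqrt (m j) * f_j].
    Self-adjointness of [B] gives [B f = h] once [ip (B g) f = ip g h], and
    this holds for the partial sums of [f] and [h]. *)
Lemma dom_BP f : dom B f <-> exists M : R, forall n, \sum_(j < n) m j * nr (co f j) ^+ 2 <= M.
Proof.
split=> [hf|[M hM]].
  exists (nr (B f) ^+ 2) => n; apply: le_trans (bessel hip eig_orth n (B f)).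
  apply: ler_sum => j _; rewrite co_B // nrM exprMn nrR real_normK ?num_real // sqr_sqrtr // ltW //.
have [|h [hh _]] := @riesz_fischer _ _ ip hip e eig_orth (fun j => (Num.sqrt (m j))%:C * co f j) M.
  move=> n; apply: le_trans (hM n); apply: ler_sum => j _.
  by rewrite nrM exprMn nrR real_normK ?num_real // sqr_sqrtr // ltW.
have [_ _ hB] := saB; suff : dom B f /\ B f = h by case.
apply/hB => g hg; apply: ip_limit => n.
rewrite /partial_sum /lsum ip_sum_r ip_sum_r.
apply: eq_bigr => j _; rewrite !ipZr -!/(co _ _) co_B // hh rmorphM /= conjR; ring.
Qed.

Lemma part_B n f : dom B f -> dom B (part n f) /\ B (part n f) = part n (B f).
Proof.
move=> hf; elim: n => [|n [IH1 IH2]].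
  by rewrite /partial_sum /lsum !big_ord0; split; [case: linB|exact: op0].
have [d1 h1] := eig_B n.
have [d2 h2] := op_lin (co f n) linB d1 IH1.
have E x : part n.+1 x = co x n *: e n + part n x by rewrite /partial_sum /lsum big_ord_recr addrC.
by rewrite !E; split => //; rewrite h2 IH2 h1 scalerA co_B // mulrC.
Qed.

Lemma ip_BB f k : dom B f -> ip (B f) (B (e k)) = (m k)%:C * co f k.
Proof.
move=> hf; have [d1 h1] := eig_B k; rewrite h1 ipZr conjR -/(co _ _) co_B // mulrA -rmorphM /=.
by rewrite -expr2 sqr_sqrtr // ltW.
Qed.

(** * The form in coordinates *)

Section Form.
Variables (v : H -> H -> R[i]) (T : operator H) (w : nat -> R).
Hypothesis bv : bounded_form B v.
Hypothesis w0 : forall j, 0 <= w j.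
Hypothesis hv : forall j k, `|v (e j) (e k)| <= (w j * w k)%:C.
Hypothesis fT : form_operator ip (dom B) (fun f g => ip (B f) (B g) + v f g) T.

Lemma form_nr : exists2 M : R, 0 <= M & forall f g, dom B f -> dom B g -> nr (v f g) <= M * nr (B f) * nr (B g).
Proof.
have [_ [M hM]] := bv; exists `|M| => // f g hf hg.
have := hM f g hf hg; rewrite !nrE -!rmorphM /= lecR => h; apply: le_trans h _.
by rewrite -!mulrA ler_wpM2r ?mulr_ge0 ?nr_ge0 ?ler_norm.
Qed.

Lemma form_linl (a : R[i]) f f' g : dom B f -> dom B f' -> dom B g -> v (a *: f + f') g = a * v f g + v f' g.
Proof. by have [[h _] _] := bv; exact: h. Qed.

Lemma form_linr (a : R[i]) f g g' : dom B f -> dom B g -> dom B g' -> v f (a *: g + g') = Num.conj a * v f g + v f g'.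
Proof. by have [[_ h] _] := bv; exact: h. Qed.

Lemma dom_Bsub f n : dom B f -> dom B (f - part n f).
Proof.
by move=> hf; have [d1 _] := part_B n hf; have [h _] := op_lin (-1) linB d1 hf; rewrite addrC -scaleN1r.
Qed.

Lemma B_tends f : dom B f -> tends (fun n => B (part n f)) (B f).
Proof.
by move=> hf; apply: tends_ext (tends_part hip eig_orth eig_total (B f)) => n; rewrite (part_B n hf).2.
Qed.

Lemma B_sub f g : dom B f -> dom B g -> B (f - g) = B f - B g.
Proof.
by move=> hf hg; have [_ h] := op_lin (-1) linB hg hf; rewrite addrC -scaleN1r h scaleN1r addrC.
Qed.

Lemma form_tendsl f g : dom B f -> dom B g -> tends (fun n => v (part n f) g : R[i]^o) (v f g).
Proof.
move=> hf hg q q0; have [M M0 hM] := form_nr.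
have c0 : 0 < M * nr (B g) + 1 by rewrite ltr_wpDl ?mulr_ge0 ?nr_ge0.
have [n0 h0] := B_tends hf (divr_gt0 q0 c0); exists n0 => n /h0; rewrite ler_pdivlMr // => h1.
have [d1 _] := part_B n hf; have d2 := dom_Bsub n hf.
have -> : v (part n f) g - v f g = - v (f - part n f) g.
  by have := form_linl 1 d2 d1 hg; rewrite scale1r mul1r subrK => ->; rewrite opprD addrCA subrr addr0.
rewrite nrN; apply: le_trans (hM _ _ d2 hg) (le_trans _ h1).
by rewrite B_sub // nrC mulrAC mulrC ler_wpM2l ?nr_ge0 // lerDl.
Qed.

Lemma form_tendsr f g : dom B f -> dom B g -> tends (fun n => v f (part n g) : R[i]^o) (v f g).
Proof.
move=> hf hg q q0; have [M M0 hM] := form_nr.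
have c0 : 0 < M * nr (B f) + 1 by rewrite ltr_wpDl ?mulr_ge0 ?nr_ge0.
have [n0 h0] := B_tends hg (divr_gt0 q0 c0); exists n0 => n /h0; rewrite ler_pdivlMr // => h1.
have [d1 _] := part_B n hg; have d2 := dom_Bsub n hg.
have -> : v f (part n g) - v f g = - v f (g - part n g).
  by have := form_linr 1 hf d2 d1; rewrite scale1r rmorph1 mul1r subrK => ->; rewrite opprD addrCA subrr addr0.
rewrite nrN; apply: le_trans (hM _ _ hf d2) (le_trans _ h1).
by rewrite B_sub // nrC mulrC ler_wpM2l ?nr_ge0 // lerDl.
Qed.

(** For partial sums of [f] this is the bound on the entries [v (e j) (e k)];
    the limit exists because [v] is bounded with respect to [B], whose values
    on partial sums converge. *)
Lemma form_bound f k (s : R) : dom B f -> (forall n, \sum_(j < n) w j * nr (co f j) <= s) ->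
  nr (v f (e k)) <= w k * s.
Proof.
move=> hf hs; have [d1 _] := eig_B k.
have hn n : nr (v (part n f) (e k)) <= w k * s.
  apply: le_trans (_ : w k * \sum_(j < n) w j * nr (co f j) <= _); last by rewrite ler_wpM2l.
  elim: n => [|n IH].
    rewrite /partial_sum /lsum !big_ord0 mulr0.
    have d0 : dom B 0 by case: linB.
    have := form_linl (-1) d0 d0 d1; rewrite scaler0 addr0 mulN1r addNr => ->.
    by rewrite nr0.
  have E : part n.+1 f = co f n *: e n + part n f by rewrite /partial_sum /lsum big_ord_recr addrC.
  have [d2 _] := eig_B n; have [d3 _] := part_B n hf.
  rewrite E form_linl // big_ord_recr /= mulrDr; apply: le_trans (nrD _ _) _.
  rewrite addrC; apply: lerD => //.
  have := hv n k; rewrite nr_le => h.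
  have := ler_wpM2l (nr_ge0 (co f n)) h; rewrite nrM.
  move: (nr (co f n)) (nr (v (e n) (e k))) => a b; lra.
by apply: (tends_nr_le (n1 := 0) (form_tendsl hf d1)) => n _; exact: hn.
Qed.

(** The test vectors [g] can be replaced by the [e k]: by antilinearity the
    equation extends to their combinations, and by continuity to the domain of
    [B]. *)
Lemma form_opP f h : (dom T f /\ T f = h) <->
  (dom B f /\ forall k, (m k)%:C * co f k + v f (e k) = co h k).
Proof.
split=> [/fT[hf h1]|[hf h1]].
  by split => // k; have [d1 _] := eig_B k; have := h1 _ d1; rewrite ip_BB.
apply/fT; split => // g hg.
have hn n : ip (B f) (B (part n g)) + v f (part n g) = ip h (part n g).
  elim: n => [|n IH].
    have -> x : part 0 x = 0 by rewrite /partial_sum /lsum big_ord0.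
    have d0 : dom B 0 by case: linB.
    have := form_linr (-1) hf d0 d0; rewrite scaler0 addr0 rmorphN1 mulN1r addNr => ->.
    by rewrite (op0 linB) !ip0r addr0.
  have E : part n.+1 g = co g n *: e n + part n g by rewrite /partial_sum /lsum big_ord_recr addrC.
  have [d2 _] := eig_B n; have [d3 _] := part_B n hg.
  have [_ h2] := op_lin (co g n) linB d2 d3.
  rewrite E form_linr // h2 !ipPr ip_BB // -/(co h n) -h1 -IH; ring.
have tg := tends_part hip eig_orth eig_total g.
have := tendsD (tends_ip hip (tends_cst (B f)) (B_tends hg)) (form_tendsr hf hg).
move/tends_uniq; apply; apply: (tends_ext _ (tends_ip hip (tends_cst h) tg)) => n.
by rewrite -hn.
Qed.

End Form.
End Structure.

(** * Rank of idempotents and the Fredholm alternative *)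

Section Rank.
Context {R : realType} {H : completeNormedModType R[i]}.

(** [nr (S x) = nr (S (S x)) <= q * nr (S x)]. *)
Lemma idem_small (S : H -> H) (q : R) : q < 1 -> (forall x, S (S x) = S x) ->
  (forall x, nr (S x) <= q * nr x) -> forall x, S x = 0.
Proof.
move=> q1 SS hq x; apply: nr_eq0; have := hq (S x); rewrite SS.
by have := nr_ge0 (S x); nra.
Qed.

(** The map [Q] is injective on the range of [P], where [P x = x] and
    [nr (x - Q x) <= q * nr x]. It maps this range onto the range of [Q]: if
    [u = Q x + (P - Q) ((P - Q) u)], then [Q (P (Q u)) = Q x]. *)
Lemma rank_close (P Q : H -> H) (q : R) n : lin P -> lin Q -> 0 <= q < 1 ->
  (forall x, P (P x) = P x) -> (forall x, Q (Q x) = Q x) ->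
  (forall x, nr (P x - Q x) <= q * nr x) -> has_rank P n -> has_rank Q n.
Proof.
move=> lP lQ /andP[q0 q1] PP QQ hq [b [bi bs]].
have Pb i : P (b i) = b i.
  have : range P (b i).
    rewrite bs; exists (fun j => (j == i)%:R).
    by rewrite (bigD1 i) //= eqxx scale1r big1 ?addr0 // => j /negbTE ->; rewrite scale0r.
  by move=> [x _ <-].
exists (fun i => Q (b i)); split.
  move=> c; have -> : \sum_i c i *: Q (b i) = Q (\sum_i c i *: b i).
    by rewrite (lin_sum lQ); apply: eq_bigr => i _; rewrite (linZ lQ).
  have Ps : P (\sum_i c i *: b i) = \sum_i c i *: b i.
    by rewrite (lin_sum lP); apply: eq_bigr => i _; rewrite (linZ lP) Pb.
  move=> Q0; apply: bi; apply: nr_eq0; have := hq (\sum_i c i *: b i).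
  by rewrite Q0 subr0 Ps; have := nr_ge0 (\sum_i c i *: b i); nra.
apply/seteqP; split => [y [x _ <-]|y [c ->]]; last first.
  exists (\sum_i c i *: b i) => //.
  by rewrite (lin_sum lQ); apply: eq_bigr => i _; rewrite (linZ lQ).
pose E x := P x - Q x.
have [||u hu] := @fixpoint _ _ (fun u => Q x + E (E u)) (q * q).
- by rewrite mulr_ge0 //=; nra.
- move=> u u'; rewrite opprD addrACA subrr add0r.
  have -> : E (E u) - E (E u') = E (E (u - u')).
    have EB a c : E a - E c = E (a - c) by rewrite /E (linB lP) (linB lQ) !opprD opprK addrACA.
    by rewrite EB EB.
  apply: le_trans (hq _) _; rewrite -mulrA ler_wpM2l //; exact: hq.
have hy : Q x = Q (P (Q u)).
  have : Q u = Q x + (Q u - Q (P (Q u))).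
    rewrite -{1}hu (linD lQ) QQ; congr (_ + _); rewrite /E !(linB lQ) !(linB lP) !(linB lQ) !QQ PP.
    by rewrite opprB [LHS]addrC addrA subrK.
  by move/eqP; rewrite addrA addrAC -subr_eq subrr eq_sym subr_eq0 => /eqP.
have : range P (P (Q u)) by exists (Q u).
rewrite bs => -[c hc]; exists c; rewrite hy hc (lin_sum lQ).
by apply: eq_bigr => i _; rewrite (linZ lQ).
Qed.

End Rank.

Section Fredholm.
Context {R : realType} {H : completeNormedModType R[i]}.
Variable ip : {dot H for (@Num.conj R[i])}.
Hypothesis hip : hilbert_norm ip.
Variable e : nat -> H.
Hypothesis orth : forall i j, ip (e i) (e j) = (i == j)%:R.

Local Notation co := (basis_coord ip e).
Local Notation part := (partial_sum ip e).

(** Since [K] is a contraction up to the finite-dimensional part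
    [part M (K x)], the equation [x = K x + y] becomes a linear system for the
    first [M] coordinates of [K x]. Its determinant decides between the two
    cases. *)
Lemma fredholm (K : H -> H) (C : R) (M : nat) : lin K -> 0 <= C ->
  (forall x, nr (K x) <= C * nr x) ->
  (forall x, nr (K x - part M (K x)) <= 2^-1 * nr x) ->
  (exists2 x, x != 0 & K x = x) \/
  (exists J, [/\ lin J, exists C' : R, forall y, nr (J y) <= C' * nr y,
     forall y, J y = K (J y) + y & forall x, J (x - K x) = x]).
Proof.
move=> lK C0 KC hM; pose G x := K x - part M (K x).
have lpart n : lin (part n).
  move=> a x y; rewrite /partial_sum /lsum scaler_sumr -big_split; apply: eq_bigr => i _.
  by rewrite coD coZ scalerDl scalerA.
have lG : lin G.
  by move=> a x y; rewrite /G lK lpart scalerBr opprD addrACA.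
have Nex y : exists x, x = G x + y.
  have [||x hx] := @fixpoint _ _ (fun x => G x + y) 2^-1; [lra| |by exists x].
  by move=> x x'; rewrite opprD addrACA subrr addr0 -(linB lG) /G; exact: hM.
(* [N] inverts [x |-> x - G x] *)
have [N hN] := choice Nex.
have Nu y x : x = G x + y -> x = N y.
  move=> hx; apply/eqP; rewrite -subr_eq0; apply/eqP/nr_eq0.
  have E : x - N y = G (x - N y) by rewrite {1}hx {1}hN (linB lG) opprD addrACA subrr addr0.
  have := hM (x - N y); rewrite -/(G _) -E; have := nr_ge0 (x - N y); lra.
have lN : lin N.
  move=> a x y; apply/esym/Nu; rewrite {1}hN {1}(hN y) lG scalerDr addrACA //.
have Nle y : nr (N y) <= 2 * nr y.
  have := nrD (G (N y)) y; rewrite -hN; have := hM (N y); rewrite -/(G _).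
  move: (nr (G (N y))) (nr (N y)) (nr y) => a b c; lra.
(* [al x] are the unknown coordinates, and [X y a] is the solution of
   [x = G x + y + a], where [a] is the combination of the [e j] with these
   coefficients *)
pose Q : 'M[R[i]]_M := \matrix_(j, i) co (K (N (e j))) i.
pose al x : 'rV[R[i]]_M := \row_i co (K x) i.
pose X y (a : 'rV[R[i]]_M) := N y + \sum_j a 0 j *: N (e j).
have alX y a : al (X y a) = al (N y) + a *m Q.
  apply/rowP => i; rewrite !mxE /X (linD lK) coD (lin_sum lK) /basis_coord.
  congr (_ + _); rewrite ip_sum_l.
  by apply: eq_bigr => j _; rewrite (linZ lK) ipZl !mxE.
have partE x : part M (K x) = \sum_(j < M) al x 0 j *: e j.
  by apply: eq_bigr => j _; rewrite mxE.
have Xfix y a : al (X y a) = a -> X y a = K (X y a) + y.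
  move=> ha; have E : X y a = N (y + part M (K (X y a))).
    by rewrite partE ha (linD lN) (lin_sum lN); congr (_ + _); apply: eq_bigr => j _; rewrite (linZ lN).
  have := hN (y + part M (K (X y a))); rewrite -E => {1}->.
  by rewrite /G [y + _]addrC addrA subrK.
have fixX x y : x = K x + y -> x = X y (al x).
  move=> hx; have -> : x = N (y + part M (K x)).
    by apply: Nu; rewrite /G [y + _]addrC addrA subrK.
  rewrite {1}partE (linD lN) (lin_sum lN); congr (_ + _).
  have <- : x = N (y + part M (K x)).
    by apply: Nu; rewrite /G [y + _]addrC addrA subrK.
  by apply: eq_bigr => j _; rewrite (linZ lN).
have [d0|d1] := eqVneq (\det (1%:M - Q)) 0.
  left; move/eqP/det0P: d0 => [a a0 ha].
  have aQ : a *m Q = a by move/eqP: ha; rewrite mulmxBr mulmx1 subr_eq0 => /eqP.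
  have N0 := lin0 lN.
  have aX : al (X 0 a) = a.
    rewrite alX N0 aQ; have -> : al 0 = 0 by apply/rowP => i; rewrite !mxE (lin0 lK) co0.
    by rewrite add0r.
  exists (X 0 a); last by rewrite [RHS](Xfix _ _ aX) addr0.
  apply: contra_neq a0 => X0; rewrite -aX X0; apply/rowP => i.
  by rewrite !mxE (lin0 lK) co0.
right; have uQ : 1%:M - Q \in unitmx by rewrite unitmxE unitfE.
pose I := invmx (1%:M - Q); pose J y := X y (al (N y) *m I).
have alJ y : al (J y) = al (N y) *m I.
  rewrite /J alX; have {1}-> : al (N y) = al (N y) *m I *m (1%:M - Q) by rewrite mulmxKV.
  by rewrite mulmxBr mulmx1 subrK.
have Jfix y : J y = K (J y) + y by apply: Xfix; exact: alJ.
have Ju x y : x = K x + y -> x = J y.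
  move=> hx; have hX := fixX _ _ hx; rewrite hX /J; congr (X _ _).
  have E : al x *m (1%:M - Q) = al (N y).
    by rewrite mulmxBr mulmx1 {1}hX alX addrK.
  by rewrite -E mulmxK.
exists J; split => //.
- move=> a x y; apply/esym/Ju; rewrite lK {1}Jfix {1}(Jfix y) scalerDr addrACA //.
- pose B := \sum_(j < M) \sum_(i < M) nr (I i j).
  exists (2 + C * 2 * B * 2) => y; rewrite /J /X; apply: le_trans (nrD _ _) _.
  rewrite mulrDl; apply: lerD; first exact: Nle.
  apply: le_trans (nr_sum _ _ _) _.
  apply: (@le_trans _ _ (\sum_(j < M) (C * (2 * nr y) * \sum_(i < M) nr (I i j)) * 2)).
    apply: ler_sum => j _; rewrite nrZ; apply: ler_pM; rewrite ?nr_ge0 //; last first.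
      by apply: le_trans (Nle _) _; rewrite (nre hip orth) mulr1.
    rewrite mxE; apply: le_trans (nr_sum _ _ _) _; rewrite mulr_sumr; apply: ler_sum => i _.
    rewrite nrM ler_wpM2r ?nr_ge0 // mxE; apply: le_trans (co_le hip orth _ _) _.
    by apply: le_trans (KC _) _; rewrite ler_wpM2l.
  by rewrite -mulr_suml -mulr_sumr; apply: le_of_eq; rewrite /B; ring.
- by move=> x; apply/esym/Ju; rewrite addrC subrK.
Qed.

Hypothesis total : forall y, (forall j, co y j = 0) -> y = 0.

Lemma rank_diag (S : H -> H) (chi : nat -> R[i]) N (idx : 'I_N -> nat) : injective idx ->
  (forall i, chi (idx i) = 1) -> (forall k, (forall i, k != idx i) -> chi k = 0) ->
  (forall x k, co (S x) k = chi k * co x k) -> has_rank S N.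
Proof.
move=> inj h1 h0 hS.
have cs (c : 'I_N -> R[i]) k : co (\sum_i c i *: e (idx i)) k = \sum_i c i * (idx i == k)%:R.
  rewrite /basis_coord ip_sum_l.
  by apply: eq_bigr => i _; rewrite ipZl orth.
have cs1 (c : 'I_N -> R[i]) i : co (\sum_i c i *: e (idx i)) (idx i) = c i.
  rewrite cs (bigD1 i) //= eqxx mulr1 big1 ?addr0 // => j ji.
  by rewrite (negbTE (_ : idx j != idx i)) ?mulr0 //; apply: contra_neq ji => /inj.
have cs0 (c : 'I_N -> R[i]) k : (forall i, k != idx i) -> co (\sum_i c i *: e (idx i)) k = 0.
  move=> hk; rewrite cs big1 // => j _; rewrite eq_sym (negbTE (hk j)) mulr0 //.
exists (fun i => e (idx i)); split.
  by move=> c hc i; rewrite -(cs1 c i) hc co0.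
apply/seteqP; split => [y [x _ <-]|y [c ->]].
  exists (fun i => co x (idx i)); apply: (co_ext total) => k; rewrite hS.
  have [[i ->]|hk] := pselect (exists i, k = idx i); first by rewrite cs1 h1 mul1r.
  have hk' i : k != idx i by apply/eqP => hki; apply: hk; exists i.
  by rewrite cs0 // h0 // mul0r.
exists (\sum_i c i *: e (idx i)) => //; apply: (co_ext total) => k; rewrite hS.
have [[i ->]|hk] := pselect (exists i, k = idx i); first by rewrite h1 mul1r.
have hk' i : k != idx i by apply/eqP => hki; apply: hk; exists i.
by rewrite cs0 // mulr0.
Qed.

End Fredholm.

(** * Poisson kernel bounds along the contours *)

Section Majorants.
Context {R : realType}.

Lemma pi_le4 : pi <= 4 :> R.
Proof. by have := pihalf_lt2 R; lra. Qed.

(** The kernel is at most [r^-1] on the circle, and the circle has the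
    Lipschitz constant [4 * pi * r <= 16 * r]. *)
Lemma circ_majorant (c rho : R[i]) (r D x : R) n (w : R[i]) : 0 < r -> nr rho = r ->
  (forall t, 0 <= D <= nr (circ c rho t - w)) -> (forall t, r <= nr (circ c rho t - w)) ->
  \sum_(i < n.+1) nr (circ c rho (node n i.+1) - circ c rho (node n i)) * (D / nr (circ c rho (node n i) - w) ^+ 2) <= 16.
Proof.
move=> r0 nrho hD hr.
apply: (@le_trans _ _ (\sum_(i < n.+1) (16 / n.+1%:R))); last first.
  rewrite sumr_const card_ord -[leLHS]mulr_natr; apply: le_of_eq.
  by field; rewrite nat1r pnatr_eq0.
apply: ler_sum => -[i hi] _ /=.
have h1 := @lip_step _ _ _ _ n i (circ_lip c rho) hi; rewrite nrho in h1.
have /andP[D0 h2] := hD (node n i); have h3 := hr (node n i).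
move: (nr (circ c rho (node n i) - w)) h2 h3 => X h2 h3.
have X0 : 0 < X by exact: lt_le_trans h3.
have h4 : D / X ^+ 2 <= r^-1.
  apply: (@le_trans _ _ X^-1); last by rewrite lef_pV2 ?posrE.
  by rewrite ler_pdivrMr ?exprn_gt0 // expr2 mulrA mulVf ?gt_eqF // mul1r.
apply: (@le_trans _ _ (r * (4 * pi) / n.+1%:R * r^-1)).
  by apply: ler_pM => //; rewrite ?nr_ge0 // divr_ge0 // exprn_ge0 // ltW.
rewrite mulrC !mulrA mulVf ?gt_eqF // mul1r ler_pM2r ?invr_gt0 //.
by have := pi_le4; lra.
Qed.

(** The relative height on the right side of the rectangle, constant along
    each of the other sides. *)
Definition clamp (t : R) : R := if t <= 4^-1 then 0 else if t <= 2^-1 then 4 * t - 1 else 1.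

Lemma quarter1 t : 0 <= t <= 4^-1 -> [/\ square_x t = 4 * t, square_y t = 0 & clamp t = 0].
Proof. by move=> /andP[t0 t1]; rewrite /square_x /square_y /clamp t1. Qed.

Lemma quarter2 t : 4^-1 <= t <= 2^-1 -> [/\ square_x t = 1, square_y t = 4 * t - 1 & clamp t = 4 * t - 1].
Proof.
by move=> /andP[t0 t1]; rewrite /square_x /square_y /clamp t1; case: ifP => h; split => //; lra.
Qed.

Lemma quarter3 t : 2^-1 <= t <= 3 / 4 -> [/\ square_x t = 3 - 4 * t, square_y t = 1 & clamp t = 1].
Proof.
move=> /andP[t0 t1]; rewrite /square_x /square_y /clamp t1.
have -> : (t <= 4^-1) = false by apply/negbTE; rewrite -ltNge; lra.
by case: ifP => h; split => //; lra.
Qed.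

Lemma quarter4 t : 3 / 4 <= t <= 1 -> [/\ square_x t = 0, square_y t = 4 - 4 * t & clamp t = 1].
Proof.
move=> /andP[t0 t1]; rewrite /square_x /square_y /clamp.
have -> : (t <= 4^-1) = false by apply/negbTE; rewrite -ltNge; lra.
have -> : (t <= 2^-1) = false by apply/negbTE; rewrite -ltNge; lra.
by case: ifP => h; split => //; lra.
Qed.

(** [y / (D + |y|)] is, up to a constant, a primitive of a majorant of the
    Poisson kernel [D / (D ^ 2 + y ^ 2)], and it is bounded independently of
    [D]. *)
Lemma poisson_step (D y y' : R) : 0 < D -> y <= y' -> y' - y <= D ->
  (y' - y) * (D / (D ^+ 2 + y ^+ 2)) <= 4 * (y' / (D + `|y'|) - y / (D + `|y|)).
Proof.
move=> D0 yy hy.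
have a0 : 0 <= `|y| by []. have b0 : 0 <= `|y'| by [].
have p1 : 0 < D + `|y| by lra. have p2 : 0 < D + `|y'| by lra.
have e1 : D * (y' - y) / ((D + `|y'|) * (D + `|y|)) <= y' / (D + `|y'|) - y / (D + `|y|).
  have -> : y' / (D + `|y'|) - y / (D + `|y|) = (y' * (D + `|y|) - y * (D + `|y'|)) / ((D + `|y'|) * (D + `|y|)).
    by field; rewrite !gt_eqF.
  rewrite ler_pM2r ?invr_gt0 ?mulr_gt0 //.
  suff : y * `|y'| <= y' * `|y| by move: (`|y|) (`|y'|) => u v; lra.
  have [hy0|hy0] := leP 0 y.
    have hy1 : 0 <= y' by lra.
    by rewrite !ger0_norm // mulrC.
  rewrite (ltr0_norm hy0); have [hy1|hy1] := leP 0 y'; last by rewrite (ltr0_norm hy1); lra.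
  by rewrite (ger0_norm hy1); have := mulr_ge0 hy1 (ltW (_ : 0 < - y)); rewrite oppr_gt0 => /(_ hy0); lra.
apply: le_trans (_ : 4 * (D * (y' - y) / ((D + `|y'|) * (D + `|y|))) <= _); last by rewrite ler_pM2l.
have -> : (y' - y) * (D / (D ^+ 2 + y ^+ 2)) = (D * (y' - y)) * (D ^+ 2 + y ^+ 2)^-1 by ring.
have -> : 4 * (D * (y' - y) / ((D + `|y'|) * (D + `|y|))) = (D * (y' - y)) * (4 / ((D + `|y'|) * (D + `|y|))) by ring.
apply: ler_wpM2l; first by rewrite mulr_ge0 ?(ltW D0) // subr_ge0.
have q0 : 0 < D ^+ 2 + y ^+ 2 by rewrite ltr_wpDr ?sqr_ge0 // exprn_gt0.
rewrite ler_pdivlMr ?mulr_gt0 // mulrC ler_pdivrMr //.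
have h1 : `|y'| <= D + `|y|.
  have := ler_normD (y' - y) y; rewrite subrK (@ger0_norm _ (y' - y)) ?subr_ge0 //; lra.
have h2 : `|y| ^+ 2 = y ^+ 2 by rewrite real_normK ?num_real.
rewrite -h2; move: (`|y|) (`|y'|) a0 b0 h1 p1 p2 => u v a0 b0 h1 p1 p2.
have h3 : (D + v) * (D + u) <= (D + (D + u)) * (D + u) by rewrite ler_wpM2r ?(ltW p1) // lerD2l.
have := sqr_ge0 (D - u); have := sqr_ge0 D; have := sqr_ge0 u; lra.
Qed.

(** Only the right side comes close to the eigenvalue, and there the kernel is
    a Poisson kernel. On the other sides the kernel is at most [h^-1], while
    their length is at most [6 * h]. The increments of [Psi] dominate both
    contributions, and [Psi] increases by at most [16] in total. With
    [4 * (k + 1)] cells the corners are nodes. *)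
Lemma rect_majorant (b h mj D : R) k : 0 < b -> b <= h -> b <> mj ->
  0 < D -> D <= `|b - mj| ->
  (forall t, 0 <= t <= 1 -> `|b - mj| <= nr (rectangle (- h) b (- h) h t - mj%:C)) ->
  2 * h / k.+1%:R <= `|b - mj| -> 0 < mj ->
  \sum_(i < (4 * k + 3).+1) nr (rectangle (- h) b (- h) h (node (4 * k + 3) i.+1) - rectangle (- h) b (- h) h (node (4 * k + 3) i))
     * (D / nr (rectangle (- h) b (- h) h (node (4 * k + 3) i) - mj%:C) ^+ 2) <= 16.
Proof.
move=> b0 bh bm D0 hD hg hk mj0.
have h0 : 0 < h by lra.
pose E := `|b - mj|.
have E0 : 0 < E by rewrite normr_gt0 subr_eq0; apply/eqP.
pose y t := - h + 2 * h * clamp t.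
pose Psi t := 8 * t + 4 * (y t / (E + `|y t|)).
set n := (4 * k + 3)%N.
set g := rectangle (- h) b (- h) h.
have hn : n.+1%:R = 4 * k.+1%:R :> R by rewrite /n -natrM -addnS mulnS addnC.
have K0 : 0 < k.+1%:R :> R by rewrite ltr0Sn.
apply: (@le_trans _ _ (\sum_(i < n.+1) (Psi (node n i.+1) - Psi (node n i)))); last first.
  rewrite -(big_mkord xpredT (fun i => Psi (node n i.+1) - Psi (node n i))) telescope_sumr // node0 node1.
  have [_ _ c0] := @quarter1 0 ltac:(lra).
  have [_ _ c1] := @quarter4 1 ltac:(lra).
  rewrite /Psi /y c0 c1; move: (- h + 2 * h * 0) (- h + 2 * h * 1) => v u.
  have hv : - 1 <= v / (E + `|v|).
    have := ler_norm (- v); rewrite normrN => hv.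
    have p : 0 < E + `|v| by rewrite ltr_pwDl.
    by rewrite lerNl -mulNr ler_pdivrMr // mul1r; apply: le_trans hv _; rewrite lerDr ltW.
  have hu : u / (E + `|u|) <= 1.
    have := ler_norm u => hu; have p : 0 < E + `|u| by rewrite ltr_pwDl.
    by rewrite ler_pdivrMr // mul1r; apply: le_trans hu _; rewrite lerDr ltW.
  by move: (u / _) (v / _) hu hv => x z; lra.
apply: ler_sum => -[i hi] _ /=.
have ti := @node_in R n i (ltnW hi); have ti1 := @node_in R n i.+1 hi.
have st := @node_step R n i.
have gle := hg _ ti; rewrite -/g -/E in gle.
have gX : 0 < nr (g (node n i) - mj%:C) by exact: lt_le_trans gle.
(* the sides at distance at least [h] from the eigenvalue *)
have far (l : R) : nr (g (node n i.+1) - g (node n i)) = l * (@node R n i.+1 - @node R n i) -> 0 <= l <= 8 * h ->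
    h <= nr (g (node n i) - mj%:C) -> clamp (node n i) = clamp (node n i.+1) ->
    nr (g (node n i.+1) - g (node n i)) * (D / nr (g (node n i) - mj%:C) ^+ 2) <= Psi (node n i.+1) - Psi (node n i).
  move=> hl /andP[l0 l8] hh hcl; rewrite hl /Psi /y hcl opprD addrACA subrr addr0 -mulrBr st.
  move: (nr (g (node n i) - mj%:C)) gle gX hh => X gle gX hh.
  have i0 : 0 <= n.+1%:R^-1 :> R by rewrite invr_ge0.
  apply: (@le_trans _ _ (8 * h * n.+1%:R^-1 * (h^-1))).
    have X2 : 0 <= D / X ^+ 2 by apply: divr_ge0; [exact: ltW|exact: sqr_ge0].
    have l1 : 0 <= l * n.+1%:R^-1 by exact: mulr_ge0.
    apply: (ler_pM l1 X2); first by rewrite ler_wpM2r.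
    apply: (@le_trans _ _ X^-1); last by rewrite lef_pV2 ?posrE.
    rewrite ler_pdivrMr ?exprn_gt0 // expr2 mulrA mulVf ?gt_eqF // mul1r.
    exact: le_trans hD gle.
  by rewrite mulrC !mulrA [h^-1 * 8]mulrC -[8 * _ * h]mulrA mulVf ?gt_eqF // mulr1.
have q4 j : node n j = j%:R / (4 * k.+1%:R) :> R by rewrite /node hn.
have qq (a : nat) : a%:R / 4 = (a * k.+1)%N%:R / (4 * k.+1%:R) :> R.
  by rewrite natrM; field; rewrite nat1r pnatr_eq0.
have ple (a j : nat) : (j <= a * k.+1)%N -> @node R n j <= a%:R / 4.
  by move=> hj; rewrite q4 qq ler_pM2r ?invr_gt0 ?mulr_gt0 // ler_nat.
have pge (a j : nat) : (a * k.+1 <= j)%N -> a%:R / 4 <= @node R n j.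
  by move=> hj; rewrite q4 qq ler_pM2r ?invr_gt0 ?mulr_gt0 // ler_nat.
have nrReal (x : R) : nr (x +i* 0) = `|x| by exact: nrR.
have nrImag (x : R) : nr (0 +i* x) = `|x|.
  by rewrite /nr normc_def /= expr0n /= add0r sqrtr_sqr.
have st0 : 0 <= @node R n i.+1 - @node R n i by rewrite st invr_ge0.
have [h1|h1] := ltnP i (1 * k.+1).
  have [p1 r1 c1] := @quarter1 (node n i) ltac:(have := ple 1%N i (ltnW h1); lra).
  have [p2 r2 c2] := @quarter1 (node n i.+1) ltac:(have := ple 1%N i.+1 h1; lra).
  apply: (far (4 * (b + h))); rewrite ?c1 ?c2 //; last 2 first.
  - by lra.
  - rewrite /g rectangleE p1 r1; apply: le_trans (nr_Im _); rewrite /= subr0 mulr0 addr0 normrN ger0_norm //; lra.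
  have -> : g (node n i.+1) - g (node n i) = (4 * (b + h) * (node n i.+1 - node n i)) +i* 0.
    by rewrite /g !rectangleE p1 p2 r1 r2; apply/eqP; rewrite eq_complex /=; apply/andP; split; apply/eqP; ring.
  by rewrite nrReal ger0_norm // !mulr_ge0 //; lra.
have [h2|h2] := ltnP i (2 * k.+1).
  have [p1 r1 c1] := @quarter2 (node n i) ltac:(have := ple 2%N i (ltnW h2); have := pge 1%N i h1; lra).
  have [p2 r2 c2] := @quarter2 (node n i.+1) ltac:(have := ple 2%N i.+1 h2; have := pge 1%N i.+1 (leqW h1); lra).
  have yE : y (node n i) = - h + 2 * h * (4 * node n i - 1) by rewrite /y c1.
  have yE' : y (node n i.+1) = - h + 2 * h * (4 * node n i.+1 - 1) by rewrite /y c2.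
  have dy : y (node n i.+1) - y (node n i) = 8 * h * (node n i.+1 - node n i) by rewrite yE yE'; ring.
  have -> : nr (g (node n i.+1) - g (node n i)) = y (node n i.+1) - y (node n i).
    have -> : g (node n i.+1) - g (node n i) = 0 +i* (y (node n i.+1) - y (node n i)).
      by rewrite /g !rectangleE p1 p2 r1 r2 yE yE'; apply/eqP; rewrite eq_complex /=; apply/andP; split; apply/eqP; ring.
    by rewrite nrImag ger0_norm // dy !mulr_ge0 // ltW.
  have nE : nr (g (node n i) - mj%:C) ^+ 2 = E ^+ 2 + y (node n i) ^+ 2.
    rewrite /g rectangleE p1 r1 nr_sqr /= yE /E real_normK ?num_real //; ring.
  rewrite nE; apply: le_trans (_ : (y (node n i.+1) - y (node n i)) * (E / (E ^+ 2 + y (node n i) ^+ 2)) <= _).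
    rewrite ler_wpM2l //; first by rewrite dy !mulr_ge0 // ltW.
    by rewrite ler_wpM2r // invr_ge0 addr_ge0 ?sqr_ge0.
  apply: le_trans (poisson_step E0 _ _) _.
  - by rewrite -subr_ge0 dy !mulr_ge0 // ltW.
  - rewrite dy st hn; apply: le_trans hk; apply: le_of_eq.
    by field; rewrite nat1r pnatr_eq0.
  by rewrite /Psi; move: (y (node n i.+1) / _) (y (node n i) / _) => u v; lra.
have [h3|h3] := ltnP i (3 * k.+1).
  have [p1 r1 c1] := @quarter3 (node n i) ltac:(have := ple 3%N i (ltnW h3); have := pge 2%N i h2; lra).
  have [p2 r2 c2] := @quarter3 (node n i.+1) ltac:(have := ple 3%N i.+1 h3; have := pge 2%N i.+1 (leqW h2); lra).
  apply: (far (4 * (b + h))); rewrite ?c1 ?c2 //; last 2 first.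
  - by lra.
  - rewrite /g rectangleE p1 r1; apply: le_trans (nr_Im _); rewrite /= subr0 mulr1 ger0_norm //; lra.
  have -> : g (node n i.+1) - g (node n i) = (- (4 * (b + h) * (node n i.+1 - node n i))) +i* 0.
    by rewrite /g !rectangleE p1 p2 r1 r2; apply/eqP; rewrite eq_complex /=; apply/andP; split; apply/eqP; ring.
  by rewrite nrReal normrN ger0_norm // !mulr_ge0 //; lra.
have E4 : (4 * k.+1 = (4 * k + 3).+1)%N by rewrite mulnS addnC [LHS]addnS.
have h4 : (i < 4 * k.+1)%N by rewrite E4.
have [p1 r1 c1] := @quarter4 (node n i) ltac:(have := ple 4%N i (ltnW h4); have := pge 3%N i h3; lra).
have [p2 r2 c2] := @quarter4 (node n i.+1) ltac:(have := ple 4%N i.+1 h4; have := pge 3%N i.+1 (leqW h3); lra).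
apply: (far (8 * h)); rewrite ?c1 ?c2 //; last 2 first.
- by lra.
- rewrite /g rectangleE p1 r1; apply: le_trans (nr_Re _); rewrite /= mulr0 addr0 ler0_norm; lra.
have -> : g (node n i.+1) - g (node n i) = 0 +i* (- (8 * h * (node n i.+1 - node n i))).
  by rewrite /g !rectangleE p1 p2 r1 r2; apply/eqP; rewrite eq_complex /=; apply/andP; split; apply/eqP; ring.
by rewrite nrImag normrN ger0_norm // !mulr_ge0 //; lra.
Qed.

End Majorants.

(** * Regions where the perturbation is small *)

(** Where the sums of [w j ^+ 2 / nr (z - m j)] are dominated by those of
    [w j ^+ 2 / d j]. *)
Definition good {R : realType} (m d : nat -> R) : set R[i] :=
  [set z | forall j, d j <= nr (z - (m j)%:C)].

Section Geometry.
Context {R : realType}.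
Variables (m rr : nat -> R).
Hypothesis m0 : forall j, 0 < m j.
Hypothesis mmono : forall i j, (i < j)%N -> m i < m j.
Hypothesis r0 : forall k, (0 < k)%N -> 0 < rr k.
Hypothesis rgap : forall k j, (0 < k)%N -> j != k -> 2 * rr k <= `|m k - m j|.

(** The distances kept from the eigenvalues by the contours of index [k]; up
    to a factor [2], the denominators of the gap sum. *)
Definition weight k j : R := if j == k then rr k / 2 else `|m k - m j| / 2.
Definition right_edge k : R := m k + rr k.

Lemma weight_ge k j : (0 < k)%N -> rr k / 2 <= weight k j.
Proof.
move=> k0; rewrite /weight; case: eqVneq => // jk.
by have := rgap k0 jk; have := r0 k0; lra.
Qed.

Lemma gap_lt k j : (0 < k)%N -> (j < k)%N -> 2 * rr k <= m k - m j.
Proof.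
move=> k0 jk; have := rgap k0 (_ : j != k); rewrite (ltn_eqF jk) => /(_ isT); rewrite ger0_norm //.
by rewrite subr_ge0 ltW // mmono.
Qed.

Lemma gap_gt k j : (0 < k)%N -> (k < j)%N -> 2 * rr k <= m j - m k.
Proof.
move=> k0 jk; have := rgap k0 (_ : j != k); rewrite eq_sym (ltn_eqF jk) => /(_ isT).
by rewrite distrC ger0_norm // subr_ge0 ltW // mmono.
Qed.

Lemma edge_gt0 k : (0 < k)%N -> 0 < right_edge k.
Proof. by move=> k0; rewrite /right_edge addr_gt0 ?r0. Qed.

Lemma edge_lt j k : (0 < j)%N -> (0 < k)%N -> (j < k)%N -> right_edge j <= m k - rr k.
Proof.
by move=> j0 k0 jk; have := gap_lt k0 jk; have := gap_gt j0 jk; rewrite /right_edge; lra.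
Qed.

Lemma good_circ k (z : R[i]) : (0 < k)%N -> rr k / 2 <= nr (z - (m k)%:C) <= rr k -> good m (weight k) z.
Proof.
move=> k0 /andP[h1 h2] j; rewrite /weight; case: eqVneq => [->//|jk].
have := rgap k0 jk; have h3 : `|m k - m j| = nr ((m k)%:C - (m j)%:C : R[i]) by rewrite -rmorphB nrR.
have := nr_tri (m k)%:C z (m j)%:C; rewrite -h3 nrC; lra.
Qed.

Lemma circ_ge k j (z : R[i]) : (0 < k)%N -> nr (z - (m k)%:C) = rr k -> rr k <= nr (z - (m j)%:C).
Proof.
move=> k0 h; have [->|jk] := eqVneq j k; first by rewrite h.
have := rgap k0 jk; have h3 : `|m k - m j| = nr ((m k)%:C - (m j)%:C : R[i]) by rewrite -rmorphB nrR.
have := nr_tri (m k)%:C z (m j)%:C; rewrite -h3 nrC h; lra.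
Qed.

Lemma weight_vert k j b : (0 < k)%N -> m k + rr k / 2 <= b <= right_edge k -> weight k j <= `|b - m j|.
Proof.
move=> k0 /andP[h1 h2]; have p := r0 k0; rewrite /right_edge in h2; rewrite /weight.
have [jk|jk|->] := ltngtP j k.
- have := gap_lt k0 jk => h; rewrite !ger0_norm; lra.
- have := gap_gt k0 jk => h; rewrite !ler0_norm; lra.
- by rewrite ger0_norm; lra.
Qed.

(** For an eigenvalue to the right of the line the real parts suffice. One to
    the left lies at a distance at most [b <= h] from the line, and there is
    no such [z] within a distance [h] of it. *)
Lemma far_line k j b h (z : R[i]) : (0 < k)%N -> m k + rr k / 2 <= b <= right_edge k -> b <= h ->
  complex.Re z <= b -> (complex.Re z <= - h \/ h <= `|complex.Im z|) -> `|b - m j| <= nr (z - (m j)%:C).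
Proof.
move=> k0 /andP[h1 h2] bh hz hor; have p := r0 k0; rewrite /right_edge in h2.
have hre : `|complex.Re z - m j| <= nr (z - (m j)%:C).
  by apply: le_trans (nr_Re _); case: (z) => x y /=.
have him : `|complex.Im z| <= nr (z - (m j)%:C).
  by apply: le_trans (nr_Im _); case: (z) => x y /=; rewrite subr0.
have [jk|jk] := leqP j k.
  have mj : m j <= m k by move: jk; rewrite leq_eqVlt => /orP[/eqP->//|/mmono/ltW].
  have q := m0 j; rewrite ger0_norm; last by lra.
  case: hor => hor; last by lra.
  by have := ler_norm (m j - complex.Re z); rewrite distrC; lra.
have := gap_gt k0 jk => hg; rewrite ler0_norm; last by lra.
by have := ler_norm (m j - complex.Re z); rewrite distrC; lra.
Qed.

Lemma rect_far k j b h t : (0 < k)%N -> m k + rr k / 2 <= b <= right_edge k -> b <= h -> 0 <= t <= 1 ->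
  `|b - m j| <= nr (rectangle (- h) b (- h) h t - (m j)%:C).
Proof.
move=> k0 hb bh /andP[t0 t1]; have p := r0 k0; have q := m0 k.
have h0 : 0 < h by case/andP: hb; lra.
have [t4|t4] := leP t 4^-1.
  have [p1 q1 _] := @quarter1 R t ltac:(lra).
  apply: (far_line j k0 hb bh); rewrite rectangleE p1 q1 /=; last by right; rewrite mulr0 addr0 normrN ger0_norm // ltW.
  have : (b - - h) * (4 * t) <= (b - - h) * 1 by rewrite ler_wpM2l; lra.
  lra.
have [t2|t2] := leP t 2^-1.
  have [p1 q1 _] := @quarter2 R t ltac:(lra).
  rewrite rectangleE p1 q1; apply: le_trans (nr_Re _) => /=.
  by have -> : - h + (b - - h) * 1 - m j = b - m j by ring.
have [t3|t3] := leP t (3 / 4).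
  have [p1 q1 _] := @quarter3 R t ltac:(lra).
  apply: (far_line j k0 hb bh); rewrite rectangleE p1 q1 /=; last first.
    right; have -> : - h + (h - - h) * 1 = h by ring.
    by rewrite ger0_norm // ltW.
  have : (b - - h) * (3 - 4 * t) <= (b - - h) * 1 by rewrite ler_wpM2l; lra.
  lra.
have [p1 q1 _] := @quarter4 R t ltac:(lra).
apply: (far_line j k0 hb bh); rewrite rectangleE p1 q1 /= mulr0 addr0; first by case/andP: hb; lra.
by left.
Qed.

Lemma good_rect k b h t : (0 < k)%N -> m k + rr k / 2 <= b <= right_edge k -> b <= h -> 0 <= t <= 1 ->
  good m (weight k) (rectangle (- h) b (- h) h t).
Proof.
by move=> k0 hb bh ht j; apply: le_trans (weight_vert j k0 hb) _; exact: (rect_far j k0 hb bh ht).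
Qed.

Lemma rect_dist b h b' h' dl (w : R[i]) t : - h <= b -> 0 <= h -> 0 <= t <= 1 -> dl <= b - b' -> dl <= h - h' ->
  box (- h') b' h' w -> dl <= nr (rectangle (- h) b (- h) h t - w).
Proof.
move=> hb h0 /andP[t0 t1] d1 d2; rewrite /box /= ler_norml => /andP[/andP[w1 w2] /andP[w3 w4]].
set z := rectangle _ _ _ _ _.
suff : dl <= complex.Re (z - w) \/ dl <= - complex.Re (z - w) \/ dl <= complex.Im (z - w) \/ dl <= - complex.Im (z - w).
  have k1 := nr_Re (z - w); have k2 := nr_Im (z - w).
  have k3 := ler_norm (complex.Re (z - w)); have k4 := ler_norm (- complex.Re (z - w)).
  have k5 := ler_norm (complex.Im (z - w)); have k6 := ler_norm (- complex.Im (z - w)).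
  rewrite !normrN in k4 k6.
  by move=> [k|[k|[k|k]]]; apply: le_trans k _; [apply: le_trans k3 k1|apply: le_trans k4 k1|apply: le_trans k5 k2|apply: le_trans k6 k2].
rewrite /z; case: (w) w1 w2 w3 w4 => x y /= *.
have [t4|t4] := leP t 4^-1.
  have [p1 q1 _] := @quarter1 R t ltac:(lra).
  by rewrite rectangleE p1 q1 /=; right; right; right; lra.
have [t2|t2] := leP t 2^-1.
  have [p1 q1 _] := @quarter2 R t ltac:(lra).
  by rewrite rectangleE p1 q1 /=; left; lra.
have [t3|t3] := leP t (3 / 4).
  have [p1 q1 _] := @quarter3 R t ltac:(lra).
  by rewrite rectangleE p1 q1 /=; right; right; left; lra.
have [p1 q1 _] := @quarter4 R t ltac:(lra).
by rewrite rectangleE p1 q1 /=; right; left; lra.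
Qed.

Lemma rect_segment a b c d a' b' c' d' s t :
  rectangle a b c d t + s%:C * (rectangle a' b' c' d' t - rectangle a b c d t) =
  rectangle (a + s * (a' - a)) (b + s * (b' - b)) (c + s * (c' - c)) (d + s * (d' - d)) t :> R[i].
Proof.
by rewrite !rectangleE; apply/eqP; rewrite eq_complex /=; apply/andP; split; apply/eqP; ring.
Qed.

Lemma circ_segment (c : R[i]) (r r' s : R) t :
  circ c r%:C t + s%:C * (circ c r'%:C t - circ c r%:C t) = circ c (r + s * (r' - r))%:C t.
Proof. by rewrite /circ rmorphD rmorphM rmorphB /=; ring. Qed.

Lemma circ_nr (c : R[i]) (r : R) t : 0 <= r -> nr (circ c r%:C t - c) = r.
Proof. by move=> r0'; rewrite /circ addrC addKr nrM nr_cis mulr1 nr_pos. Qed.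

Hypothesis minf : forall K : R, exists M, forall k, (M <= k)%N -> K <= m k.

Lemma nearest (x : R) : exists k, forall j, `|x - m k| <= `|x - m j|.
Proof.
have [M hM] := minf (x + `|x - m 0%N|).
pose k := [arg min_(i < ord0 : 'I_M.+1) `|x - m i|]%O.
have hk (j : 'I_M.+1) : `|x - m k| <= `|x - m j|.
  by rewrite /k; case: arg_minP => // i _ h; exact: h.
exists k => j; have [jM|Mj] := ltnP j M.+1; first exact: (hk (Ordinal jM)).
apply: le_trans (hk ord0) _ => /=.
have := hM j (ltnW Mj); have := ler_norm (m j - x); rewrite [`|m j - x|]distrC; lra.
Qed.

(** To the left of the line [Re z = right_edge k0] the weights of index [k0]
    are suitable; to its right, those of the eigenvalue nearest to [Re z]. *)
Lemma good_cover k0 h (z : R[i]) : (0 < k0)%N -> right_edge k0 <= h ->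
  ~ (- h < complex.Re z <= right_edge k0 /\ `|complex.Im z| <= h) ->
  (forall k, (k0 < k)%N -> rr k <= nr (z - (m k)%:C)) ->
  exists2 k, (k0 <= k)%N & good m (weight k) z.
Proof.
move=> k00 bh hP hD; have [zb|zb] := leP (complex.Re z) (right_edge k0).
  exists k0 => // j.
  have hb : m k0 + rr k0 / 2 <= right_edge k0 <= right_edge k0 by rewrite lexx andbT /right_edge; have := r0 k00; lra.
  apply: le_trans (weight_vert j k00 hb) _; apply: (far_line j k00 hb bh zb).
  have [hz|hz] := leP (complex.Re z) (- h); [by left|right].
  rewrite leNgt; apply/negP => hI; apply: hP; rewrite zb hz; split => //; exact: ltW.
have [k hk] := nearest (complex.Re z).
have hre j : `|complex.Re z - m j| <= nr (z - (m j)%:C).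
  by apply: le_trans (nr_Re _); case: (z) => x y /=.
have kk : (k0 <= k)%N.
  rewrite leqNgt; apply/negP => /mmono kk; have p := r0 k00; have := hk k0; rewrite /right_edge in zb.
  by rewrite !ger0_norm; lra.
exists k => // j; rewrite /weight; case: eqVneq => [->|jk].
  have := r0 (leq_trans k00 kk).
  move: kk; rewrite leq_eqVlt => /orP[/eqP <-|/hD]; last by lra.
  have := hre k0; have := ler_norm (complex.Re z - m k0); have := r0 k00; rewrite /right_edge in zb; lra.
have := hk j; have := hre j; have := ler_distD (complex.Re z) (m k) (m j); rewrite [`|m k - complex.Re z|]distrC; lra.
Qed.

End Geometry.

(** * The resolvent in coordinates *)

Section Model.
Context {R : realType} {H : completeNormedModType R[i]}.
Variable ip : {dot H for (@Num.conj R[i])}.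
Hypothesis hip : hilbert_norm ip.
Variable e : nat -> H.
Hypothesis orth : forall i j, ip (e i) (e j) = (i == j)%:R.
Hypothesis total : forall y, (forall j, basis_coord ip e y j = 0) -> y = 0.
Variables (m w : nat -> R).
Hypothesis m0 : forall j, 0 < m j.
Hypothesis w0 : forall j, 0 <= w j.
Variable (S0 : R).
Hypothesis hS0 : forall n, \sum_(j < n) w j ^+ 2 / m j <= S0.

Local Notation co := (basis_coord ip e).
Local Notation part := (partial_sum ip e).

(** The description of [T] on which everything below rests: [c f k] stands for
    [v f (e k)], and [c = 0] gives the unperturbed operator. *)
Record model (D : set H) (c : H -> nat -> R[i]) (T : operator H) : Prop := Model {
  model_dom : forall f, D f <-> exists M : R, forall n, \sum_(j < n) m j * nr (co f j) ^+ 2 <= M;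
  model_lin : forall (a : R[i]) f f' k, D f -> D f' -> c (a *: f + f') k = a * c f k + c f' k;
  model_bound : forall f k (s : R), D f -> (forall n, \sum_(j < n) w j * nr (co f j) <= s) ->
    nr (c f k) <= w k * s;
  model_op : forall f h, (dom T f /\ T f = h) <->
    (D f /\ forall k, (m k)%:C * co f k + c f k = co h k) }.

Section Solve.
Variables (D : set H) (c : H -> nat -> R[i]) (T : operator H).
Hypothesis hT : model D c T.

Lemma D_lin (a : R[i]) f g : D f -> D g -> D (a *: f + g).
Proof.
move=> /(model_dom hT)[M hM] /(model_dom hT)[M' hM']; apply/(model_dom hT).
exists (2 * nr a ^+ 2 * M + 2 * M') => n.
have := lerD (ler_wpM2l (mulr_ge0 (ler0n _ 2) (sqr_ge0 (nr a))) (hM n)) (ler_wpM2l (ler0n _ 2) (hM' n)).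
move=> h; apply: le_trans h; rewrite !mulr_sumr -big_split /=; apply: ler_sum => j _.
rewrite coD coZ; have h1 : nr (a * co f j + co g j) <= nr a * nr (co f j) + nr (co g j).
  by apply: le_trans (nrD _ _) _; rewrite nrM.
have h2 : nr (a * co f j + co g j) ^+ 2 <= (nr a * nr (co f j) + nr (co g j)) ^+ 2.
  by rewrite ler_pXn2r ?nnegrE ?nr_ge0 ?addr_ge0 ?mulr_ge0 ?nr_ge0.
have h3 := sqr_ge0 (nr a * nr (co f j) - nr (co g j)).
have h4 : m j * nr (a * co f j + co g j) ^+ 2 <= m j * (2 * (nr a * nr (co f j)) ^+ 2 + 2 * nr (co g j) ^+ 2).
  by rewrite ler_wpM2l ?(ltW (m0 j)) //; move: h2 h3; lra.
by apply: le_trans h4 _; apply: le_of_eq; ring.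
Qed.

Lemma D0 : D 0.
Proof.
apply/(model_dom hT); exists 0 => n; rewrite big1 // => j _.
by rewrite co0 nr0 expr0n mulr0.
Qed.

Lemma D_sub f g : D f -> D g -> D (f - g).
Proof. by move=> hf hg; rewrite addrC -scaleN1r; exact: D_lin. Qed.

Lemma c_sub f g k : D f -> D g -> c (f - g) k = c f k - c g k.
Proof. by move=> hf hg; rewrite addrC -scaleN1r (model_lin hT) // mulN1r addrC. Qed.

Lemma D_sigma f : D f -> exists s : R, forall n, \sum_(j < n) w j * nr (co f j) <= s.
Proof.
move=> /(model_dom hT)[M hM].
have S00 : 0 <= S0 by have := hS0 0%N; rewrite big_ord0.
have M0 : 0 <= M by have := hM 0%N; rewrite big_ord0.
exists (Num.sqrt S0 * Num.sqrt M) => n.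
have := @cauchy_sum_le _ n (fun j => w j / Num.sqrt (m j)) (fun j => Num.sqrt (m j) * nr (co f j)) _ _ (sqrtr_ge0 S0) (sqrtr_ge0 M).
rewrite !sqr_sqrtr // => h.
have sm j : Num.sqrt (m j) != 0 by rewrite gt_eqF // sqrtr_gt0.
have -> : \sum_(j < n) w j * nr (co f j) = \sum_(j < n) w j / Num.sqrt (m j) * (Num.sqrt (m j) * nr (co f j)).
  by apply: eq_bigr => j _; rewrite mulrA divfK.
apply: h.
  apply: le_trans (hS0 n); apply: ler_sum => j _.
  by rewrite exprMn exprVn sqr_sqrtr // ltW.
by apply: le_trans (hM n); apply: ler_sum => j _; rewrite exprMn sqr_sqrtr // ltW.
Qed.

Variables (d : nat -> R) (dl eps : R).
Hypothesis dl0 : 0 < dl.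
Hypothesis hd : forall j, dl <= d j.
Hypothesis eps1 : eps <= 2^-1.
Hypothesis heps : forall n, \sum_(j < n) w j ^+ 2 / d j <= eps.

Local Notation good := (good m d).

Let eps0 : 0 <= eps. Proof. by have := heps 0%N; rewrite big_ord0. Qed.
Let d0 j : 0 < d j. Proof. exact: lt_le_trans dl0 (hd j). Qed.

Lemma good_pos z j : good z -> 0 < nr (z - (m j)%:C).
Proof. by move=> /(_ j); exact: lt_le_trans. Qed.

Lemma good_dl z j : good z -> dl <= nr (z - (m j)%:C).
Proof. by move=> /(_ j); exact: le_trans. Qed.

Lemma good_neq z j : good z -> z - (m j)%:C != 0.
Proof. by move=> /(good_pos j); apply: contraTneq => ->; rewrite nr0 ltxx. Qed.

Lemma good_eps z n : good z -> \sum_(j < n) w j ^+ 2 / nr (z - (m j)%:C) <= eps.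
Proof.
move=> hz; apply: le_trans (heps n); apply: ler_sum => j _.
by rewrite ler_wpM2l ?sqr_ge0 // lef_pV2 ?posrE ?d0 ?(good_pos j hz).
Qed.

Lemma good_eps2 z n : good z -> \sum_(j < n) (w j / nr (z - (m j)%:C)) ^+ 2 <= eps / dl.
Proof.
move=> hz; rewrite ler_pdivlMr // mulr_suml; apply: le_trans (good_eps n hz); apply: ler_sum => j _.
have p := good_pos j hz; rewrite exprMn exprVn -mulrA ler_wpM2l ?sqr_ge0 //.
by rewrite expr2 invfM -mulrA ler_piMr ?invr_ge0 ?(ltW p) // mulrC ler_pdivrMr // mul1r good_dl.
Qed.

(** By the equation and [model_bound], the supremum [s1] of these sums, which
    is finite on [D], satisfies [s1 <= be + eps * s1]. *)
Lemma apriori z f (b : nat -> R[i]) (be : R) : good z -> D f ->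
  (forall k, (z - (m k)%:C) * co f k - c f k = b k) ->
  (forall n, \sum_(j < n) w j * nr (b j) / nr (z - (m j)%:C) <= be) ->
  forall n, \sum_(j < n) w j * nr (co f j) <= 2 * be.
Proof.
move=> hz Df hf hb.
have [s hs] := D_sigma Df.
pose E := [set x | exists n, x = \sum_(j < n) w j * nr (co f j)].
have hE : has_sup E.
  by split; [exists 0, 0%N; rewrite big_ord0|exists s => _ [n ->]].
move sE : (sup E) => s1.
have hs1 n : \sum_(j < n) w j * nr (co f j) <= s1.
  by rewrite -sE; apply: sup_upper_bound => //; exists n.
have s10 : 0 <= s1 by have := hs1 0%N; rewrite big_ord0.
have key n : \sum_(j < n) w j * nr (co f j) <= be + eps * s1.
  apply: le_trans (_ : \sum_(j < n) (w j * nr (b j) / nr (z - (m j)%:C) + s1 * (w j ^+ 2 / nr (z - (m j)%:C))) <= _).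
    apply: ler_sum => j _; have p := good_pos j hz.
    have h1 : nr (co f j) * nr (z - (m j)%:C) <= nr (b j) + w j * s1.
      rewrite mulrC -nrM; have -> : (z - (m j)%:C) * co f j = b j + c f j by rewrite -hf subrK.
      apply: le_trans (nrD _ _) _; rewrite lerD2l; exact: (model_bound hT).
    rewrite -ler_pdivlMr // in h1.
    apply: le_trans (ler_wpM2l (w0 j) h1) _.
    by apply: le_of_eq; ring.
  rewrite big_split /= -mulr_sumr; apply: lerD; first exact: hb.
  by rewrite [eps * _]mulrC ler_wpM2l // good_eps.
have : s1 <= be + eps * s1.
  by rewrite -sE; apply: ge_sup; [exists 0, 0%N; rewrite big_ord0|rewrite sE => _ [n ->]].
have : eps * s1 <= 2^-1 * s1 by rewrite ler_wpM2r.
by move=> h1 h2 n; apply: le_trans (hs1 n) _; lra.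
Qed.

Lemma beta_le z x n : good z ->
  \sum_(j < n) w j * nr (co x j) / nr (z - (m j)%:C) <= Num.sqrt (eps / dl) * nr x.
Proof.
move=> hz; have p : 0 <= eps / dl by rewrite divr_ge0 // ltW.
have -> : \sum_(j < n) w j * nr (co x j) / nr (z - (m j)%:C) = \sum_(j < n) w j / nr (z - (m j)%:C) * nr (co x j).
  by apply: eq_bigr => j _; rewrite mulrAC.
apply: (@cauchy_sum_le _ n (fun j => w j / nr (z - (m j)%:C)) (fun j => nr (co x j))); rewrite ?sqrtr_ge0 ?nr_ge0 //.
  by rewrite sqr_sqrtr // good_eps2.
exact: bessel.
Qed.

Definition solves z x f := D f /\ forall k, (z - (m k)%:C) * co f k - c f k = co x k.

Lemma solve_sigma z x f (be : R) : good z -> solves z x f ->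
  (forall n, \sum_(j < n) w j * nr (co x j) / nr (z - (m j)%:C) <= be) ->
  forall k, nr (c f k) <= w k * (2 * be).
Proof.
by move=> hz [Df hf] hb k; apply: (model_bound hT) => //; exact: (apriori hz Df hf hb).
Qed.

(** The factor [nr (z - m j)], bounded below and tending to infinity with [j],
    yields both the norm bound [solve_le] and the compactness estimate
    [res_tail]. *)
Lemma solve_energy z x f n : good z -> solves z x f ->
  \sum_(j < n) nr (z - (m j)%:C) * nr (co f j) ^+ 2 <= 4 / dl * nr x ^+ 2.
Proof.
move=> hz sf; have hc := solve_sigma hz sf (fun n => beta_le x n hz); have [Df hf] := sf.
have p : 0 <= eps / dl by rewrite divr_ge0 // ltW.
move sE : (Num.sqrt (eps / dl) * nr x) hc => s hc.
apply: (@le_trans _ _ (\sum_(j < n) (2 / dl * nr (co x j) ^+ 2 + 8 * s ^+ 2 * (w j ^+ 2 / nr (z - (m j)%:C))))).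
  apply: ler_sum => j _; have q := good_pos j hz; have qd := good_dl j hz.
  have h1 : nr (z - (m j)%:C) * nr (co f j) <= nr (co x j) + 2 * s * w j.
    have -> : 2 * s * w j = w j * (2 * s) by ring.
    rewrite -nrM (_ : (z - (m j)%:C) * co f j = co x j + c f j); last by rewrite -hf subrK.
    by apply: le_trans (nrD _ _) _; rewrite lerD2l.
  have h2 : nr (co x j) ^+ 2 / nr (z - (m j)%:C) <= nr (co x j) ^+ 2 / dl.
    by rewrite ler_wpM2l ?sqr_ge0 // lef_pV2.
  apply: (@le_trans _ _ (2 * (nr (co x j) ^+ 2 / nr (z - (m j)%:C)) + 8 * s ^+ 2 * (w j ^+ 2 / nr (z - (m j)%:C)))); last first.
    by rewrite lerD2r -[2 / dl * _]mulrA ler_pM2l // [leRHS]mulrC.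
  have -> : 2 * (nr (co x j) ^+ 2 / nr (z - (m j)%:C)) + 8 * s ^+ 2 * (w j ^+ 2 / nr (z - (m j)%:C)) =
    (2 * nr (co x j) ^+ 2 + 8 * s ^+ 2 * w j ^+ 2) / nr (z - (m j)%:C) by ring.
  rewrite ler_pdivlMr //; move: (nr (co x j)) (w j) (nr (z - _)) (nr (co f j)) (nr_ge0 (co f j)) q h1 => a b u t t0 q h1.
  have h3 : (u * t) ^+ 2 <= (a + 2 * s * b) ^+ 2 by rewrite ler_pXn2r ?nnegrE //; nra.
  have := sqr_ge0 (a - 2 * s * b); move: h3; lra.
rewrite big_split /= -!mulr_sumr.
have s2 : s ^+ 2 = eps / dl * nr x ^+ 2 by rewrite -sE exprMn sqr_sqrtr.
have h1 : 2 / dl * (\sum_(i < n) nr (co x i) ^+ 2) <= 2 / dl * nr x ^+ 2.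
  by rewrite ler_wpM2l ?bessel // divr_ge0 // ltW.
have h2 : 8 * s ^+ 2 * (\sum_(i < n) w i ^+ 2 / nr (z - (m i)%:C)) <= 8 * s ^+ 2 * eps.
  by rewrite ler_wpM2l ?good_eps // mulr_ge0 // sqr_ge0.
apply: le_trans (lerD h1 h2) _; rewrite s2.
have -> : 2 / dl * nr x ^+ 2 + 8 * (eps / dl * nr x ^+ 2) * eps = (2 + 8 * eps ^+ 2) * (nr x ^+ 2 / dl) by ring.
have -> : 4 / dl * nr x ^+ 2 = 4 * (nr x ^+ 2 / dl) by ring.
rewrite ler_wpM2r ?divr_ge0 ?sqr_ge0 ?(ltW dl0) //.
have : eps ^+ 2 <= 2^-1 ^+ 2 by rewrite ler_pXn2r ?nnegrE.
lra.
Qed.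

Lemma solve_le z x f : good z -> solves z x f -> nr f <= 2 / dl * nr x.
Proof.
move=> hz sf; apply: (nr_le_co hip orth total); first by rewrite mulr_ge0 ?nr_ge0 // divr_ge0 // ltW.
move=> n; have -> : (2 / dl * nr x) ^+ 2 = 4 / dl * nr x ^+ 2 / dl by field; rewrite gt_eqF.
rewrite ler_pdivlMr // mulr_suml; apply: le_trans (solve_energy n hz sf); apply: ler_sum => j _.
by rewrite mulrC ler_wpM2r ?sqr_ge0 ?good_dl.
Qed.

Lemma solve_uniq z x f g : good z -> solves z x f -> solves z x g -> f = g.
Proof.
move=> hz [Df hf] [Dg hg]; apply/eqP; rewrite -subr_eq0; apply/eqP/nr_eq0/eqP.
rewrite eq_le nr_ge0 andbT -[leRHS](_ : 2 / dl * nr (0 : H) = 0); last by rewrite nr0 mulr0.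
apply: (solve_le hz); split; first exact: D_sub.
move=> k; rewrite coB c_sub // co0 -(subrr (co x k)) -{1}hf -hg; ring.
Qed.

(** The unknown is the sequence [u k = c f k / sqrt (nr (z - m k))], from
    which [f] has the coordinates
    [(x_k + sqrt (nr (z - m k)) * u k) / (z - m k)]. In this variable the
    equation is a fixed point problem for a contraction of constant [eps]:
    both passages, from [u] to the sums of [w j * nr (f_j)] and back, cost a
    factor [sqrt eps]. *)
Lemma solve_exists z x : good z -> exists f, solves z x f.
Proof.
move=> hz; pose a k := Num.sqrt (nr (z - (m k)%:C)).
have a0 k : 0 < a k by rewrite sqrtr_gt0 (good_pos k hz).
have aa k : a k ^+ 2 = nr (z - (m k)%:C) by rewrite sqr_sqrtr // nr_ge0.
have nza k : nr (z - (m k)%:C)^-1 = (a k ^+ 2)^-1 by rewrite nrV aa.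
have aC k : (a k)%:C != 0 :> R[i] by rewrite eq_complex /= eqxx andbT gt_eqF.
have nra k : nr (a k)%:C = a k by rewrite nrR ger0_norm // ltW.
pose ka := 1 + nr z / dl.
have hka k : m k / nr (z - (m k)%:C) <= ka.
  have p := good_pos k hz; rewrite ler_pdivrMr // /ka mulrDl mul1r.
  apply: (@le_trans _ _ (nr (z - (m k)%:C) + nr z)).
    have := nr_tri (m k)%:C z 0; rewrite !subr0 nrR (ger0_norm (ltW (m0 k))) => h.
    by rewrite nrC.
  rewrite lerD2l mulrAC ler_pdivlMr // ler_wpM2l ?nr_ge0 // good_dl //.
pose F0 u k := (co x k + (a k)%:C * co u k) / (z - (m k)%:C).
have hF0 u k : nr (F0 u k) ^+ 2 <= 2 * (nr (co x k) ^+ 2 / nr (z - (m k)%:C) ^+ 2 + nr (co u k) ^+ 2 / nr (z - (m k)%:C)).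
  have p := good_pos k hz.
  rewrite /F0 nrM nrV exprMn exprVn -aa.
  have h1 : nr (co x k + (a k)%:C * co u k) <= nr (co x k) + a k * nr (co u k).
    by apply: le_trans (nrD _ _) _; rewrite nrM nra.
  have h2 : nr (co x k + (a k)%:C * co u k) ^+ 2 <= 2 * (nr (co x k) ^+ 2 + a k ^+ 2 * nr (co u k) ^+ 2).
    have : nr (co x k + (a k)%:C * co u k) ^+ 2 <= (nr (co x k) + a k * nr (co u k)) ^+ 2.
      by rewrite ler_pXn2r ?nnegrE ?nr_ge0 // addr_ge0 ?mulr_ge0 ?nr_ge0 // ltW.
    have := sqr_ge0 (nr (co x k) - a k * nr (co u k)); lra.
  have h3 := ler_wpM2r (_ : 0 <= (a k ^+ 2 ^+ 2)^-1) h2.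
  apply: le_trans (h3 _) _; first by rewrite invr_ge0 !exprn_ge0 // ltW.
  by apply: le_of_eq; field; rewrite gt_eqF.
have dsq k : nr (z - (m k)%:C) ^- 2 <= dl ^- 2.
  by rewrite lef_pV2 ?posrE ?exprn_gt0 ?(good_pos k hz) // ler_pXn2r ?nnegrE ?nr_ge0 ?(ltW dl0) ?good_dl.
have dsq1 k : nr (z - (m k)%:C)^-1 <= dl^-1.
  by rewrite nrV lef_pV2 ?posrE ?(good_pos k hz) ?good_dl.
have [F hF] : exists F : H -> H, forall u k, co (F u) k = F0 u k.
  have hu u : exists f, forall k, co f k = F0 u k.
    have [|f [hf _]] := @riesz_fischer _ _ ip hip e orth (F0 u) (2 * (nr x ^+ 2 / dl ^+ 2 + nr u ^+ 2 / dl)); last by exists f.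
    move=> n; apply: (@le_trans _ _ (\sum_(j < n) (2 * (nr (co x j) ^+ 2 / dl ^+ 2 + nr (co u j) ^+ 2 / dl)))).
      apply: ler_sum => k _; apply: le_trans (hF0 u k) _; rewrite ler_pM2l //.
      apply: lerD; apply: ler_wpM2l; rewrite ?sqr_ge0 ?dsq //.
      by have := dsq1 k; rewrite nrV.
    rewrite -mulr_sumr ler_pM2l // big_split /= -!mulr_suml; apply: lerD.
      by rewrite ler_wpM2r ?bessel // invr_ge0 exprn_ge0 // ltW.
    by rewrite ler_wpM2r ?bessel // invr_ge0 ltW.
  by have [F hF] := choice hu; exists F.
have ka0 : 0 <= ka by rewrite /ka addr_ge0 // divr_ge0 ?nr_ge0 // ltW.
have DF u : D (F u).
  apply/(model_dom hT); exists (2 * (ka / dl * nr x ^+ 2 + ka * nr u ^+ 2)) => n.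
  apply: (@le_trans _ _ (\sum_(j < n) (2 * (ka / dl * nr (co x j) ^+ 2 + ka * nr (co u j) ^+ 2)))).
    apply: ler_sum => k _; rewrite hF; apply: le_trans (ler_wpM2l (ltW (m0 k)) (hF0 u k)) _.
    rewrite mulrCA ler_pM2l // mulrDr; apply: lerD.
      rewrite (_ : m k * (nr (co x k) ^+ 2 / nr (z - (m k)%:C) ^+ 2) = (m k / nr (z - (m k)%:C)) * (nr (z - (m k)%:C))^-1 * nr (co x k) ^+ 2); last first.
        by rewrite expr2 [in LHS]invfM; ring.
      rewrite ler_wpM2r ?sqr_ge0 //; apply: ler_pM => //; first by rewrite divr_ge0 ?nr_ge0 // ltW.
        by rewrite invr_ge0 nr_ge0.
      by have := dsq1 k; rewrite nrV.
    rewrite (_ : m k * (nr (co u k) ^+ 2 / nr (z - (m k)%:C)) = m k / nr (z - (m k)%:C) * nr (co u k) ^+ 2); last by ring.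
    by rewrite ler_wpM2r ?sqr_ge0.
  rewrite -mulr_sumr ler_pM2l // big_split /= -!mulr_sumr; apply: lerD.
    by rewrite ler_wpM2l ?bessel // divr_ge0 // ltW.
  by rewrite ler_wpM2l ?bessel.
have waE n : \sum_(k < n) (w k / a k) ^+ 2 <= eps.
  by apply: le_trans (good_eps n hz); apply: ler_sum => k _; rewrite exprMn exprVn aa.
have wa_le (t : R) (g : nat -> R[i]) n : (forall k, nr (g k) <= w k * t) -> 0 <= t ->
   \sum_(k < n) nr (g k / (a k)%:C) ^+ 2 <= t ^+ 2 * eps.
  move=> hg t0; apply: (@le_trans _ _ (\sum_(k < n) t ^+ 2 * (w k / a k) ^+ 2)); last first.
    by rewrite -mulr_sumr ler_wpM2l ?sqr_ge0.
  apply: ler_sum => k _; rewrite -exprMn ler_pXn2r ?nnegrE ?nr_ge0 //; last first.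
    by rewrite mulr_ge0 // divr_ge0 // ltW.
  by rewrite nrM nrV nra mulrA ler_pM2r ?invr_gt0 // mulrC.
have [Th hTh] : exists Th : H -> H, forall u k, co (Th u) k = c (F u) k / (a k)%:C.
  have hu u : exists f, forall k, co f k = c (F u) k / (a k)%:C.
    have [s hs] := D_sigma (DF u).
    have s0 : 0 <= s by have := hs 0%N; rewrite big_ord0.
    have [|f [hf _]] := @riesz_fischer _ _ ip hip e orth (fun k => c (F u) k / (a k)%:C) (s ^+ 2 * eps); last by exists f.
    by move=> n; apply: (wa_le s) => // k; exact: (model_bound hT).
  by have [F' hF'] := choice hu; exists F'.
have [||u hu] := @fixpoint _ _ Th eps.
- by rewrite eps0 /=; apply: le_lt_trans eps1 _; lra.
- move=> u u'; pose N := nr (u - u').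
  have hs n : \sum_(j < n) w j * nr (co (F u - F u') j) <= Num.sqrt eps * N.
    have -> : \sum_(j < n) w j * nr (co (F u - F u') j) = \sum_(j < n) w j / a j * nr (co (u - u') j).
      apply: eq_bigr => j _; rewrite coB !hF /F0 -mulrBl opprD addrACA subrr add0r -mulrBr -coB.
      by rewrite !nrM nza nra; field; rewrite gt_eqF.
    apply: (@cauchy_sum_le _ n (fun j => w j / a j) (fun j => nr (co (u - u') j))); rewrite ?sqrtr_ge0 ?nr_ge0 //.
      by rewrite sqr_sqrtr.
    exact: bessel.
  have sN : 0 <= Num.sqrt eps * N by rewrite mulr_ge0 ?sqrtr_ge0 ?nr_ge0.
  apply: (nr_le_co hip orth total); first by rewrite mulr_ge0 ?nr_ge0.
  move=> n; have := wa_le _ (fun k => c (F u - F u') k) n (fun k => model_bound hT k (D_sub (DF u) (DF u')) hs) sN.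
  rewrite exprMn sqr_sqrtr // (_ : eps * N ^+ 2 * eps = (eps * N) ^+ 2); last by ring.
  move=> h; apply: le_trans h; apply: ler_sum => k _.
  by rewrite coB !hTh c_sub // mulrBl.
exists (F u); split => // k; rewrite hF /F0.
have := hTh u k; rewrite hu => ->; rewrite [(a k)%:C * _]mulrC divfK ?aC // mulrC divfK ?good_neq //.
by rewrite addrK.
Qed.

Lemma solves_op z x f : solves z x f <-> dom T f /\ z *: f - T f = x.
Proof.
split=> [[Df hf]|[df hx]].
  have [] := (model_op hT f (z *: f - x)).2 _.
    by split => // k; rewrite coB coZ -hf; ring.
  by move=> df ->; split => //; rewrite opprB addrC subrK.
have [Df hf] := (model_op hT f (T f)).1 (conj df erefl); split => // k.
by rewrite -hx coB coZ -hf; ring.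
Qed.

Lemma good_resolvent z : good z -> is_resolvent T z (resolvent T z) /\
  forall x, solves z x (resolvent T z x).
Proof.
move=> hz; have [S hS] := choice (fun x => solve_exists x hz).
suff hR : is_resolvent T z S.
  have hR' : is_resolvent T z (resolvent T z) by exact: (getPex (ex_intro _ _ hR)).
  by split => // x; have [_ h _] := hR'; apply/solves_op.
split.
- split.
    move=> a x y; apply: (solve_uniq hz (hS _)).
    have [D1 h1] := hS x; have [D2 h2] := hS y; split; first exact: D_lin.
    by move=> k; rewrite !coD !coZ (model_lin hT) // -h1 -h2; ring.
  exists (2 / dl) => x; rewrite (nrE (S x)) (nrE x) -rmorphM lecR; exact: (solve_le hz (hS x)).
- by move=> x; apply/solves_op.
- move=> f hf; apply: (solve_uniq hz (hS _)); exact/solves_op.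
Qed.


Lemma good_solves z x : good z -> solves z x (resolvent T z x).
Proof. by move=> hz; have [_ h] := good_resolvent hz. Qed.

Lemma good_is_resolvent z : good z -> is_resolvent T z (resolvent T z).
Proof. by move=> hz; have [h _] := good_resolvent hz. Qed.

Lemma good_resfam : resfam good (resolvent T) (2 / dl).
Proof.
apply: resolvent_fam; first by rewrite divr_ge0 // ltW.
  exact: good_is_resolvent.
move=> z x hz; exact: (solve_le hz (good_solves x hz)).
Qed.

Lemma res_tail z : (forall K : R, exists M, forall k, (M <= k)%N -> K <= m k) -> good z ->
  forall q, 0 < q -> exists M, forall x, nr (resolvent T z x - part M (resolvent T z x)) <= q * nr x.
Proof.
move=> hm hz q q0; pose K := 4 / dl / q ^+ 2; have [M hM] := hm (nr z + K); exists M => x.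
have K0 : 0 < K by rewrite !divr_gt0 ?exprn_gt0.
apply: (nr_le_co hip orth total); first by rewrite mulr_ge0 ?nr_ge0 // ltW.
move=> n; have -> : (q * nr x) ^+ 2 = 4 / dl * nr x ^+ 2 / K by rewrite /K; field; rewrite !gt_eqF.
rewrite ler_pdivlMr // mulr_suml; apply: le_trans (solve_energy n hz (good_solves x hz)).
apply: ler_sum => j _; rewrite coB co_part //; case: ltnP => Mj.
  by rewrite subrr nr0 expr0n mul0r mulr_ge0 ?sqr_ge0 ?nr_ge0.
rewrite subr0 mulrC ler_wpM2r ?sqr_ge0 //; have := hM j Mj.
have := nr_tri (m j)%:C z 0; rewrite !subr0 nrR (ger0_norm (ltW (m0 j))) nrC; lra.
Qed.

(** At one good point [z0] the resolvent is compact by [res_tail]; for any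
    other [z] that is not an eigenvalue, [z - T] is inverted through
    [1 - (z0 - z) R(z0)], to which [fredholm] applies. *)
Lemma spectrum_point z0 : (forall K : R, exists M, forall k, (M <= k)%N -> K <= m k) -> good z0 ->
  op_spectrum T = point_spectrum T.
Proof.
move=> hm hz0; have [[lR0 _] R1 R2] := good_is_resolvent hz0; have lR : lin (resolvent T z0) by exact: lR0.
move: R1 R2; set R0 := resolvent T z0 in lR *; move=> R1 R2.
have R0le x : nr (R0 x) <= 2 / dl * nr x by exact: (resfam_le good_resfam).
have C0 : 0 <= 2 / dl by rewrite divr_ge0 // ltW.
apply/seteqP; split => z; last first.
  move=> [f [df Tf] f0] [S [[lS _] _ S2]]; have := S2 f df; rewrite Tf subrr.
  have lS' : lin S by exact: lS.
  by rewrite (lin0 lS') => f00; rewrite -f00 eqxx in f0.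
apply: contra_notP => nz.
pose K x := (z0 - z) *: R0 x.
have lK : lin K by move=> a x y; rewrite /K lR scalerDr !scalerA mulrC.
have KC x : nr (K x) <= nr (z0 - z) * (2 / dl) * nr x.
  by rewrite nrZ -mulrA ler_wpM2l ?nr_ge0.
have n1 : 0 < nr (z0 - z) + 1 by rewrite ltr_wpDl ?nr_ge0.
have i2 : 0 < 2^-1 :> R by lra.
have [M hM] := res_tail hm hz0 (divr_gt0 i2 n1).
have [||[x x0 Kx]|[J [lJ [C' hJ] J1 J2]]] := @fredholm _ _ ip hip e orth K _ M lK _ KC.
- by rewrite mulr_ge0 ?nr_ge0.
- move=> x; have -> : K x - part M (K x) = (z0 - z) *: (R0 x - part M (R0 x)).
    rewrite /K /partial_sum /lsum scalerBr scaler_sumr; congr (_ - _); apply: eq_bigr => i _.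
    by rewrite coZ scalerA.
  rewrite nrZ; apply: le_trans (ler_wpM2l (nr_ge0 _) (hM x)) _.
  rewrite mulrA ler_wpM2r ?nr_ge0 // mulrCA -[leRHS]mulr1 ler_wpM2l ?invr_ge0 //.
  by rewrite ler_pdivrMr // mul1r lerDl.
- case: nz; exists x => //.
  have [d1 e1] := R1 ((z0 - z) *: x).
  have Ex : R0 ((z0 - z) *: x) = x by rewrite (linZ lR).
  rewrite Ex in d1 e1; split => //.
  have -> : T x = z0 *: x - (z0 - z) *: x by rewrite -e1 opprB addrC subrK.
  by rewrite -scalerBl opprB addrC subrK.
- exists (fun h => J (R0 h)); split.
  + split; first by move=> a x y; rewrite lR lJ.
    exists (`|C'| * (2 / dl)) => x; rewrite (nrE (J _)) (nrE x) -rmorphM lecR.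
    apply: le_trans (hJ _) _; apply: le_trans (ler_wpM2r (nr_ge0 _) (ler_norm C')) _.
    by rewrite -mulrA ler_wpM2l.
  + move=> h; have E : J (R0 h) = R0 ((z0 - z) *: J (R0 h) + h) by rewrite lR -/(K _) -J1.
    have [d1 e1] := R1 ((z0 - z) *: J (R0 h) + h); rewrite -E in d1 e1; split => //.
    move/eqP: e1; rewrite subr_eq => /eqP e1.
    have -> : z *: J (R0 h) = z0 *: J (R0 h) - (z0 - z) *: J (R0 h) by rewrite -scalerBl opprB addrC subrK.
    by rewrite e1 -addrA -opprD; apply/eqP; rewrite subr_eq [eqbRHS]addrCA [eqbRHS]addrA.
  + move=> f df; rewrite -[RHS]J2; congr (J _).
    have -> : z *: f - T f = (- (z0 - z)) *: f + (z0 *: f - T f).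
      by rewrite addrA -scalerDl addrC opprB subrK addrC.
    by rewrite lR R2 // scaleNr addrC.
Qed.

End Solve.

(** * Distance to the unperturbed Riesz projections *)

Section Difference.
Variables (D D' : set H) (c : H -> nat -> R[i]) (T A : operator H).
Hypothesis hT : model D c T.
Hypothesis hA : model D' (fun _ _ => 0) A.
Variables (d : nat -> R) (dl eps : R).
Hypothesis dl0 : 0 < dl.
Hypothesis hd : forall j, dl <= d j.
Hypothesis eps1 : eps <= 2^-1.
Hypothesis heps : forall n, \sum_(j < n) w j ^+ 2 / d j <= eps.
Local Notation good := (good m d).
Let eps0 : 0 <= eps. Proof. by have := heps 0%N; rewrite big_ord0. Qed.
Let d0 j : 0 < d j. Proof. exact: lt_le_trans dl0 (hd j). Qed.

Let gT z x (hz : good z) := good_solves hT dl0 hd eps1 heps x hz.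
Let gA z x (hz : good z) := good_solves hA dl0 hd eps1 heps x hz.

(** A sum of squared coordinates weighted by kernels whose integrals along the
    contours are bounded uniformly in [j]. *)
Definition gsum M x z := \sum_(j < M) nr (co x j) ^+ 2 * (d j / nr (z - (m j)%:C) ^+ 2).

(** The [j]-th coordinate of the difference is [c_j / (z - m j)], bounded by
    [2 * b x * w j / nr (z - m j)], so that the pairing is at most
    [2 * b x * b y]; and [b x ^+ 2 <= eps * gsum x] by Cauchy-Schwarz with the
    weights [d j]. The factors [nr x], [nr y] make the bound homogeneous after
    [2 a b <= a ^ 2 + b ^ 2]. *)
Lemma diff_point z x y M : good z ->
  nr x * nr y * nr (ip (resolvent T z (part M x) - resolvent A z (part M x)) (part M y)) <=
  eps * (gsum M x z * nr y ^+ 2 + gsum M y z * nr x ^+ 2).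
Proof.
move=> hz; pose b (x : H) := \sum_(j < M) w j * nr (co x j) / nr (z - (m j)%:C).
have pz j := good_pos dl0 hd j hz.
have hb x' : b x' ^+ 2 <= eps * gsum M x' z.
  have -> : b x' = \sum_(j < M) w j / Num.sqrt (d j) * (nr (co x' j) * Num.sqrt (d j) / nr (z - (m j)%:C)).
    apply: eq_bigr => j _; have n1 : Num.sqrt (d j) != 0 by rewrite gt_eqF // sqrtr_gt0.
    have n2 : nr (z - (m j)%:C) != 0 by rewrite gt_eqF.
    by field; rewrite ?n1 ?n2.
  apply: le_trans (@cauchy_sum _ M (fun j => w j / Num.sqrt (d j)) (fun j => nr (co x' j) * Num.sqrt (d j) / nr (z - (m j)%:C))) _.
  have -> : \sum_(j < M) (w j / Num.sqrt (d j)) ^+ 2 = \sum_(j < M) w j ^+ 2 / d j.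
    by apply: eq_bigr => j _; rewrite exprMn exprVn sqr_sqrtr // ltW.
  have -> : \sum_(j < M) (nr (co x' j) * Num.sqrt (d j) / nr (z - (m j)%:C)) ^+ 2 = gsum M x' z.
    by apply: eq_bigr => j _; rewrite !exprMn exprVn sqr_sqrtr ?(ltW (d0 j)) // mulrA.
  rewrite ler_wpM2r //; apply: sumr_ge0 => j _.
  by rewrite mulr_ge0 ?sqr_ge0 // divr_ge0 ?sqr_ge0 // ltW.
have b0 x' : 0 <= b x' by apply: sumr_ge0 => j _; rewrite divr_ge0 ?mulr_ge0 ?nr_ge0.
have sT := gT (part M x) hz; have sA := gA (part M x) hz.
have bX n : \sum_(j < n) w j * nr (co (part M x) j) / nr (z - (m j)%:C) <= b x.
  apply: le_trans (@sum_trunc _ (fun j => w j * nr (co (part M x) j) / nr (z - (m j)%:C)) M n _ _) _.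
  - by move=> j; rewrite divr_ge0 ?mulr_ge0 ?nr_ge0.
  - by move=> j Mj; rewrite co_part // ltnNge Mj /= nr0 mulr0 mul0r.
  by apply: ler_sum => j _; rewrite co_part // ltn_ord.
have hc := solve_sigma hT dl0 hd eps1 heps hz sT bX.
have key : nr (ip (resolvent T z (part M x) - resolvent A z (part M x)) (part M y)) <= 2 * b x * b y.
  rewrite /partial_sum /lsum -/(part M x) ip_sum_r.
  apply: le_trans (nr_sum _ _ _) _.
  rewrite /b mulr_sumr; apply: ler_sum => j _.
  rewrite ipZr -/(co _ j) nrM nr_conj coB.
  have -> : co (resolvent T z (part M x)) j - co (resolvent A z (part M x)) j =
     (z - (m j)%:C)^-1 * c (resolvent T z (part M x)) j.
    have [_ h1] := sT; have [_ h2] := sA; have nz := good_neq dl0 hd j hz.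
    apply: (mulfI nz); rewrite mulVKf // mulrBr; have := h1 j; rewrite -(h2 j) subr0 => <-; ring.
  rewrite nrM nrV; apply: le_trans (_ : nr (co y j) * ((nr (z - (m j)%:C))^-1 * (w j * (2 * b x))) <= _).
    by rewrite ler_wpM2l ?nr_ge0 // ler_wpM2l ?invr_ge0 ?nr_ge0.
  by apply: le_of_eq; rewrite /b; ring.
have h1 := hb x; have h2 := hb y; have nx := nr_ge0 x; have ny := nr_ge0 y.
apply: le_trans (ler_wpM2l (mulr_ge0 nx ny) key) _.
have h3 := sqr_ge0 (b x * nr y - b y * nr x).
have h4 : b x ^+ 2 * nr y ^+ 2 <= eps * gsum M x z * nr y ^+ 2 by rewrite ler_wpM2r ?sqr_ge0.
have h5 : b y ^+ 2 * nr x ^+ 2 <= eps * gsum M y z * nr x ^+ 2 by rewrite ler_wpM2r ?sqr_ge0.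
move: h3 h4 h5; move: (gsum M x z) (gsum M y z) (b x) (b y) => a1 a2 b1 b2; nra.
Qed.

(** Integration of [diff_point] along the path exchanges the integral with the
    sum over the coordinates, where [Cg] bounds each kernel. The division by
    [2 * pi * i] is estimated by [nr two_pi_i >= 4]. *)
Lemma rp_diff g Ag S S' (Cg : R) k0 : lip g Ag -> g 0 = g 1 -> (forall t, 0 <= t <= 1 -> good (g t)) ->
  is_rp (resolvent T) g S -> is_rp (resolvent A) g S' -> 0 <= Cg ->
  (forall k, (k0 <= k)%N -> forall j, \sum_(i < (4 * k + 3).+1)
     nr (g (node (4 * k + 3) i.+1) - g (node (4 * k + 3) i)) * (d j / nr (g (node (4 * k + 3) i) - (m j)%:C) ^+ 2) <= Cg) ->
  forall x, nr (S x - S' x) <= eps * Cg / 2 * nr x.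
Proof.
move=> lg cg gg hS hS' Cg0 hmaj.
have fT := good_resfam hT dl0 hd eps1 heps.
have fA := good_resfam hA dl0 hd eps1 heps.
have cont : contour good g Ag by split.
have lS : lin S := rp_lin fT cont hS; have lS' : lin S' := rp_lin fA cont hS'.
pose L x := S x - S' x.
have lL : lin L by move=> a x y; rewrite /L lS lS' scalerBr opprD addrACA.
have [B B0 hB] : exists2 B : R, 0 <= B & forall x, nr (L x) <= B * nr x.
  exists (Ag * (2 / dl) + Ag * (2 / dl)).
    by rewrite addr_ge0 // mulr_ge0 ?(lip_ge0 lg) // divr_ge0 // ltW.
  move=> x; rewrite mulrDl; apply: le_trans (nrB _ _) _; apply: lerD.
    exact: (rp_le fT x cont hS).
  exact: (rp_le fA x cont hS').
have fin x y M : nr x * nr y * nr (ip (L (part M x)) (part M y)) <= eps * Cg / 2 * (nr x ^+ 2 * nr y ^+ 2).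
  pose F t := resolvent T (g t) (part M x) - resolvent A (g t) (part M x).
  have hI : is_int g F (two_pi_i *: L (part M x)).
    have := intD (hS (part M x)) (intZ (-1) (hS' (part M x))).
    rewrite scaleN1r -scalerBr; apply: int_ext => t _; by rewrite scaleN1r.
  have hI2 := tends_sub (k := fun k => (4 * k + 3)%N) (fun n => leq_trans (leq_pmull n (isT : (0 < 4)%N)) (leq_addr 3 _)) hI.
  have hb k : (k0 <= k)%N -> nr (ip (left_sum g F (4 * k + 3)) ((nr x * nr y)%:C *: part M y)) <= 2 * eps * Cg * (nr x ^+ 2 * nr y ^+ 2).
    move=> hk; have hm := hmaj k hk; move: (4 * k + 3)%N hm => n hm.
    rewrite ipZr nrM nr_conj nrR ger0_norm ?mulr_ge0 ?nr_ge0 //.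
    rewrite /left_sum ip_sum_l.
    apply: le_trans (ler_wpM2l (mulr_ge0 (nr_ge0 x) (nr_ge0 y)) (nr_sum _ _ _)) _.
    rewrite mulr_sumr.
    apply: (@le_trans _ _ (\sum_(i < n.+1) nr (g (node n i.+1) - g (node n i)) * (eps * (gsum M x (g (node n i)) * nr y ^+ 2 + gsum M y (g (node n i)) * nr x ^+ 2)))).
      apply: ler_sum => i _; rewrite ipZl nrM mulrCA ler_wpM2l ?nr_ge0 //.
      by apply: diff_point; apply: gg; apply: node_in; rewrite ltnW.
    have gs x' : \sum_(i < n.+1) nr (g (node n i.+1) - g (node n i)) * gsum M x' (g (node n i)) <= Cg * nr x' ^+ 2.
      have -> : \sum_(i < n.+1) nr (g (node n i.+1) - g (node n i)) * gsum M x' (g (node n i)) =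
        \sum_(j < M) nr (co x' j) ^+ 2 * \sum_(i < n.+1) nr (g (node n i.+1) - g (node n i)) * (d j / nr (g (node n i) - (m j)%:C) ^+ 2).
        transitivity (\sum_(i < n.+1) \sum_(j < M) nr (co x' j) ^+ 2 * (nr (g (node n i.+1) - g (node n i)) * (d j / nr (g (node n i) - (m j)%:C) ^+ 2))).
          by apply: eq_bigr => i _; rewrite /gsum mulr_sumr; apply: eq_bigr => j _; rewrite mulrCA.
        by rewrite exchange_big /=; apply: eq_bigr => j _; rewrite mulr_sumr.
      apply: (@le_trans _ _ (\sum_(j < M) nr (co x' j) ^+ 2 * Cg)).
        by apply: ler_sum => j _; rewrite ler_wpM2l ?sqr_ge0.
      by rewrite -mulr_suml mulrC ler_wpM2l // bessel.
    have -> : \sum_(i < n.+1) nr (g (node n i.+1) - g (node n i)) * (eps * (gsum M x (g (node n i)) * nr y ^+ 2 + gsum M y (g (node n i)) * nr x ^+ 2)) =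
      eps * ((\sum_(i < n.+1) nr (g (node n i.+1) - g (node n i)) * gsum M x (g (node n i))) * nr y ^+ 2 +
             (\sum_(i < n.+1) nr (g (node n i.+1) - g (node n i)) * gsum M y (g (node n i))) * nr x ^+ 2).
      rewrite mulrDr !mulr_suml !mulr_sumr -big_split; apply: eq_bigr => i _ /=; ring.
    have h1 := ler_wpM2r (sqr_ge0 (nr y)) (gs x); have h2 := ler_wpM2r (sqr_ge0 (nr x)) (gs y).
    apply: le_trans (ler_wpM2l eps0 (lerD h1 h2)) _.
    by apply: le_of_eq; ring.
  have := tends_nr_le (tends_ip hip hI2 (tends_cst _)) hb.
  rewrite ipZl ipZr nrM [nr (Num.conj _ * _)]nrM nr_conj nrR ger0_norm ?mulr_ge0 ?nr_ge0 //.
  have t4 := @two_pi_i_ge4 R.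
  have h0 : 0 <= nr x * nr y * nr (ip (L (part M x)) (part M y)) by rewrite !mulr_ge0 ?nr_ge0.
  have := ler_wpM2r h0 t4; move: (nr x * nr y * _) h0 => X X0; move: (nr two_pi_i * X) => Y; lra.
have full x y : nr (ip (L x) y) * (nr x * nr y) <= eps * Cg / 2 * (nr x * nr y) * (nr x * nr y).
  have lx : tends (fun n => L (part n x)) (L x).
    by apply: (tends_lin _ (tends_part hip orth total x)) => u v; rewrite -(linB lL); exact: hB.
  have t := tendsZ (nr x * nr y)%:C (tends_ip hip lx (tends_part hip orth total y)).
  have nxy : nr (nr x * nr y)%:C = nr x * nr y by rewrite nrR ger0_norm // mulr_ge0 ?nr_ge0.
  have := tends_nr_le (n1 := 0) t (M := eps * Cg / 2 * (nr x ^+ 2 * nr y ^+ 2)).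
  rewrite nrZ nxy [_ * nr (ip _ _)]mulrC => h; apply: le_trans (h _) _ => [n _|].
    by rewrite nrZ nxy; exact: fin.
  by apply: le_of_eq; ring.
move=> x; have := full x (L x); rewrite (ip_sqr hip) nrR ger0_norm ?sqr_ge0 //.
have nL := nr_ge0 (L x); have nx := nr_ge0 x; rewrite -/(L x).
have e0 : 0 <= eps * Cg / 2 by rewrite divr_ge0 // mulr_ge0.
have [->|p1] := eqVneq (nr (L x)) 0; first by move=> _; rewrite mulr_ge0.
have [x0|p2] := eqVneq (nr x) 0.
  by move=> _; apply: le_trans (hB x) _; rewrite x0 !mulr0.
have q1 : 0 < nr (L x) by rewrite lt_def p1.
have q2 : 0 < nr x by rewrite lt_def p2.
rewrite ler_pM2r ?mulr_gt0 // expr2 mulrA ler_pM2r //.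
Qed.

(** In the [k]-th coordinate the unperturbed resolvent is the Cauchy kernel of
    [m k]. *)
Lemma rp_diag g Ag S' (chi : nat -> R[i]) : lip g Ag -> g 0 = g 1 -> (forall t, 0 <= t <= 1 -> good (g t)) ->
  is_rp (resolvent A) g S' ->
  (forall k (x : H), is_int g (fun t => cauchy_kern (m k)%:C (g t) x) ((chi k * two_pi_i) *: x)) ->
  forall x k, co (S' x) k = chi k * co x k.
Proof.
move=> lg cg gg hS' hchi x k.
have fA := good_resfam hA dl0 hd eps1 heps.
have cont : contour good g Ag by split.
have h := hS' x; have h2 := hchi k (co x k *: e k).
suff E : two_pi_i * co (S' x) k = chi k * two_pi_i * co x k.
  by apply: (mulfI (@two_pi_i_neq0 R)); rewrite E; ring.
have E2 : chi k * two_pi_i * co x k = ip ((chi k * two_pi_i) *: (co x k *: e k)) (e k).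
  by rewrite !ipZl orth eqxx mulr1.
rewrite E2 -ipZl.
apply/eqP; rewrite -subr_eq0 -ipBl; apply/eqP.
have hd2 := intD h (intZ (-1) h2); rewrite scaleN1r in hd2.
apply: (tends_uniq (tends_ip hip hd2 (tends_cst (e k)))); apply: (tends_eventually (n0 := 0)) => n _.
rewrite /left_sum ip_sum_l.
rewrite big1 // => i _.
have hz : good (g (node n i)) by apply: gg; apply: node_in; rewrite ltnW.
have [_ hs] := gA x hz; have := hs k; rewrite subr0 => hk.
rewrite ipZl ipDl ipZl /cauchy_kern !ipZl orth eqxx mulr1 -hk mulKf ?(good_neq dl0 hd k hz) //.
by rewrite mulN1r subrr mulr0.
Qed.

End Difference.

(** * Products of the Riesz projections *)

Section Assembly.
Variable rr : nat -> R.
Hypothesis mmono : forall i j, (i < j)%N -> m i < m j.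
Hypothesis minf : forall K : R, exists M, forall k, (M <= k)%N -> K <= m k.
Hypothesis r0 : forall k, (0 < k)%N -> 0 < rr k.
Hypothesis rgap : forall k j, (0 < k)%N -> j != k -> 2 * rr k <= `|m k - m j|.

Local Notation weight := (weight m rr).
Local Notation edge := (right_edge m rr).
Local Notation Z k := (good m (weight k)).
Local Notation cir k r := (circ (m k)%:C r%:C).
Local Notation rec k h := (rectangle (- h) (edge k) (- h) h).

Definition gap_small k (eta : R) := (0 < k)%N /\ forall n, \sum_(j < n) w j ^+ 2 / weight k j <= eta.

Section OneOperator.
Variables (D : set H) (c : H -> nat -> R[i]) (T : operator H).
Hypothesis hT : model D c T.
Local Notation RT := (resolvent T).

Let half_gt0 k : (0 < k)%N -> 0 < rr k / 2.
Proof. by move=> k0; rewrite divr_gt0 ?r0. Qed.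

Lemma gap_resfam k eta : gap_small k eta -> eta <= 2^-1 -> resfam (Z k) RT (2 / (rr k / 2)).
Proof.
move=> [k0 h] e1.
by have := (good_resfam hT (half_gt0 k0) (fun j => weight_ge r0 rgap j k0) e1 h).
Qed.

Lemma gap_is_resolvent k eta z : gap_small k eta -> eta <= 2^-1 -> Z k z -> is_resolvent T z (RT z).
Proof.
move=> [k0 h] e1.
exact: (good_is_resolvent hT (half_gt0 k0) (fun j => weight_ge r0 rgap j k0) e1 h).
Qed.

Lemma gap_resfam2 j k eta : gap_small j eta -> gap_small k eta -> eta <= 2^-1 -> exists C, resfam (Z j `|` Z k) RT C.
Proof.
move=> hj hk e1; have fj := gap_resfam hj e1; have fk := gap_resfam hk e1.
exists (2 / (rr j / 2) + 2 / (rr k / 2)).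
have cj : 0 <= 2 / (rr j / 2) by case: fj. have ck : 0 <= 2 / (rr k / 2) by case: fk.
apply: resolvent_fam; first by rewrite addr_ge0.
  by move=> z [/(gap_is_resolvent hj e1)|/(gap_is_resolvent hk e1)].
move=> z x hz; rewrite mulrDl; case: hz => hz.
  by apply: le_trans (resfam_le fj x hz) _; rewrite lerDl mulr_ge0 ?nr_ge0.
by apply: le_trans (resfam_le fk x hz) _; rewrite lerDr mulr_ge0 ?nr_ge0.
Qed.

Lemma contour_sub (Z1 Z2 : set R[i]) g A : Z1 `<=` Z2 -> contour Z1 g A -> contour Z2 g A.
Proof. by move=> h [h1 h2 h3]; split => // t ht; exact/h/h3. Qed.

Lemma circ_contour k r : (0 < k)%N -> rr k / 2 <= r <= rr k -> contour (Z k) (cir k r) (nr r%:C * (4 * pi)).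
Proof.
move=> k0 hr; split; [exact: circ_lip|exact: circ_closed|move=> t _].
apply: good_circ => //; rewrite circ_nr //; have := r0 k0; case/andP: hr; lra.
Qed.

Lemma rect_contour k b h : (0 < k)%N -> m k + rr k / 2 <= b <= edge k -> b <= h ->
  contour (Z k) (rectangle (- h) b (- h) h) (4 * (`|b - - h| + `|h - - h|)).
Proof.
move=> k0 hb bh; split; [exact: rect_lip|exact: rect_closed|move=> t ht].
exact: (good_rect m0 mmono r0 rgap).
Qed.

Lemma edge_vert k : (0 < k)%N -> m k + rr k / 2 <= edge k <= edge k.
Proof. by move=> k0; rewrite lexx andbT /right_edge; have := r0 k0; lra. Qed.

(** [riesz_product] needs room between its two contours; shrinking the contour
    provides it when both projections are the same. *)
Lemma half_rp k eta S : gap_small k eta -> eta <= 2^-1 -> is_rp RT (cir k (rr k)) S -> is_rp RT (cir k (rr k / 2)) S.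
Proof.
move=> hk e1 hS x; have [k0 _] := hk; have p := r0 k0.
have := @resfam_homotopy _ _ _ _ _ (gap_resfam hk e1) (cir k (rr k)) (cir k (rr k / 2)) (nr (rr k)%:C * (4 * pi)) x (two_pi_i *: S x).
apply; [exact: circ_lip| |exact: circ_closed|exact: circ_closed| |exact: hS].
  apply: lip_mono (circ_lip _ _) _; rewrite ler_wpM2r ?mulr_ge0 ?pi_ge0 // !nr_pos; lra.
move=> s t /andP[s0 s1] _; rewrite circ_segment; apply: good_circ => //.
rewrite circ_nr; nra.
Qed.

Lemma circ_idem k eta S : gap_small k eta -> eta <= 2^-1 -> is_rp RT (cir k (rr k)) S -> forall x, S (S x) = S x.
Proof.
move=> hk e1 hS x; have [k0 _] := hk; have p := r0 k0; have hS2 := half_rp hk e1 hS.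
have hr1 : rr k / 2 <= rr k <= rr k by lra.
have hr2 : rr k / 2 <= rr k / 2 <= rr k by lra.
have c1 := circ_contour k0 hr1; have c2 := circ_contour k0 hr2.
rewrite -[RHS]scale1r.
apply: (riesz_product (gap_resfam hk e1) c2 hS2 c1 hS (@disc_convex _ (m k)%:C (rr k / 2)) _ (half_gt0 k0)).
- by move=> t _; apply: circ_disc; lra.
- move=> v t; rewrite /disc /= => hv _.
  have := nr_tri (cir k (rr k) t) v (m k)%:C; rewrite circ_nr; lra.
- move=> v y; rewrite /disc /= mul1r => hv; apply: wind_circ_in; lra.
Qed.

Lemma shrink_rp k h eta S : gap_small k eta -> eta <= 2^-1 -> 2 * edge k <= h -> is_rp RT (rec k h) S ->
  is_rp RT (rectangle (- (h / 2)) (m k + rr k / 2) (- (h / 2)) (h / 2)) S.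
Proof.
move=> hk e1 hh hS x; have [k0 _] := hk; have p := r0 k0; have q := m0 k; have b0 := edge_gt0 m0 r0 k0.
pose A1 := 4 * (`|edge k - - h| + `|h - - h|).
pose A2 := 4 * (`|m k + rr k / 2 - - (h / 2)| + `|h / 2 - - (h / 2)|).
have := @resfam_homotopy _ _ _ _ _ (gap_resfam hk e1) (rec k h) (rectangle (- (h / 2)) (m k + rr k / 2) (- (h / 2)) (h / 2)) (A1 + A2) x (two_pi_i *: S x).
have A10 : 0 <= A1 by rewrite mulr_ge0 // addr_ge0.
have A20 : 0 <= A2 by rewrite mulr_ge0 // addr_ge0.
apply; [| |exact: rect_closed|exact: rect_closed| |exact: hS].
- by apply: lip_mono (rect_lip _ _ _ _) _; rewrite lerDl.
- by apply: lip_mono (rect_lip _ _ _ _) _; rewrite lerDr.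
move=> s t /andP[s0 s1] ht; rewrite rect_segment.
have -> : - h + s * (- (h / 2) - - h) = - (h + s * (h / 2 - h)) by ring.
apply: (good_rect m0 mmono r0 rgap) => //; rewrite /right_edge in hh b0 *.
  by apply/andP; split; nra.
nra.
Qed.

(** The points of the inner contour have winding number [1] with respect to
    the rectangle. *)
Lemma rect_absorbs k h eta S (Z' : set R[i]) C g A S' b' h' dl :
  gap_small k eta -> eta <= 2^-1 -> edge k <= h -> is_rp RT (rec k h) S ->
  resfam (Z k `|` Z') RT C -> contour Z' g A -> is_rp RT g S' ->
  0 < dl -> dl <= edge k - b' -> dl <= h - h' -> (forall t, 0 <= t <= 1 -> box (- h') b' h' (g t)) ->
  forall x, S (S' x) = S' x /\ S' (S x) = S' x.
Proof.
move=> hk e1 hh hS hR cg hS' dl0 d1 d2 hbox x; have [k0 _] := hk; have b0 := edge_gt0 m0 r0 k0.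
have hb := edge_vert k0.
have c1 : contour (Z k `|` Z') (rec k h) _ := contour_sub (@subsetUl _ _ _) (rect_contour k0 hb hh).
have c2 : contour (Z k `|` Z') g _ := contour_sub (@subsetUr _ _ _) cg.
have E y : S (S' y) = S' y.
  rewrite -[RHS]scale1r.
  apply: (riesz_product hR c2 hS' c1 hS (@box_convex _ (- h') b' h') hbox dl0).
    by move=> v t hv ht; apply: (rect_dist (b' := b') (h' := h')) => //; lra.
  move=> v y'; rewrite mul1r => hv; apply: (wind_rect_in _ (e := dl)) => //;
    move: hv; rewrite /box /= ler_norml => /andP[/andP[v1 v2] /andP[v3 v4]]; lra.
by rewrite (rp_comm2 hR x c2 hS' c1 hS) E.
Qed.

Lemma rect_idem k h eta S : gap_small k eta -> eta <= 2^-1 -> 2 * edge k <= h -> is_rp RT (rec k h) S ->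
  forall x, S (S x) = S x.
Proof.
move=> hk e1 hh hS x; have [k0 _] := hk; have b0 := edge_gt0 m0 r0 k0; have p := r0 k0; have q := m0 k.
have hb : edge k <= h by lra.
have f2 : resfam (Z k `|` Z k) RT (2 / (rr k / 2)) by rewrite setUid; exact: (gap_resfam hk e1).
have hb' : m k + rr k / 2 <= m k + rr k / 2 <= edge k by rewrite lexx /right_edge /=; lra.
have hb2 : m k + rr k / 2 <= h / 2 by rewrite /right_edge in hh; lra.
have [] := rect_absorbs hk e1 hb hS f2 (rect_contour k0 hb' hb2) (shrink_rp hk e1 hh hS)
  (b' := m k + rr k / 2) (h' := h / 2) (half_gt0 k0) _ _ _ x => //.
- by rewrite /right_edge; lra.
- by rewrite /right_edge in hh; lra.
- by move=> t ht; apply: rect_box => //; lra.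
Qed.

Lemma rect_circ k h eta S S' : gap_small k eta -> eta <= 2^-1 -> 2 * edge k <= h -> is_rp RT (rec k h) S ->
  is_rp RT (cir k (rr k)) S' -> forall x, S (S' x) = S' x /\ S' (S x) = S' x.
Proof.
move=> hk e1 hh hS hS' x; have [k0 _] := hk; have b0 := edge_gt0 m0 r0 k0; have p := r0 k0; have q := m0 k.
have hb : edge k <= h by lra.
have f2 : resfam (Z k `|` Z k) RT (2 / (rr k / 2)) by rewrite setUid; exact: (gap_resfam hk e1).
have hr : rr k / 2 <= rr k / 2 <= rr k by lra.
apply: (rect_absorbs hk e1 hb hS f2 (circ_contour k0 hr) (half_rp hk e1 hS')
  (b' := m k + rr k / 2) (h' := h / 2) (half_gt0 k0)).
- by rewrite /right_edge; lra.
- by rewrite /right_edge in hh; lra.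
- move=> t ht; have hn := @circ_nr R (m k)%:C (rr k / 2) t (ltW (half_gt0 k0)).
  have h1 := nr_Re (cir k (rr k / 2) t - (m k)%:C); have h2 := nr_Im (cir k (rr k / 2) t - (m k)%:C).
  rewrite hn in h1 h2; move: h1 h2; rewrite /box /=; case: (cir k (rr k / 2) t) => a b /=.
  rewrite subr0 !ler_norml => /andP[a1 a2] /andP[b1 b2]; rewrite /right_edge in hh.
  by apply/andP; split; apply/andP; split; lra.
Qed.

Lemma rect_rect j k h h' eta S S' : gap_small k eta -> gap_small j eta -> eta <= 2^-1 -> (j < k)%N ->
  edge j <= h' -> 2 * h' <= h -> 2 * edge k <= h ->
  is_rp RT (rec k h) S -> is_rp RT (rec j h') S' -> forall x, S (S' x) = S' x /\ S' (S x) = S' x.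
Proof.
move=> hk hj e1 jk bj hh' hh hS hS' x; have [k0 _] := hk; have [j0 _] := hj.
have b0 := edge_gt0 m0 r0 k0; have p := r0 k0; have q := m0 k; have bj0 := edge_gt0 m0 r0 j0; have pj := r0 j0.
have hb : edge k <= h by lra.
have [C f2] := gap_resfam2 hk hj e1.
have hlt := edge_lt mmono rgap j0 k0 jk.
apply: (rect_absorbs hk e1 hb hS f2 (rect_contour j0 (edge_vert j0) bj) hS'
  (b' := edge j) (h' := h / 2) (half_gt0 k0)).
- by rewrite /right_edge in hlt *; lra.
- by rewrite /right_edge in hh; lra.
- move=> t ht; have := @rect_box R (- h') (edge j) h' t ltac:(lra) ltac:(lra) ht; rewrite /box /=.
  by move=> /andP[/andP[u1 u2] u3]; apply/andP; split; [apply/andP; split|]; lra.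
Qed.

(** The contour lies in a half-plane, a convex set whose points have winding
    number [0] with respect to the circle. *)
Lemma circ_left j k eta S g A S' : gap_small j eta -> gap_small k eta -> eta <= 2^-1 -> (j < k)%N ->
  is_rp RT (cir k (rr k)) S -> contour (Z j) g A -> is_rp RT g S' ->
  (forall t, 0 <= t <= 1 -> complex.Re (g t) <= edge j) ->
  forall x, S (S' x) = 0 /\ S' (S x) = 0.
Proof.
move=> hj hk e1 jk hS cg hS' hg x; have [k0 _] := hk; have [j0 _] := hj.
have p := r0 k0; have [C f2] := gap_resfam2 hj hk e1; have hlt := edge_lt mmono rgap j0 k0 jk.
have hr : rr k / 2 <= rr k / 2 <= rr k by lra.
have c1 : contour (Z j `|` Z k) g _ := contour_sub (@subsetUl _ _ _) cg.
have c2 : contour (Z j `|` Z k) (cir k (rr k / 2)) _ := contour_sub (@subsetUr _ _ _) (circ_contour k0 hr).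
have hS2 := half_rp hk e1 hS.
have far v : halfL (edge j) v -> rr k <= nr (v - (m k)%:C).
  rewrite /halfL /= => hv; have := nr_Re (v - (m k)%:C); case: v hv => a b /= hv.
  have := ler_norm (m k - a); rewrite distrC; lra.
have E y : S (S' y) = 0.
  rewrite -[RHS](scale0r (S' y)).
  apply: (riesz_product f2 c1 hS' c2 hS2 (@halfL_convex _ (edge j)) hg (half_gt0 k0)).
    move=> v t hv _; have := far v hv; have := @circ_nr R (m k)%:C (rr k / 2) t (ltW (half_gt0 k0)).
    have := nr_tri v (cir k (rr k / 2) t) (m k)%:C; rewrite [nr (v - circ _ _ _)]nrC; lra.
  move=> v y' hv; rewrite mul0r scale0r; apply: wind_circ_out; first by lra.
  have := far v hv; lra.
by rewrite (rp_comm2 f2 x c1 hS' c2 hS2) E.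
Qed.

End OneOperator.

(** * Spectral decomposition *)

Section TwoOperators.
Variables (D D' : set H) (c : H -> nat -> R[i]) (T A : operator H).
Hypothesis hT : model D c T.
Hypothesis hA : model D' (fun _ _ => 0) A.
Local Notation RT := (resolvent T).
Local Notation RA := (resolvent A).

Let half_gt0 k : (0 < k)%N -> 0 < rr k / 2.
Proof. by move=> k0; rewrite divr_gt0 ?r0. Qed.

(** [8] is half the bound of [circ_majorant]. *)
Lemma circ_diff k eta S S' : gap_small k eta -> eta <= 2^-1 ->
  is_rp RT (cir k (rr k)) S -> is_rp RA (cir k (rr k)) S' -> forall x, nr (S x - S' x) <= eta * 8 * nr x.
Proof.
move=> hk e1 hS hS' x; have [k0 h] := hk; have p := r0 k0.
have hr : rr k / 2 <= rr k <= rr k by lra.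
have [l1 cl1 z1] := circ_contour k0 hr.
have := rp_diff hT hA (half_gt0 k0) (fun j => weight_ge r0 rgap j k0) e1 h
  l1 cl1 z1 hS hS' (Cg := 16) (k0 := 0%N) (ler0n _ _).
have -> : eta * 8 = eta * 16 / 2 by field.
apply => // n _ j; apply: (circ_majorant (r := rr k)) => //.
- by rewrite nr_pos // ltW.
- move=> t; have := good_circ rgap k0 (z := cir k (rr k) t); rewrite circ_nr ?(ltW p) // => /(_ hr j) ->.
  by rewrite andbT; apply: le_trans (weight_ge r0 rgap j k0); rewrite ltW ?half_gt0.
- by move=> t; apply: (circ_ge rgap) => //; rewrite circ_nr // ltW.
Qed.

Lemma rect_diff k h eta S S' : gap_small k eta -> eta <= 2^-1 -> edge k <= h ->
  is_rp RT (rec k h) S -> is_rp RA (rec k h) S' -> forall x, nr (S x - S' x) <= eta * 8 * nr x.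
Proof.
move=> hk e1 hh hS hS' x; have [k0 hw] := hk; have p := r0 k0; have b0 := edge_gt0 m0 r0 k0.
have hb := edge_vert k0.
have [l1 cl1 z1] := rect_contour k0 hb hh.
have [n0 hn0] := archi (2 * h / (rr k / 2)).
have := rp_diff hT hA (half_gt0 k0) (fun j => weight_ge r0 rgap j k0) e1 hw
  l1 cl1 z1 hS hS' (Cg := 16) (k0 := n0) (ler0n _ _).
have -> : eta * 8 = eta * 16 / 2 by field.
have wv j := weight_vert mmono r0 rgap j k0 hb; have wg j := weight_ge r0 rgap j k0.
have h2 := half_gt0 k0.
apply => // n hn j; apply: rect_majorant => //.
- by move=> E; have := wv j; have := wg j; rewrite E subrr normr0; lra.
- exact: lt_le_trans (wg j).
- by move=> t ht; exact: (rect_far m0 mmono r0 rgap j k0 hb hh ht).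
- apply: le_trans (le_trans (wg j) (wv j)); rewrite ler_pdivrMr ?ltr0Sn //.
  rewrite ltr_pdivrMr // in hn0; apply: ltW; apply: lt_le_trans hn0 _.
  by rewrite mulrC ler_wpM2l ?(ltW h2) // ler_nat leqW.
Qed.

Lemma circ_unperturbed k eta S' : gap_small k eta -> eta <= 2^-1 -> is_rp RA (cir k (rr k)) S' ->
  forall x j, co (S' x) j = (j == k)%:R * co x j.
Proof.
move=> hk e1 hS'; have [k0 hw] := hk; have p := r0 k0.
have hr : rr k / 2 <= rr k <= rr k by lra.
have [l1 cl1 z1] := circ_contour k0 hr.
apply: (rp_diag hA (half_gt0 k0) (fun j => weight_ge r0 rgap j k0) e1 hw l1 cl1 z1 hS').
move=> j x; have [->|jk] := eqVneq j k.
  by rewrite mul1r; apply: wind_circ_in; rewrite subrr nr0.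
rewrite mul0r scale0r; apply: wind_circ_out; first by lra.
rewrite -rmorphB nrR distrC; have := rgap k0 jk; lra.
Qed.

Lemma rect_unperturbed k h eta S' : gap_small k eta -> eta <= 2^-1 -> edge k <= h -> is_rp RA (rec k h) S' ->
  forall x j, co (S' x) j = (j <= k)%N%:R * co x j.
Proof.
move=> hk e1 hh hS'; have [k0 hw] := hk; have p := r0 k0; have b0 := edge_gt0 m0 r0 k0; have mk0 := m0 k.
have hb := edge_vert k0.
have [l1 cl1 z1] := rect_contour k0 hb hh.
apply: (rp_diag hA (half_gt0 k0) (fun j => weight_ge r0 rgap j k0) e1 hw l1 cl1 z1 hS').
move=> j x; rewrite /right_edge in hh b0 *; have mj := m0 j; case: leqP => jk.
  have mjk : m j <= m k by move: jk; rewrite leq_eqVlt => /orP[/eqP->//|/mmono/ltW].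
  by rewrite mul1r; apply: (wind_rect_in _ (e := rr k)) => //=; lra.
have g := gap_gt mmono rgap k0 jk.
by rewrite mul0r scale0r; apply: wind_rect_out; lra.
Qed.


Hypothesis hok : forall eta : R, 0 < eta -> exists K, forall k, (K <= k)%N -> gap_small k eta.

(* small enough that three errors [8 * et] add up to less than [1] *)
Let et : R := 100^-1.
Let et0 : 0 < et. Proof. by rewrite /et; lra. Qed.
Let e1 : et <= 2^-1. Proof. by rewrite /et; lra. Qed.

Let famT k (hk : gap_small k et) := gap_resfam hT hk e1.
Let famA k (hk : gap_small k et) := gap_resfam hA hk e1.

Lemma circ_full k : (0 < k)%N -> contour (Z k) (cir k (rr k)) (nr (rr k)%:C * (4 * pi)).
Proof. by move=> k0; apply: (circ_contour k0); have := r0 k0; lra. Qed.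

Lemma rect_full k h : (0 < k)%N -> edge k <= h -> contour (Z k) (rec k h) (4 * (`|edge k - - h| + `|h - - h|)).
Proof. by move=> k0 hh; apply: (rect_contour k0 _ hh); exact: edge_vert. Qed.

Lemma rect_rp k h : gap_small k et -> edge k <= h ->
  exists V V', is_rp RT (rec k h) V /\ is_rp RA (rec k h) V'.
Proof.
move=> hk hh; have [k0 _] := hk; have cr := rect_full k0 hh.
by have [V hV] := rp_exists (famT hk) cr; have [V' hV'] := rp_exists (famA hk) cr; exists V, V'.
Qed.

Lemma circ_rp k : gap_small k et ->
  exists P P', is_rp RT (cir k (rr k)) P /\ is_rp RA (cir k (rr k)) P'.
Proof.
move=> hk; have [k0 _] := hk; have cr := circ_full k0.
by have [V hV] := rp_exists (famT hk) cr; have [V' hV'] := rp_exists (famA hk) cr; exists V, V'.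
Qed.

(** The difference [V' - V - P] is idempotent by the product rules. For the
    unperturbed operator the corresponding difference vanishes, so it is at
    most [24 * et] in norm, hence [0]. *)
Lemma rect_succ k h h' V V' P : (0 < k)%N -> gap_small k et -> gap_small k.+1 et ->
  2 * edge k <= h -> 2 * h <= h' -> 2 * edge k.+1 <= h' ->
  is_rp RT (rec k h) V -> is_rp RT (rec k.+1 h') V' -> is_rp RT (cir k.+1 (rr k.+1)) P ->
  forall x, V' x = V x + P x.
Proof.
move=> k0 hk hk1 b1 b2 b3 hV hV' hP x.
have bk := edge_gt0 m0 r0 k0; have bk1 := edge_gt0 m0 r0 (ltn0Sn k).
have [bh bh'] : edge k <= h /\ edge k.+1 <= h' by split; lra.
have cV := rect_full k0 bh; have cV' := rect_full (ltn0Sn k) bh'; have cP := circ_full (ltn0Sn k).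
have lV := rp_lin (famT hk) cV hV; have lV' := rp_lin (famT hk1) cV' hV'; have lP := rp_lin (famT hk1) cP hP.
have [_ [A1 [_ hA1]]] := rect_rp hk bh; have [_ [A2 [_ hA2]]] := rect_rp hk1 bh'.
have [_ [A3 [_ hA3]]] := circ_rp hk1.
have sum0 y : A2 y - A1 y - A3 y = 0.
  apply: total => j; rewrite !coB.
  rewrite (rect_unperturbed hk1 e1 bh' hA2).
  rewrite (rect_unperturbed hk e1 bh hA1).
  rewrite (circ_unperturbed hk1 e1 hA3).
  rewrite leq_eqVlt ltnS; case: eqVneq => [->|_] /=.
    by rewrite ltnn !mul1r mul0r subr0 subrr.
  by rewrite mul0r subr0 subrr.
pose Q y := V' y - V y - P y.
have VV := rect_idem hT hk e1 b1 hV.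
have VV' := rect_idem hT hk1 e1 b3 hV'.
have PP := circ_idem hT hk1 e1 hP.
have V'V y := (rect_rect hT hk1 hk e1 (ltnSn k) bh b2 b3 hV' hV y).
have V'P y := (rect_circ hT hk1 e1 b3 hV' hP y).
have PV y := (circ_left hT hk hk1 e1 (ltnSn k) hP cV hV _ y).
have hre t : 0 <= t <= 1 -> complex.Re (rec k h t) <= edge k.
  move=> ht; have := @rect_box R (- h) (edge k) h t ltac:(lra) ltac:(lra) ht.
  by rewrite /box /= => /andP[/andP[_ ->]].
suff : Q x = 0 by rewrite /Q => /eqP; rewrite subr_eq0 subr_eq addrC => /eqP.
apply: (@idem_small _ _ Q (24 * et)); first by rewrite /et; lra.
- move=> y; rewrite /Q.
  rewrite !(linB lV') !(linB lV) !(linB lP) VV' VV PP (V'V y).1 (V'V y).2 (V'P y).1 (V'P y).2.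
  rewrite (PV hre y).1 (PV hre y).2.
  by rewrite !subrr !subr0 subrr subr0.
- move=> y; have d1 := rect_diff hk1 e1 bh' hV' hA2 y.
  have d2 := rect_diff hk e1 bh hV hA1 y.
  have d3 := circ_diff hk1 e1 hP hA3 y.
  have -> : Q y = (V' y - A2 y) - (V y - A1 y) - (P y - A3 y).
    rewrite -[LHS]subr0 -(sum0 y) /Q !opprD !opprK.
    by rewrite [RHS](AC (2*2*2) ((1*3*5)*(2*4*6))).
  apply: le_trans (nrB _ _) _.
  have := nrB (V' y - A2 y) (V y - A1 y); move: d1 d2 d3.
  move: (nr (V' y - A2 y)) (nr (V y - A1 y)) (nr (P y - A3 y)) (nr _) (nr y) => a b d f g; lra.
Qed.

(** All indices start at [0]. Completeness: a vector [y] orthogonal to the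
    ranges is orthogonal to the ranges of the projections [V] of all larger
    rectangles, by [rect_succ]; and [V x] tends to [x], because it is close to
    the corresponding partial sum of [x], with an error controlled by the gap
    condition at the index of the rectangle. *)
Theorem spectral_decomposition : exists k0 h0, [/\ (0 < k0)%N, 0 < h0, op_spectrum T = point_spectrum T,
  (forall z, op_spectrum T z -> (- h0 < complex.Re z <= edge k0 /\ `|complex.Im z| <= h0) \/
     exists2 k, (k0 < k)%N & nr (z - (m k)%:C) < rr k) &
  exists (S S' : H -> H) (P P' : nat -> H -> H),
  [/\ is_riesz_projection T (rec k0 h0) S /\ is_riesz_projection A (rec k0 h0) S',
    forall k, (k0 < k)%N -> is_riesz_projection T (cir k (rr k)) (P k) /\ is_riesz_projection A (cir k (rr k)) (P' k),
    has_rank S k0.+1 /\ has_rank S' k0.+1,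
    forall k, (k0 < k)%N -> has_rank (P k) 1 /\ has_rank (P' k) 1 &
    [/\ (forall x, S (S x) = S x),
        (forall k x, (k0 < k)%N -> S (P k x) = 0 /\ P k (S x) = 0),
        (forall j k x, (k0 < j)%N -> (k0 < k)%N -> P j (P k x) = if j == k then P j x else 0) &
        forall y, (forall x, ip (S x) y = 0) -> (forall k x, (k0 < k)%N -> ip (P k x) y = 0) -> y = 0]]].
Proof.
have [K hK] := hok et0; pose k0 := K.+1.
have ok0 k : (k0 <= k)%N -> gap_small k et by move=> h; apply: hK; exact: ltnW.
have k00 : (0 < k0)%N by [].
have okk0 := ok0 k0 (leqnn _).
have b0 := edge_gt0 m0 r0 k00.
(* the factor [2] leaves room for the shrunk rectangle of [shrink_rp] *)
pose h0 := 2 * edge k0; have h00 : 0 < h0 by rewrite mulr_gt0.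
have bh0 : edge k0 <= h0 by rewrite /h0; lra.
have c0 := rect_full k00 bh0.
have [S [S' [hS hS']]] := rect_rp okk0 bh0.
have [P hP] : exists P : nat -> H -> H, forall k, (k0 <= k)%N -> is_rp RT (cir k (rr k)) (P k).
  have h k : exists p, (k0 <= k)%N -> is_rp RT (cir k (rr k)) p.
    have [hk|hk] := leqP k0 k; last by exists id.
    by have [p [_ [hp _]]] := circ_rp (ok0 k hk); exists p.
  by have [p hp] := choice h; exists p.
have [P' hP'] : exists p : nat -> H -> H, forall k, (k0 <= k)%N -> is_rp RA (cir k (rr k)) (p k).
  have h k : exists p, (k0 <= k)%N -> is_rp RA (cir k (rr k)) p.
    have [hk|hk] := leqP k0 k; last by exists id.
    by have [_ [p [_ hp]]] := circ_rp (ok0 k hk); exists p.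
  by have [p hp] := choice h; exists p.
have pos k : (k0 <= k)%N -> (0 < k)%N by exact: leq_trans.
have is_T k z (hk : (k0 <= k)%N) := gap_is_resolvent (z := z) hT (ok0 k hk) e1.
have is_A k z (hk : (k0 <= k)%N) := gap_is_resolvent (z := z) hA (ok0 k hk) e1.
have rpT k (hk : (k0 <= k)%N) g C1 S1 (cg : contour (Z k) g C1) (h : is_rp RT g S1) : is_riesz_projection T g S1 :=
  riesz_of_rp (famT (ok0 k hk)) (fun z => @is_T k z hk) cg h.
have rpA k (hk : (k0 <= k)%N) g C1 S1 (cg : contour (Z k) g C1) (h : is_rp RA g S1) : is_riesz_projection A g S1 :=
  riesz_of_rp (famA (ok0 k hk)) (fun z => @is_A k z hk) cg h.
have SS := rect_idem hT okk0 e1 (lexx _) hS.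
have SS' := rect_idem hA okk0 e1 (lexx _) hS'.
have PP k (hk : (k0 <= k)%N) := circ_idem hT (ok0 k hk) e1 (hP k hk).
have PP' k (hk : (k0 <= k)%N) := circ_idem hA (ok0 k hk) e1 (hP' k hk).
have lS : lin S := rp_lin (famT okk0) c0 hS; have lS' : lin S' := rp_lin (famA okk0) c0 hS'.
have lP k (hk : (k0 <= k)%N) : lin (P k) := rp_lin (famT (ok0 k hk)) (circ_full (pos k hk)) (hP k hk).
have lP' k (hk : (k0 <= k)%N) : lin (P' k) := rp_lin (famA (ok0 k hk)) (circ_full (pos k hk)) (hP' k hk).
have q1 : 0 <= et * 8 < 1 by rewrite /et; lra.
have rankS' : has_rank S' k0.+1.
  apply: (@rank_diag _ _ _ _ orth total S' (fun j => (j <= k0)%N%:R) k0.+1 (fun i => val i)).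
  - exact: val_inj.
  - by move=> i; rewrite -ltnS ltn_ord.
  - move=> k hk; case: leqP => // kk; exfalso; have := hk (Ordinal (kk : (k < k0.+1)%N)); by rewrite eqxx.
  - exact: (rect_unperturbed okk0 e1 bh0 hS').
have rankP' k : (k0 <= k)%N -> has_rank (P' k) 1.
  move=> hk; apply: (@rank_diag _ _ _ _ orth total (P' k) (fun j => (j == k)%:R) 1 (fun=> k)).
  - by move=> i j _; rewrite !ord1.
  - by move=> i; rewrite eqxx.
  - by move=> j /(_ ord0) /negbTE ->.
  - exact: (circ_unperturbed (ok0 k hk) e1 (hP' k hk)).
have SP k x : (k0 < k)%N -> S (P k x) = 0 /\ P k (S x) = 0.
  move=> hk.
  have [] := circ_left hT okk0 (ok0 k (ltnW hk)) e1 hk (hP k (ltnW hk)) c0 hS _ x => //.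
  move=> t ht; have := @rect_box R (- h0) (edge k0) h0 t ltac:(lra) ltac:(lra) ht.
  by rewrite /box /= => /andP[/andP[_ ->]].
have PPjk j k x : (k0 < j)%N -> (j < k)%N -> P j (P k x) = 0 /\ P k (P j x) = 0.
  move=> hj jk; have hk := ltnW (ltn_trans hj jk).
  have [] := circ_left hT (ok0 j (ltnW hj)) (ok0 k hk) e1 jk (hP k hk) (circ_full (pos j (ltnW hj))) (hP j (ltnW hj)) _ x => //.
  move=> t _; have := nr_Re (cir j (rr j) t - (m j)%:C); rewrite circ_nr ?(ltW (r0 (pos j (ltnW hj)))) //.
  rewrite /right_edge; case: (cir j (rr j) t) => a b /=.
  have := ler_norm (a - m j); lra.
(* rectangles of increasing height, so that each contour surrounds the
   preceding one at a distance *)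
have chain n : exists h V, [/\ 2 * edge (k0 + n)%N <= h, is_rp RT (rec (k0 + n)%N h) V &
    forall x, V x = S x + \sum_(i < n) P (k0 + i.+1)%N x].
  elim: n => [|n [h [V [hb hV hVx]]]].
    by exists h0, S; rewrite addn0; split => // x; rewrite big_ord0 addr0.
  have kn := leq_addr n k0; have kn1 := leq_addr n.+1 k0.
  have bn := edge_gt0 m0 r0 (pos _ kn); have bn1 := edge_gt0 m0 r0 (pos _ kn1).
  pose h' := 2 * h + 2 * edge (k0 + n.+1)%N.
  have bh' : edge (k0 + n.+1)%N <= h' by rewrite /h'; lra.
  have [V' [_ [hV' _]]] := rect_rp (ok0 _ kn1) bh'.
  exists h', V'; split => //; first by rewrite /h'; lra.
  move=> x; rewrite big_ord_recr /= addrA -hVx.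
  move: hV' bh' bn1 (hP _ kn1) (ok0 _ kn1); rewrite /h' addnS => hV' bh' bn1 hP1 ok1.
  by apply: (rect_succ (pos _ kn) (ok0 _ kn) ok1 hb _ _ hV hV' hP1); lra.
exists k0, h0; split => //.
- apply: (spectrum_point hT (dl := rr k0 / 2) (z0 := rec k0 h0 0) _ _ e1 okk0.2 minf).
  + by rewrite divr_gt0 ?r0.
  + by move=> j; exact: (weight_ge r0 rgap).
  + by have [_ _ h] := c0; apply: h; rewrite lexx ler01.
- move=> z hz; apply: contrapT => /not_orP[n1 n2].
  have [|k kk gz] := @good_cover _ _ _ m0 mmono r0 rgap minf k0 h0 z k00 bh0 n1.
    move=> k hk; rewrite leNgt; apply/negP => hlt; apply: n2; by exists k.
  apply: hz; exists (RT z); exact: (is_T k z kk gz).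
exists S, S', P, P'; split.
- by split; [exact: (rpT k0 (leqnn _) _ _ _ c0 hS)|exact: (rpA k0 (leqnn _) _ _ _ c0 hS')].
- move=> k /ltnW hk; have ck := circ_full (pos k hk).
  by split; [exact: (rpT k hk _ _ _ ck (hP k hk))|exact: (rpA k hk _ _ _ ck (hP' k hk))].
- split=> //; apply: (rank_close lS' lS q1 SS' SS _ rankS') => x; rewrite nrC.
  exact: (rect_diff okk0 e1 bh0 hS hS').
- move=> k /ltnW hk; split; last exact: rankP'.
  apply: (rank_close (lP' k hk) (lP k hk) q1 (PP' k hk) (PP k hk) _ (rankP' k hk)) => x; rewrite nrC.
  exact: (circ_diff (ok0 k hk) e1 (hP k hk) (hP' k hk)).
split => //.
- move=> j k x hj hk; have [jk|kj|<-] := ltngtP j k; last by rewrite PP // ltnW.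
    exact: (PPjk j k x hj jk).1.
  exact: (PPjk k j x hk kj).2.
move=> y yS yP.
suff h x : ip x y = 0 by apply: nr_eq0; apply/eqP; rewrite -sqrf_eq0 -complexC_eq0 -(ip_sqr hip) h.
apply: nr_eq0; apply/eqP; rewrite eq_le nr_ge0 andbT; apply: le_eps => eps eps0; rewrite add0r.
pose cc := nr y + 8 * nr x * nr y + 1.
have cc0 : 0 < cc by rewrite ltr_wpDl ?addr_ge0 ?mulr_ge0 ?nr_ge0.
pose eta := Num.min et (eps / cc).
have ec0 : 0 < eps / cc by rewrite divr_gt0.
have eta0 : 0 < eta by rewrite lt_min et0 ec0.
have eta1 : eta <= 2^-1 by apply: le_trans e1; rewrite ge_min lexx.
have eta2 : eta <= eps / cc by rewrite ge_min lexx orbT.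
have [K1 hK1] := hok eta0.
have [n1 hn1] := tends_part hip orth total x ec0.
pose n := maxn K1 n1; have [h [V [hb hV hVx]]] := chain n.
have kn := leq_addr n k0; have bn := edge_gt0 m0 r0 (pos _ kn).
have bh : edge (k0 + n)%N <= h by lra.
have [_ [V0 [_ hV0]]] := rect_rp (ok0 _ kn) bh.
have okn : gap_small (k0 + n)%N eta.
  by apply: hK1; apply: leq_trans (leq_addl _ _); exact: leq_maxl.
have d1 := rect_diff okn eta1 bh hV hV0 x.
have V0E : V0 x = part (k0 + n).+1 x.
  apply: (co_ext total) => j; rewrite (rect_unperturbed okn eta1 bh hV0) co_part // ltnS.
  by case: leqP; rewrite ?mul1r ?mul0r.
have d2 : nr (V0 x - x) <= eps / cc.
  by rewrite V0E; apply: hn1; apply: leq_trans (leq_maxr K1 n1) _; apply: leq_trans (leq_addl k0 n) _.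
have Vy : ip (V x) y = 0.
  rewrite hVx ipDl yS add0r ip_sum_l big1 // => i _.
  by rewrite yP // addnS ltnS leq_addr.
have -> : ip x y = - ip (V0 x - x) y - ip (V x - V0 x) y by rewrite !ipBl Vy; ring.
apply: le_trans (nrB _ _) _; rewrite nrN.
have d3 : nr (ip (V0 x - x) y) <= eps / cc * nr y.
  by apply: le_trans (cauchy_schwarz hip _ _) _; rewrite ler_wpM2r ?nr_ge0.
have d4 : nr (ip (V x - V0 x) y) <= eps / cc * 8 * nr x * nr y.
  apply: le_trans (cauchy_schwarz hip _ _) _; rewrite ler_wpM2r ?nr_ge0 //.
  by apply: le_trans d1 _; rewrite !ler_wpM2r ?nr_ge0.
apply: le_trans (lerD d3 d4) _.
have -> : eps / cc * nr y + eps / cc * 8 * nr x * nr y = eps * (nr y + 8 * nr x * nr y) / cc by ring.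
by rewrite ler_pdivrMr // ler_wpM2l ?(ltW eps0) // /cc lerDl.
Qed.

End TwoOperators.
End Assembly.
End Model.

(** * From the hypotheses to the coordinate description *)

Section GapRadius.
Variables (R : realType) (mu : nat -> R).
Hypothesis mono : forall m n, (0 < m)%N -> (m < n)%N -> mu m < mu n.

Lemma gap_radiusE k : (0 < k)%N ->
  gap_radius mu k.+1 = Num.min (mu k.+1 - mu k) (mu k.+2 - mu k.+1) / 2.
Proof. by case: k. Qed.

Lemma gap_radius_gt0 k : 0 < gap_radius mu k.+1.
Proof.
case: k => [|k]; first by rewrite /gap_radius /= divr_gt0 // subr_gt0 mono.
by rewrite gap_radiusE // divr_gt0 // lt_min !subr_gt0 !mono.
Qed.

Lemma mu_le i j : (i <= j)%N -> mu i.+1 <= mu j.+1.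
Proof. by rewrite leq_eqVlt => /orP[/eqP->//|h]; rewrite ltW // mono. Qed.

Lemma gap_radius_gap k j : (0 < k)%N -> j != k ->
  2 * gap_radius mu k.+1 <= `|mu k.+1 - mu j.+1|.
Proof.
move=> k0 jk; rewrite gap_radiusE // mulrC divfK // ge_min.
case: ltngtP jk => // [jk|kj] _; apply/orP; [left|right].
- have := @mu_le j k.-1; rewrite prednK // -ltnS prednK // => /(_ jk).
  have := ler_norm (mu k.+1 - mu j.+1); lra.
- have := @mu_le k.+1 j kj; have := ler_norm (mu j.+1 - mu k.+1); rewrite distrC; lra.
Qed.

End GapRadius.

Lemma nneseries_bounded (R : realType) (u : nat -> R) (P : pred nat) (S : \bar R) n :
  (forall j, 0 <= u j.+1) -> (\sum_(1 <= j <oo | P j) (u j)%:E <= S)%E ->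
  ((\sum_(j < n | P j.+1) u j.+1)%:E <= S)%E.
Proof.
move=> u0; apply: le_trans.
have h : forall j, (1 <= j)%N -> P j -> (0 <= (u j)%:E)%E.
  by case=> // j _ _; rewrite lee_fin.
have := @nneseries_lim_ge R (fun j => (u j)%:E) P 1%N n.+1 h.
rewrite sumEFin big_add1 /= big_mkord //.
Qed.
 
(** The form equation for [f] says that [B f] pairs with [B g] as [h] does
    with [g], which by self-adjointness of [B] means [B (B f) = h]. *)
Lemma form_operator_self (R : realType) (H : completeNormedModType R[i])
    (ip : {dot H for (@Num.conj R[i])}) (A B : operator H) :
  is_sqrt ip A B -> form_operator ip (dom B) (fun f g => ip (B f) (B g) + 0) A.
Proof.
move=> [saB _ hd hA] f h; have [_ _ hB] := saB; split=> [[df <-]|[df hf]].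
  have [d1 d2] := (hd f).1 df; split => // g dg.
  by rewrite addr0 hA // -(sa_sym saB dg d2).
suff [d2 h2] : dom B (B f) /\ B (B f) = h.
  have dA : dom A f by apply/hd.
  by rewrite hA.
apply/hB => g dg; rewrite ipC [RHS]ipC; congr (Num.conj _).
by have := hf g dg; rewrite addr0.
Qed.

(** If [mu] stayed below [K], all terms of the series would be at least
    [K `^ (- p)]. *)
Lemma powR_series_unbounded (R : realType) (mu : nat -> R) (p : R) :
  (forall n, (0 < n)%N -> 0 < mu n) ->
  (forall m n, (0 < m)%N -> (m < n)%N -> mu m < mu n) -> 0 < p ->
  (\sum_(1 <= n <oo) (mu n `^ (- p))%:E < +oo)%E ->
  forall K : R, exists M, forall k, (M <= k)%N -> K <= mu k.+1.
Proof.
move=> mu0 mono p0 hp K; apply: contrapT => hK.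
have lK k : mu k.+1 <= K.
  rewrite leNgt; apply/negP => h; apply: hK; exists k => j kj.
  by apply: le_trans (mu_le mono kj); exact: ltW.
have K0 : 0 < K by exact: lt_le_trans (mu0 1%N isT) (lK 0%N).
have [s hs] : exists s : R, (\sum_(1 <= n <oo) (mu n `^ (- p))%:E <= s%:E)%E.
  case: (\sum_(1 <= n <oo) _)%E hp => [s|//|] _; first by exists s.
  by exists 0; rewrite leNye.
pose c := (K `^ p)^-1; have c0 : 0 < c by rewrite invr_gt0 powR_gt0.
have [n hn] := archi (s / c).
have := @nneseries_bounded R (fun n => mu n `^ (- p)) xpredT s%:E n (fun j => powR_ge0 _ _) hs.
rewrite lee_fin leNgt => /negP; apply.
apply: lt_le_trans (_ : \sum_(j < n) c <= _).
  by rewrite sumr_const card_ord -[c *+ n]mulr_natl -ltr_pdivrMr.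
apply: ler_sum => j _; rewrite powRN lef_pV2 ?posrE ?powR_gt0 ?mu0 //.
by rewrite ge0_ler_powR ?nnegrE ?(ltW p0) ?(ltW K0) ?(ltW (mu0 _ _)) //; exact: lK.
Qed.

(** The weights are half the denominators of the gap expression, so that the
    weighted sums are at most twice its value. *)
Lemma gap_small_eventually (R : realType) (mu omega : nat -> R) :
  (forall m n, (0 < m)%N -> (m < n)%N -> mu m < mu n) ->
  (\sum_(1 <= j <oo | j != n) (omega j ^+ 2 / `|mu n - mu j|)%:E
     + (omega n ^+ 2 / gap_radius mu n)%:E)%E @[n --> \oo] --> 0%E ->
  forall eta : R, 0 < eta -> exists K, forall k, (K <= k)%N ->
    gap_small (fun j => mu j.+1) (fun j => omega j.+1) (fun k => gap_radius mu k.+1) k eta.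
Proof.
move=> mono hg eta eta0.
have e2 : (0%:E < (eta / 2)%:E)%E by rewrite lte_fin divr_gt0.
have [N _ hN] := hg _ (open_ereal_lt' e2).
exists N.+1 => k Nk; have k0 : (0 < k)%N by exact: leq_ltn_trans Nk.
split=> // n; have /= hk := hN k.+1 (leq_trans (ltnW Nk) (leqnSn k)).
set m := fun j => mu j.+1; set w := fun j => omega j.+1.
set rr := fun k => gap_radius mu k.+1.
have rk : 0 < rr k by exact: gap_radius_gt0.
set S := (\sum_(1 <= j <oo | _) _)%E in hk.
have hb := @nneseries_bounded R (fun j => omega j ^+ 2 / `|mu k.+1 - mu j|) (fun j => j != k.+1) S n
  (fun j => divr_ge0 (sqr_ge0 _) (normr_ge0 _)) (lexx _).
have {}hk : \sum_(j < n | j.+1 != k.+1) w j ^+ 2 / `|m k - m j| + w k ^+ 2 / rr k < eta / 2.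
  by rewrite -lte_fin EFinD; apply: le_lt_trans hk; rewrite leeD2r.
apply: le_trans (_ : 2 * (\sum_(j < n | j.+1 != k.+1) w j ^+ 2 / `|m k - m j| + w k ^+ 2 / rr k) <= _); last first.
  by move: hk; lra.
have half (x y : R) : x ^+ 2 / (y / 2) = 2 * (x ^+ 2 / y) by rewrite invf_div mulrCA.
rewrite (bigID (fun j : 'I_n => j != k :> nat)) /= mulrDr mulr_sumr; apply: lerD.
  apply: le_of_eq; apply: eq_big => j; first by rewrite eqSS.
  by move=> jk; rewrite /weight (negbTE jk) half.
have [kn|nk] := ltnP k n; last first.
  rewrite big1 => [|j]; first by rewrite mulr_ge0 // divr_ge0 ?sqr_ge0 // ltW.
  rewrite negbK => /eqP jk.
  by have := ltn_ord j; rewrite jk ltnNge nk.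
rewrite (big_pred1 (Ordinal kn)) => [|j]; last by rewrite negbK.
by rewrite /weight eqxx half.
Qed.
Theorem proposition3p3 (R : realType) (H : completeNormedModType R[i])
    (ip : {dot H for (@Num.conj R[i])})
    (A B T : operator H) (mu omega : nat -> R) (psi : nat -> H)
    (v : H -> H -> R[i]) (p : R) :
  hilbert_norm ip -> separable_hilbert H -> infinite_dimensional H ->
  self_adjoint ip A -> compact_resolvent A ->
  (forall n, (0 < n)%N -> 0 < mu n) ->
  (forall m n, (0 < m)%N -> (m < n)%N -> mu m < mu n) ->
  op_spectrum A = [set (mu n)%:C | n in [set n | (0 < n)%N]] ->
  (forall n, (0 < n)%N -> simple_eigenvalue A (mu n)%:C) ->
  (forall n, (0 < n)%N -> op_eigenspace A (mu n)%:C (psi n) /\ `|psi n| = 1) ->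
  is_sqrt ip A B ->
  bounded_form B v ->
  (forall j, (0 < j)%N -> 0 <= omega j) ->
  (forall j k, (0 < j)%N -> (0 < k)%N ->
     `|v (psi j) (psi k)| <= (omega j * omega k)%:C) ->
  (\sum_(1 <= j <oo) (omega j ^+ 2 / mu j)%:E < +oo)%E ->
  0 < p ->
  (\sum_(1 <= n <oo) (mu n `^ (- p))%:E < +oo)%E ->
  (\sum_(1 <= j <oo | j != n) (omega j ^+ 2 / `|mu n - mu j|)%:E
     + (omega n ^+ 2 / gap_radius mu n)%:E)%E @[n --> \oo] --> 0%E ->
  form_operator ip (dom B) (fun f g => ip (B f) (B g) + v f g) T ->
  exists (N0 : nat) (h1 h2 : R),
    [/\ (0 < N0)%N, 0 < h1, 0 < h2,
        op_spectrum T = point_spectrum T /\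
        point_spectrum T `<=`
          Pi0 mu N0 h1 h2 `|`
          \bigcup_(k in [set k | (N0 < k)%N]) PiDisc mu k
      & exists (S0 S00 : H -> H) (P P0 : nat -> H -> H),
        [/\ is_riesz_projection T (Gamma0 mu N0 h1 h2) S0 /\
            is_riesz_projection A (Gamma0 mu N0 h1 h2) S00,
            (forall n, (N0 < n)%N ->
               is_riesz_projection T (Gamma mu n) (P n) /\
               is_riesz_projection A (Gamma mu n) (P0 n)),
            has_rank S0 N0 /\ has_rank S00 N0,
            (forall n, (N0 < n)%N -> has_rank (P n) 1 /\ has_rank (P0 n) 1)
          & let J := [set k | k = 0%N \/ (N0 < k)%N] in
            let Q := fun k => if k == 0%N then S0 else P k in
            disjoint_system J Q /\ complete_system ip J Q]].
Proof.
move=> hip _ _ saA cptA mu0 mono spA simA eA sqB bv om0 hv homega p0 hp hgap fT.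
pose m j := mu j.+1; pose w j := omega j.+1; pose e j := psi j.+1.
pose rr k := gap_radius mu k.+1.
have m0 j : 0 < m j by exact: mu0.
have mmono i j : (i < j)%N -> m i < m j by move=> ij; exact: mono.
have minj i j : m i = m j -> i = j.
  by move=> mij; case: (ltngtP i j) => // /mmono; rewrite mij ltxx.
have spA' : op_spectrum A = [set z | exists j, z = (m j)%:C].
  rewrite spA; apply/seteqP; split=> [_ [[//|j] _ <-]|_ [j ->]]; first by exists j.
  by exists j.+1.
have simA' j : simple_eigenvalue A (m j)%:C by exact: simA.
have eA' j : op_eigenspace A (m j)%:C (e j) /\ `|e j| = 1 by exact: eA.
have w0 j : 0 <= w j by exact: om0.
have hv' j k : `|v (e j) (e k)| <= (w j * w k)%:C by exact: hv.
have orth := eig_orth hip saA minj eA'.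
have total := eig_total hip saA cptA m0 minj spA' simA' eA' sqB.
have [S0 hS0] : exists S0 : R, forall n, \sum_(j < n) w j ^+ 2 / m j <= S0.
  case E : (\sum_(1 <= j <oo) _)%E homega => [s|//|] _.
    exists s => n; rewrite -lee_fin -E.
    exact: (@nneseries_bounded R (fun j => omega j ^+ 2 / mu j) xpredT _ n
      (fun j => divr_ge0 (sqr_ge0 _) (ltW (m0 j))) (lexx _)).
  have := @nneseries_bounded R (fun j => omega j ^+ 2 / mu j) xpredT -oo%E 0%N
    (fun j => divr_ge0 (sqr_ge0 _) (ltW (m0 j))).
  by rewrite E => /(_ (lexx _)).
have r0 k : (0 < k)%N -> 0 < rr k by move=> _; exact: gap_radius_gt0.
have rgap k j : (0 < k)%N -> j != k -> 2 * rr k <= `|m k - m j| by exact: gap_radius_gap.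
have minf := powR_series_unbounded mu0 mono p0 hp.
have hok := gap_small_eventually mono hgap.
have domB := dom_BP hip saA cptA m0 minj spA' simA' eA' sqB.
have eB k : dom B (e k) by have [] := eig_B hip m0 eA' sqB k.
have hT : model ip e m w (dom B) (fun f k => v f (e k)) T.
  split=> [//|a f f' k df df'|f k s|f h].
  - exact: (form_linl bv).
  - exact: (form_bound hip saA cptA m0 minj spA' simA' eA' sqB bv w0 hv').
  - exact: (form_opP hip saA cptA m0 minj spA' simA' eA' sqB bv fT).
have b0 : bounded_form B (fun _ _ => 0 : R[i]).
  split; first by split=> *; rewrite mulr0 addr0.
  by exists 0 => f g _ _; rewrite normr0 mul0r mul0r.
have hA : model ip e m w (dom B) (fun _ _ => 0) A.
  split=> [//|a f f' k _ _|f k s _ hs|f h].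
  - by rewrite mulr0 addr0.
  - by rewrite nr0 mulr_ge0 //; have := hs 0%N; rewrite big_ord0.
  - exact: (form_opP hip saA cptA m0 minj spA' simA' eA' sqB b0 (form_operator_self sqB)).
have GammaE k : Gamma mu k.+1 = circ (m k)%:C (rr k)%:C.
  by apply/funext => t; apply/eqP; rewrite eq_complex /= !mul0r subr0 !addr0 add0r !eqxx.
have [k0 [h0 [_ h00 spT cover [S [S' [P [P' [rS rP kS kP [SS SP PP cmpl]]]]]]]]] :=
  spectral_decomposition hip orth total m0 w0 hS0 mmono minf r0 rgap hT hA hok.
exists k0.+1, h0, h0; split=> //.
  split=> // z; rewrite -spT => /cover[[h1 h2]|[k hk h1]]; first by left.
  by right; exists k.+1 => //=; rewrite /PiDisc /= nrE ltcR.
exists S, S', (fun n => P n.-1), (fun n => P' n.-1); split=> //.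
- by move=> [|n] // hn; rewrite GammaE; exact: rP.
- by move=> [|n] // hn; exact: kP.
split=> [[|j] [|k] hj hk x /=|y hy].
- exact: SS.
- by case: hk => // hk; have [] := SP k x hk.
- by case: hj => // hj; have [] := SP j x hj.
- by case: hj hk => // hj [//|hk]; rewrite eqSS; exact: PP.
apply: cmpl => [x|k x hk]; first by apply: (hy 0%N x); left.
by apply: (hy k.+1 x); right.
Qed.
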